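(* Consider the multivariate linear structural errors-in-variables model $$y = b + C^{T} z + B^{T}\xi + e + \epsilon,\qquad x = \xi + \delta,$$ where $y,e,\epsilon$ take values in $\mathbb{R}^d$, $z$ in $\mathbb{R}^q$, $\xi,\delta,x$ in $\mathbb{R}^m$, and $b\in\mathbb{R}^d$, $C\in\mathbb{R}^{q\times d}$, $B\in\mathbb{R}^{m\times d}$ are nonrandom. Assume: (i) the random vectors $z$, $\xi$, $e$ and $(\epsilon^T,\delta^T)^T$ are independent with finite second moments ($\epsilon$ and $\delta$ may be correlated with each other); (ii) the covariance matrices $\Sigma_z=\mathbf{Cov}(z)$ and $\Sigma_x=\mathbf{Cov}(x)$ are nonsingular; (iii) $e$, $\epsilon$, $\delta$ have zero means; (iv) $\epsilon,\delta,\xi$ are jointly Gaussian. Suppose that $\Sigma_{\epsilon\delta}=\mathbf{E}\,\epsilon\delta^T$ is the only model parameter which is known. Let $(y_i,z_i,\xi_i,e_i,\epsilon_i,x_i,\delta_i)$, $i=0,1,2,\dots$, be independent copies of the model; put $\eta_0=\mathbf{E}[y_0\mid z_0,\xi_0]$ and let $\hat\eta_0=\mathbf{E}[\eta_0\mid z_0,x_0]$ be the best mean predictor. Define $$\tilde\eta_0=\tilde y_0-\Sigma_{\epsilon\delta}\hat\Sigma_x^{-1}(x_0-\hat\mu),$$ where $\tilde y_0$ is the OLS predictor (defined in the context) and $$\hat\mu=\bar x=\frac1n\sum_{i=1}^n x_i,\qquad \hat\Sigma_x=\frac1{n-1}\sum_{i=1}^n(x_i-\bar x)(x_i-\bar x)^T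 .$$ Then $\tilde\eta_0$ is a strongly consistent estimator of $\hat\eta_0$, i.e. $\tilde\eta_0\to\hat\eta_0$ almost surely as $n\to\infty$, and moreover $$\forall\,\tau>0,\qquad \mathbf{P}\big(\|\tilde\eta_0-\hat\eta_0\|>\tau\,\big|\,z_0,x_0\big)\to0\quad\text{a.s. as }n\to\infty.$$
   Context: All vectors are columns. For variables $u,v$, $\bar u=\frac1n\sum_{i=1}^n u_i$ and $S_{uv}=\frac1n\sum_{i=1}^n (u_i-\bar u)(v_i-\bar v)^T$. $A^{+}$ denotes the (Moore–Penrose) pseudo-inverse. With $r=(z^T,x^T)^T$, the OLS estimators are $$\begin{pmatrix}\hat C\\ \hat B_x\end{pmatrix}=S_{rr}^{+}S_{ry},\qquad \hat b_x=\bar y-\hat C^T\bar z-\hat B_x^T\bar x ,$$ and the OLS predictor, built from $(y_i,z_i,x_i)$, $i=1,\dots,n$, and $(z_0,x_0)$, is $\tilde y_0=\hat b_x+\hat C^Tz_0+\hat B_x^Tx_0$. The inverse $\hat\Sigma_x^{-1}$ is understood for $n\ge m+1$, when $\hat\Sigma_x$ is almost surely invertible. *)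

(* Defs.v *)
From HB Require Import structures.
From mathcomp Require Import all_boot all_order all_algebra.
From mathcomp Require Import finmap.
From mathcomp Require Import all_classical all_reals all_analysis.

Set Implicit Arguments.
Unset Strict Implicit.
Unset Printing Implicit Defensive.

Import Order.TTheory GRing.Theory Num.Theory.
Import numFieldNormedType.Exports.

Local Open Scope classical_set_scope.
Local Open Scope ring_scope.

(* R^k carries the sigma-algebra generated by the coordinates, i.e. its Borel
   sigma-algebra (for k = 0 the trivial one). *)
Definition cV_display : measure_display -> measure_display.
Proof. exact. Qed.

Section measurable_cV.
Context {R : realType} (k : nat).

Let coords (i : 'I_k) (v : 'cV[R]_k) : R := v i 0.

Let cV_set0 : g_sigma_preimage coords set0.
Proof. exact: sigma_algebra0. Qed.

Let cV_setC A : g_sigma_preimage coords A -> g_sigma_preimage coords (~` A).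
Proof. exact: sigma_algebraC. Qed.

Let cV_bigcup (F : _^nat) : (forall i, g_sigma_preimage coords (F i)) ->
  g_sigma_preimage coords (\bigcup_i (F i)).
Proof. exact: sigma_algebra_bigcup. Qed.

HB.instance Definition _ := @isMeasurable.Build (cV_display default_measure_display)
  'cV[R]_k (g_sigma_preimage coords) cV_set0 cV_setC cV_bigcup.

End measurable_cV.

Section pseudo_inverse.
Context {R : realType}.

Definition penrose m n (A : 'M[R]_(m, n)) (X : 'M[R]_(n, m)) : Prop :=
  [/\ A *m X *m A = A, X *m A *m X = X,
      (A *m X)^T = A *m X & (X *m A)^T = X *m A].

Definition mp_inv m n (A : 'M[R]_(m, n)) : 'M[R]_(n, m) :=
  xget 0 [set X | penrose A X].

Lemma gram_unit m n (G : 'M[R]_(m, n)) : row_free G -> G *m G^T \in unitmx.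
Proof.
move=> Gfree; rewrite -row_free_unit; apply/row_freeP.
have /row_freeP[D GD] : row_free (G *m G^T).
  rewrite -kermx_eq0; apply/eqP/row_matrixP => i; rewrite row0.
  set v := row i _.
  have v0 : v *m (G *m G^T) = 0 by rewrite -row_mul mulmx_ker row0.
  have vG0 : v *m G = 0.
    have h : (v *m G) *m (v *m G)^T = 0.
      by rewrite trmx_mul mulmxA -(mulmxA v) v0 mul0mx.
    apply/rowP => j; rewrite [RHS]mxE.
    have := congr1 (fun M : 'M[R]_1 => M 0 0) h; rewrite mxE [RHS]mxE => /eqP.
    under eq_bigr do rewrite [X in _ * X]mxE -expr2.
    rewrite psumr_eq0 => [/allP/(_ j)|l _]; last exact: sqr_ge0.
    by rewrite mem_index_enum sqrf_eq0 => /(_ isT)/eqP.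
  by move: vG0; rewrite -(mul0mx _ G) => /(row_free_inj Gfree).
by exists D.
Qed.

Lemma penrose_mp_inv m n (A : 'M[R]_(m, n)) : penrose A (mp_inv A).
Proof.
suff [X AX] : exists X, [set X | penrose A X] X by exact: (xgetI 0 AX).
have [r [F [G [AE freeF freeG]]]] : exists r (F : 'M[R]_(m, r)) (G : 'M[R]_(r, n)),
    [/\ A = F *m G, row_free F^T & row_free G].
  exists (\rank A), (col_base A), (row_base A); rewrite mulmx_base row_base_free.
  by split=> //; rewrite /row_free mxrank_tr; exact: (col_base_full A).
have uG : G *m G^T \in unitmx by exact: gram_unit.
have uF : F^T *m F \in unitmx by rewrite -{2}(trmxK F); exact: gram_unit.
set U := G *m G^T in uG; set V := F^T *m F in uF.
have UT : (invmx U)^T = invmx U by rewrite trmx_inv trmx_mul trmxK.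
have VT : (invmx V)^T = invmx V by rewrite trmx_inv trmx_mul trmxK.
pose X := G^T *m (invmx U *m (invmx V *m F^T)).
have AX : A *m X = F *m (invmx V *m F^T).
  by rewrite AE /X -!mulmxA (mulmxA G) (mulmxA U) mulmxV// mul1mx.
have XA : X *m A = G^T *m (invmx U *m G).
  by rewrite AE /X -!mulmxA (mulmxA F^T) (mulmxA (invmx V)) mulVmx// mul1mx.
exists X; split.
- by rewrite AX AE -!mulmxA (mulmxA F^T) (mulmxA (invmx V)) mulVmx// mul1mx.
- by rewrite XA /X -!mulmxA (mulmxA G) (mulmxA (invmx U) U) mulVmx// mul1mx.
- by rewrite AX !trmx_mul VT trmxK mulmxA.
- by rewrite XA !trmx_mul UT trmxK mulmxA.
Qed.

Lemma penrose_unique m n (A : 'M[R]_(m, n)) X Y :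
  penrose A X -> penrose A Y -> X = Y.
Proof.
move=> [AXA XAX AXT XAT] [AYA YAY AYT YAT].
have AXY : A *m X = A *m Y.
  by rewrite -AXT -{1}AYA -mulmxA trmx_mul AXT AYT mulmxA AXA.
have XYA : X *m A = Y *m A.
  by rewrite -XAT -{1}AYA !mulmxA -mulmxA trmx_mul XAT YAT -mulmxA (mulmxA A) AXA.
by rewrite -XAX -mulmxA AXY mulmxA XYA YAY.
Qed.

End pseudo_inverse.

Section probability_notions.
Context d (T : measurableType d) (R : realType) (P : probability T R).

Definition mutually_independent (I : choiceType) (F : I -> set (set T)) : Prop :=
  forall (J : {fset I}) (E : I -> set T), (forall i, i \in J -> F i (E i)) ->
    P (\bigcap_(i in [set` J]) E i) = (\prod_(i <- J) P (E i))%E.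

Definition identically_distributed d' (T' : measurableType d')
    (X Y : T -> T') : Prop :=
  forall A, measurable A -> P (X @^-1` A) = P (Y @^-1` A).

Definition independent_copies d' (T' : measurableType d')
    (X : T -> T') (Xs : nat -> T -> T') : Prop :=
  mutually_independent (fun i => g_sigma_algebra_preimage (Xs i)) /\
  forall i, identically_distributed (Xs i) X.

Definition cov_mx k (X : T -> 'cV[R]_k) : 'M[R]_k :=
  \matrix_(i, j) fine (covariance P (fun w => X w i 0) (fun w => X w j 0)).

Definition cross_moment k l (X : T -> 'cV[R]_k) (Y : T -> 'cV[R]_l) :
    'M[R]_(k, l) :=
  \matrix_(i, j) fine 'E_P[fun w => (X w *m (Y w)^T) i j]%E.

Definition finite_second_moment k (X : T -> 'cV[R]_k) : Prop :=
  forall i, (fun w => X w i 0) \in Lfun P 2%:E.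

Definition zero_mean k (X : T -> 'cV[R]_k) : Prop :=
  forall i, 'E_P[fun w => X w i 0%R]%E = 0%E.

(* normal_prob m 0 is not a point mass in the library (its density is then that
   of the uniform law on [0, 1]), so the degenerate case is treated apart. *)
Definition gaussian_law (m s : R) (A : set R) : \bar R :=
  if s == 0 then \d_m A else normal_prob m s A.

Definition gaussian_rv (X : T -> R) : Prop :=
  exists m s : R, 0 <= s /\
    forall A, measurable A -> P (X @^-1` A) = gaussian_law m s A.

(* Singular covariance matrices are allowed. *)
Definition gaussian_vector k (X : T -> 'cV[R]_k) : Prop :=
  forall a : 'cV[R]_k, gaussian_rv (fun w => (a^T *m X w) 0 0).

(* Y is a version of E[X | V]. *)
Definition cond_expectation d' (T' : measurableType d') (V : T -> T')
    (X Y : T -> R) : Prop :=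
  [/\ measurable_fun [set: g_sigma_algebra_preimageType V] Y,
      P.-integrable [set: T] (EFin \o Y) &
      forall A, g_sigma_algebra_preimage V A ->
        (\int[P]_(w in A) (Y w)%:E = \int[P]_(w in A) (X w)%:E)%E].

Definition cond_expectation_cV d' (T' : measurableType d') (V : T -> T') k
    (X Y : T -> 'cV[R]_k) : Prop :=
  forall i, cond_expectation V (fun w => X w i 0) (fun w => Y w i 0).

Definition cond_probability d' (T' : measurableType d') (V : T -> T')
    (E : set T) (p : T -> R) : Prop :=
  cond_expectation V (\1_E) p.

End probability_notions.

Definition enorm {R : realType} k (v : 'cV[R]_k) : R :=
  Num.sqrt (\sum_i v i 0 ^+ 2).

Section estimators.
Context {R : realType}.

(* Sequences of observations are indexed by nat; the sample of size n consists
   of the observations 1, ..., n, the index 0 being kept for the unit whose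
   response is predicted. *)
Definition sample_mean n k (u : nat -> 'cV[R]_k) : 'cV[R]_k :=
  n%:R^-1 *: \sum_(1 <= i < n.+1) u i.

Definition sample_cov n k l (u : nat -> 'cV[R]_k) (v : nat -> 'cV[R]_l) :
    'M[R]_(k, l) :=
  n%:R^-1 *: \sum_(1 <= i < n.+1)
    (u i - sample_mean n u) *m (v i - sample_mean n v)^T.

Context (d q m : nat) (n : nat).
Context (y : nat -> 'cV[R]_d) (z : nat -> 'cV[R]_q) (x : nat -> 'cV[R]_m).

Definition ols_coef : 'M[R]_(q + m, d) :=
  let r i := col_mx (z i) (x i) in mp_inv (sample_cov n r r) *m sample_cov n r y.

Definition ols_C : 'M[R]_(q, d) := usubmx ols_coef.

Definition ols_B : 'M[R]_(m, d) := dsubmx ols_coef.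

Definition ols_b : 'cV[R]_d :=
  sample_mean n y - ols_C^T *m sample_mean n z - ols_B^T *m sample_mean n x.

Definition ols_predictor (z0 : 'cV[R]_q) (x0 : 'cV[R]_m) : 'cV[R]_d :=
  ols_b + ols_C^T *m z0 + ols_B^T *m x0.

Definition Sigma_x_hat : 'M[R]_m :=
  (n%:R - 1)^-1 *: \sum_(1 <= i < n.+1)
    (x i - sample_mean n x) *m (x i - sample_mean n x)^T.

(* invmx is the inverse only on invertible matrices, so for n <= m this is a
   dummy value. *)
Definition eta_tilde (Sigma_eps_delta : 'M[R]_(d, m))
    (z0 : 'cV[R]_q) (x0 : 'cV[R]_m) : 'cV[R]_d :=
  ols_predictor z0 x0
    - Sigma_eps_delta *m invmx Sigma_x_hat *m (x0 - sample_mean n x).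

End estimators.

Record eiv_model dT (T : measurableType dT) (R : realType) (P : probability T R)
    (d q m : nat) (b : 'cV[R]_d) (C : 'M[R]_(q, d)) (B : 'M[R]_(m, d))
    (y : {RV P >-> 'cV[R]_d}) (z : {RV P >-> 'cV[R]_q})
    (xi : {RV P >-> 'cV[R]_m}) (e eps : {RV P >-> 'cV[R]_d})
    (x delta : {RV P >-> 'cV[R]_m}) : Prop := EivModel {
  eiv_response : forall w, y w = b + C^T *m z w + B^T *m xi w + e w + eps w;
  eiv_surrogate : forall w, x w = xi w + delta w;
  eiv_indep : mutually_independent P (tnth
    [tuple g_sigma_algebra_preimage z; g_sigma_algebra_preimage xi;
           g_sigma_algebra_preimage e;
           g_sigma_algebra_preimage (fun w => (eps w, delta w))]);
  eiv_moment_z : finite_second_moment P z;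
  eiv_moment_xi : finite_second_moment P xi;
  eiv_moment_e : finite_second_moment P e;
  eiv_moment_eps : finite_second_moment P eps;
  eiv_moment_delta : finite_second_moment P delta;
  eiv_cov_z : cov_mx P z \in unitmx;
  eiv_cov_x : cov_mx P x \in unitmx;
  eiv_mean_e : zero_mean P e;
  eiv_mean_eps : zero_mean P eps;
  eiv_mean_delta : zero_mean P delta;
  eiv_gaussian :
    gaussian_vector P (fun w => col_mx (eps w) (col_mx (delta w) (xi w)))
}.

(* Main.v *)
(* With G the limit of S_rr^+ S_ry, the strong law of large numbers gives
   G = (C, Sigma_x^-1 (Sigma_xi B + Sigma_epsdelta^T)), because z is uncorrelated with x. The
   correction by Sigma_epsdelta turns the limit of the OLS predictor into
     b + C^T z_0 + B^T (mu + Sigma_xi Sigma_x^-1 (x_0 - mu)),   mu = E xi.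
   This is the best predictor: eta_0 = b + C^T z_0 + B^T xi_0, and the error of the linear
   prediction of xi_0 from x_0 is Gaussian and uncorrelated with x_0, hence independent of
   (z_0, x_0). The conditional probabilities converge to 0 along any choice of versions because
   the events { tau < |error_n| } almost surely occur finitely often. *)

Require Import Defs.

From HB Require Import structures.
From mathcomp Require Import all_boot all_order all_algebra.
From mathcomp Require Import finmap.
From mathcomp Require Import all_classical all_reals all_analysis.
From mathcomp Require Import measurable_realfun.
From mathcomp Require Import ring lra.

Set Implicit Arguments.
Unset Strict Implicit.
Unset Printing Implicit Defensive.

Import Order.TTheory GRing.Theory Num.Theory.
Import numFieldNormedType.Exports.

Local Open Scope classical_set_scope.
Local Open Scope ring_scope.

(** * Expectation and independence *)

(** The Gaussian hypothesis is stated through one-dimensional projections, so no joint density is at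
    hand. Independence of the prediction error U from x is replaced by what conditional expectations
    require, E[U 1_A(x)] = 0. This comes from a symmetry: (U, x) and (-U, x) have the same
    projections, since a Gaussian law is fixed by its first two moments, hence the same law by the
    Cramer-Wold device, itself proved with real cosines. The pseudo-inverse and the inverse are
    discontinuous, and the former is defined by choice. Both are replaced by the adjugate over the
    determinant, with which they agree once the determinants are nonzero, hence almost surely for
    large n because Sigma_z and Sigma_x are nonsingular. The same rational formula yields the limit
    and the measurability. The conditional probabilities are arbitrary versions, one for each n, of
    events not known to be measurable. These events are enclosed in measurable ones, and a maximal
    inequality over first passages gives the almost sure convergence, which convergence in mean
    would not. *)

Lemma dynkin_ind (T : Type) (G Q : set (set T)) :
  setI_closed G -> G `<=` Q -> Q setT ->
  (forall A, Q A -> Q (~` A)) ->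
  (forall F : (set T)^nat, trivIset setT F -> (forall i, Q (F i)) ->
    Q (\bigcup_i F i)) ->
  <<s G >> `<=` Q.
Proof.
move=> GI GQ QT QC QU; rewrite -setI_closed_g_dynkin_g_sigma_algebra//.
by apply: smallest_sub => //; split.
Qed.

(** Rectangles form a pi-system generating the product sigma-algebra. Intersecting [Q] with the
    measurable sets before the Dynkin argument is what allows measurability to be assumed in the
    complement and union steps. *)
Lemma measurable_prod_ind d1 d2 (T1 : measurableType d1) (T2 : measurableType d2)
    (Q : set (set (T1 * T2))) :
  (forall A B, measurable A -> measurable B -> Q (A `*` B)) ->
  (forall A, measurable A -> Q A -> Q (~` A)) ->
  (forall F : (set (T1 * T2))^nat, trivIset setT F ->
    (forall i, measurable (F i)) -> (forall i, Q (F i)) -> Q (\bigcup_i F i)) ->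
  measurable `<=` Q.
Proof.
move=> QX QC QU A mA.
suff [] : (measurable `&` Q) A by [].
move: A mA; rewrite {1}measurable_prod_measurableType; apply: dynkin_ind.
- move=> _ _ [A mA [B mB <-]] [C mC [D mD <-]].
  exists (A `&` C); first exact: measurableI.
  by exists (B `&` D); [exact: measurableI|rewrite setXI].
- by move=> _ [A mA [B mB <-]]; split; [exact: measurableX|exact: QX].
- by split; [exact: measurableT|rewrite -setXTT; exact: QX].
- by move=> A [mA QA]; split; [exact: measurableC|exact: QC].
- move=> F tF QF; split; first by apply: bigcupT_measurable => i; case: (QF i).
  by apply: QU => // i; case: (QF i).
Qed.

Section real_expectation.
Context d (T : measurableType d) (R : realType) (P : probability T R).
Implicit Types X Y : T -> R.

Definition intg X := P.-integrable setT (EFin \o X).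

Definition Ex X : R := \int[P]_w X w.

Lemma ExE X : intg X -> (Ex X)%:E = (\int[P]_w (X w)%:E)%E.
Proof. by move=> iX; rewrite /Ex /Rintegral fineK// integrable_fin_num. Qed.

Lemma ExpectationE X : fine ('E_P[X])%E = Ex X.
Proof. by rewrite unlock. Qed.

Lemma intg_meas X : intg X -> measurable_fun setT X.
Proof. by move=> /measurable_int/measurable_EFinP. Qed.

Lemma intgD X Y : intg X -> intg Y -> intg (fun w => X w + Y w).
Proof. by move=> iX iY; exact: (integrableD _ iX iY). Qed.

Lemma intgZ c X : intg X -> intg (fun w => c * X w).
Proof. by move=> iX; exact: (integrableZl _ c iX). Qed.

Lemma intgB X Y : intg X -> intg Y -> intg (fun w => X w - Y w).
Proof. by move=> iX iY; exact: (integrableB _ iX iY). Qed.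

Lemma intg_sum (I : Type) (s : seq I) (p : pred I) (X : I -> T -> R) :
  (forall i, p i -> intg (X i)) -> intg (fun w => \sum_(i <- s | p i) X i w).
Proof.
move=> iX; rewrite /intg.
have -> : EFin \o (fun w => \sum_(i <- s | p i) X i w) =
    fun w => (\sum_(i <- s | p i) (X i w)%:E)%E.
  by apply/funext => w /=; rewrite sumEFin.
by apply: integrable_sum => // i pi; exact: iX.
Qed.

Lemma intg_bounded X M : measurable_fun setT X -> (forall w, `|X w| <= M) ->
  intg X.
Proof.
move=> mX XM; apply: measurable_bounded_integrable => //.
  exact: fin_num_fun_lty.
by exists M; split; rewrite ?num_real// => x Mx w _; rewrite /= (le_trans (XM w))// ltW.
Qed.

Lemma intg_cst c : intg (fun=> c).
Proof. by apply: (@intg_bounded _ `|c|). Qed.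

Lemma le_intg X Y : measurable_fun setT X -> (forall w, `|X w| <= `|Y w|) ->
  intg Y -> intg X.
Proof.
move=> mX XY; apply: le_integrable => //; first exact/measurable_EFinP.
by move=> w _; rewrite /= lee_fin.
Qed.

Lemma ExD X Y : intg X -> intg Y -> Ex (fun w => X w + Y w) = Ex X + Ex Y.
Proof. exact: RintegralD. Qed.

Lemma ExB X Y : intg X -> intg Y -> Ex (fun w => X w - Y w) = Ex X - Ex Y.
Proof. exact: RintegralB. Qed.

Lemma ExZ c X : intg X -> Ex (fun w => c * X w) = c * Ex X.
Proof. exact: RintegralZl. Qed.

Lemma Ex_cst c : Ex (fun=> c) = c.
Proof. by rewrite /Ex Rintegral_cst//= probability_setT mulr1. Qed.

Lemma Ex_sum (I : Type) (s : seq I) (X : I -> T -> R) :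
  (forall i, intg (X i)) -> Ex (fun w => \sum_(i <- s) X i w) = \sum_(i <- s) Ex (X i).
Proof.
move=> iX; elim: s => [|i s IH].
  by rewrite big_nil -[RHS]Ex_cst; congr Ex; apply/funext => w; rewrite big_nil.
rewrite big_cons -IH -ExD//; last by apply: intg_sum.
by congr Ex; apply/funext => w; rewrite big_cons.
Qed.

Lemma Ex_ge0 X : (forall w, 0 <= X w) -> 0 <= Ex X.
Proof. by move=> X0; apply: Rintegral_ge0. Qed.

Lemma le_Ex X Y : intg X -> intg Y -> (forall w, X w <= Y w) -> Ex X <= Ex Y.
Proof. by move=> iX iY XY; apply: le_Rintegral. Qed.

Lemma intg_indic A : measurable A -> intg (\1_A).
Proof.
by move=> mA; apply: (@intg_bounded _ 1) => // w; rewrite indicE normr_nat lern1 leq_b1.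
Qed.

Lemma intgM_indic X A : measurable A -> intg X -> intg (fun w => X w * \1_A w).
Proof.
move=> mA iX; apply: (@le_intg _ X) => //.
  by apply: measurable_funM => //; exact: intg_meas.
move=> w; rewrite normrM ler_piMr// indicE.
by case: (_ \in _); rewrite ?normr1 ?normr0.
Qed.

Lemma Ex_indic A : measurable A -> Ex (\1_A) = fine (P A).
Proof. by move=> mA; rewrite /Ex /Rintegral integral_indic// setIT. Qed.

Lemma Ex_dominated (X_ : nat -> T -> R) X Y : (forall n, measurable_fun setT (X_ n)) ->
  measurable_fun setT X -> intg Y -> (forall n w, `|X_ n w| <= Y w) ->
  (forall w, X_ ^~ w @ \oo --> X w) ->
  (fun n => Ex (X_ n)) @ \oo --> Ex X.
Proof.
move=> mX_ mX iY XY cX.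
have [] := @dominated_convergence _ T R P setT measurableT
  (fun n => EFin \o X_ n) (EFin \o X) (EFin \o Y).
- by move=> n; exact/measurable_EFinP.
- exact/measurable_EFinP.
- by apply: aeW => w _; apply: cvg_EFin; [exact: nearW|exact: cX].
- exact: iY.
- by apply: aeW => w n _; rewrite /= lee_fin.
move=> iX _ h; apply: fine_cvg; rewrite fineK; last exact: integrable_fin_num.
exact: h.
Qed.

Lemma Ex_indic_bigcup X (F : (set T)^nat) : intg X -> trivIset setT F ->
  (forall i, measurable (F i)) -> (forall i, Ex (fun w => X w * \1_(F i) w) = 0) ->
  Ex (fun w => X w * \1_(\bigcup_i F i) w) = 0.
Proof.
move=> iX tF mF F0.
have mUF : measurable (\bigcup_i F i) by exact: bigcupT_measurable.
have E A : measurable A -> (\int[P]_(w in A) (X w)%:E)%E = (Ex (fun w => X w * \1_A w))%:E.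
  move=> mA; rewrite ExE; last exact: intgM_indic.
  rewrite integral_mkcond; apply: eq_integral => w _ /=.
  rewrite patchE indicE; case: ifPn => _; first by rewrite mulr1.
  by rewrite mulr0.
apply: EFin_inj; rewrite -E// integral_bigcup//; last exact: integrableS iX.
by apply: eseries0 => i _ _; rewrite E// F0.
Qed.

End real_expectation.

Section independence.
Context d (T : measurableType d) (R : realType) (P : probability T R).

Definition indep2 d1 d2 (T1 : measurableType d1) (T2 : measurableType d2)
    (X : T -> T1) (Y : T -> T2) :=
  forall A B, measurable A -> measurable B ->
    P (X @^-1` A `&` Y @^-1` B) = (P (X @^-1` A) * P (Y @^-1` B))%E.

Lemma indep2_comp d1 d2 d3 d4 (T1 : measurableType d1) (T2 : measurableType d2)
    (T3 : measurableType d3) (T4 : measurableType d4)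
    (X : T -> T1) (Y : T -> T2) (f : T1 -> T3) (g : T2 -> T4) :
  measurable_fun setT f -> measurable_fun setT g ->
  indep2 X Y -> indep2 (fun w => f (X w)) (fun w => g (Y w)).
Proof.
move=> mf mg XY A B mA mB.
have mfA : measurable (f @^-1` A) by rewrite -[_ @^-1` _]setTI; exact: mf.
have mgB : measurable (g @^-1` B) by rewrite -[_ @^-1` _]setTI; exact: mg.
exact: (XY _ _ mfA mgB).
Qed.

(** Dynkin induction on the event of the pair. The hypothesis keeps the joint probability of [Y] and
    [Z] unfactored, so these two may depend on each other. *)
Lemma indep2_pair d1 d2 d3 (T1 : measurableType d1) (T2 : measurableType d2)
    (T3 : measurableType d3) (X : T -> T1) (Y : T -> T2) (Z : T -> T3) :
  measurable_fun setT X -> measurable_fun setT Y -> measurable_fun setT Z ->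
  (forall A B C, measurable A -> measurable B -> measurable C ->
    P (X @^-1` A `&` (Y @^-1` B `&` Z @^-1` C)) =
    (P (X @^-1` A) * P (Y @^-1` B `&` Z @^-1` C))%E) ->
  indep2 X (fun w => (Y w, Z w)).
Proof.
move=> mX mY mZ XYZ A C mA; pose YZ w := (Y w, Z w); move: C.
change (measurable `<=` [set C |
  P (X @^-1` A `&` YZ @^-1` C) = (P (X @^-1` A) * P (YZ @^-1` C))%E]).
have mYZ : measurable_fun setT YZ by exact: measurable_fun_pair.
have mXA : measurable (X @^-1` A) by rewrite -[_ @^-1` _]setTI; exact: mX.
have mpre C : measurable C -> measurable (YZ @^-1` C).
  by move=> mC; rewrite -[_ @^-1` _]setTI; exact: mYZ.
apply: measurable_prod_ind => [B C mB mC|C mC E|F tF mF E] /=.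
- have -> : YZ @^-1` (B `*` C) = Y @^-1` B `&` Z @^-1` C by [].
  exact: XYZ.
- rewrite preimage_setC.
  have -> : X @^-1` A `&` ~` (YZ @^-1` C) =
      X @^-1` A `\` (X @^-1` A `&` YZ @^-1` C).
    by apply/seteqP; split=> w [? h]; split=> //; [case|move=> ?; apply: h].
  have mC' := mpre _ mC.
  have mXC : measurable (X @^-1` A `&` YZ @^-1` C) by exact: measurableI.
  have -> : P (X @^-1` A `\` (X @^-1` A `&` YZ @^-1` C)) =
      (P (X @^-1` A) - P (X @^-1` A `&` YZ @^-1` C))%E.
    rewrite [LHS]measureD//; first by rewrite setIA setIid.
    by rewrite (le_lt_trans (probability_le1 _ _))// ltry.
  rewrite E probability_setC// muleBr ?mule1//.
  exact: fin_num_measure.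
- have tYZ : trivIset setT (fun i => YZ @^-1` F i).
    by move=> i j _ _ [w [Fi Fj]]; apply: (tF _ _ I I); exists (YZ w).
  rewrite preimage_bigcup setI_bigcupr.
  have -> : P (\bigcup_i (YZ @^-1` F i)) = (\sum_(i <oo) P (YZ @^-1` F i))%E.
    rewrite measure_bigcup//; last by move=> i _; exact: mpre.
    by apply: eq_eseriesl => i; rewrite in_setT.
  have -> : P (\bigcup_i (X @^-1` A `&` YZ @^-1` F i)) =
      (\sum_(i <oo) P (X @^-1` A `&` YZ @^-1` F i))%E.
    rewrite measure_bigcup//; last 2 first.
    - by move=> i _; apply: measurableI => //; exact: mpre.
    - exact: trivIset_setIl.
    by apply: eq_eseriesl => i; rewrite in_setT.
  have PXA : P (X @^-1` A) \is a fin_num by exact: fin_num_measure.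
  rewrite -(fineK PXA) -nneseriesZl//.
  by apply: eq_eseriesr => i _; rewrite E// fineK.
Qed.

End independence.

Section transfer.
Context d (T : measurableType d) d' (T' : measurableType d') (R : realType).
Context (P : probability T R) (Q : probability T' R).
Context d1 (T1 : measurableType d1) (X : T -> T1) (Y : T' -> T1).
Hypothesis mX : measurable_fun setT X.
Hypothesis mY : measurable_fun setT Y.
Hypothesis XY : forall A, measurable A -> P (X @^-1` A) = Q (Y @^-1` A).

Let X' : {mfun T >-> T1} := HB.pack X (isMeasurableFun.Build _ _ _ _ X mX).
Let Y' : {mfun T' >-> T1} := HB.pack Y (isMeasurableFun.Build _ _ _ _ Y mY).

(** Both sides are integrals against the common image law. The two spaces may differ: besides
    passing from the model to its copies, transfer moves Gaussian integrals to the standard normal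
    law on the line. *)
Lemma ge0_integral_transfer (f : T1 -> \bar R) :
  measurable_fun setT f -> (forall x, 0 <= f x)%E ->
  (\int[P]_w f (X w) = \int[Q]_w f (Y w))%E.
Proof.
move=> mf f0.
rewrite -(@ge0_integral_distribution _ _ _ _ _ P X')//.
rewrite -(@ge0_integral_distribution _ _ _ _ _ Q Y')//.
by apply: eq_measure_integral => A mA _; exact: XY.
Qed.

Lemma intg_transfer (f : T1 -> R) : measurable_fun setT f ->
  intg P (fun w => f (X w)) -> intg Q (fun w => f (Y w)).
Proof.
move=> mf /integrableP[_ ifX]; apply/integrableP; split.
  by apply/measurable_EFinP; exact: measurableT_comp.
rewrite -(@ge0_integral_transfer (fun x => `|(f x)%:E|%E))//.
by apply: measurableT_comp => //; exact/measurable_EFinP.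
Qed.

Lemma Ex_transfer (f : T1 -> R) : measurable_fun setT f ->
  intg P (fun w => f (X w)) -> Ex P (fun w => f (X w)) = Ex Q (fun w => f (Y w)).
Proof.
move=> mf ifX; have ifY := intg_transfer mf ifX.
apply: EFin_inj; rewrite !ExE//.
rewrite -(@integral_distribution _ _ _ _ _ P X' (EFin \o f))//; last exact/measurable_EFinP.
rewrite -(@integral_distribution _ _ _ _ _ Q Y' (EFin \o f))//; last exact/measurable_EFinP.
by apply: eq_measure_integral => A mA _; exact: XY.
Qed.

End transfer.

Section independent_product.
Context d (T : measurableType d) (R : realType) (P : probability T R).
Variables X Y : T -> R.
Hypotheses (iX : intg P X) (iY : intg P Y) (XY : indep2 P X Y).

Let mX := intg_meas iX.
Let mY := intg_meas iY.
Let Z w := (X w, Y w).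
Let mZ : measurable_fun setT Z. Proof. exact: measurable_fun_pair. Qed.

Let X' : {mfun T >-> R} := HB.pack X (isMeasurableFun.Build _ _ _ _ X mX).
Let Y' : {mfun T >-> R} := HB.pack Y (isMeasurableFun.Build _ _ _ _ Y mY).
Let Z' : {mfun T >-> (R * R)%type} := HB.pack Z (isMeasurableFun.Build _ _ _ _ Z mZ).

Let PX := distribution P X'.
Let PY := distribution P Y'.

(** Independence makes the joint law agree with the product of the marginals on rectangles, and the
    product measure is determined there. *)
Let law_pair A : measurable A -> (PX \x PY)%E A = distribution P Z' A.
Proof.
apply: product_measure_unique => B C mB mC.
rewrite /= /PX /PY /distribution /pushforward /=.
exact: XY.
Qed.

Let mul (z : R * R) : R := z.1 * z.2.

Let mmul : measurable_fun setT mul.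
Proof. exact: measurable_funM. Qed.

Let iXd : PX.-integrable setT (EFin \o (@id R)).
Proof.
apply/integrableP; split; first exact/measurable_EFinP.
rewrite ge0_integral_distribution//; last by apply: measurableT_comp => //; exact/measurable_EFinP.
by case/integrableP : iX.
Qed.

Let iYd : PY.-integrable setT (EFin \o (@id R)).
Proof.
apply/integrableP; split; first exact/measurable_EFinP.
rewrite ge0_integral_distribution//; last by apply: measurableT_comp => //; exact/measurable_EFinP.
by case/integrableP : iY.
Qed.

Let imul : (PX \x PY)%E.-integrable setT (EFin \o mul).
Proof.
apply/integrable12ltyP; first exact/measurable_EFinP.
have -> : (\int[PX]_x \int[PY]_y `|(EFin \o mul) (x, y)| =
    \int[PX]_x (`|x|%:E * \int[PY]_y `|y|%:E))%E.
  apply: eq_integral => x _; rewrite -ge0_integralZl//.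
  - by apply: eq_integral => y _; rewrite /= normrM EFinM.
  - by apply: measurableT_comp => //; exact: measurableT_comp.
rewrite ge0_integralZr//; last 2 first.
- by apply: measurableT_comp => //; exact: measurableT_comp.
- exact: integral_ge0.
rewrite lte_mul_pinfty//; first exact: integral_ge0.
  by case/integrableP : iXd => ? h; rewrite ge0_fin_numE//; exact: integral_ge0.
by case/integrableP : iYd.
Qed.

(** Integrability under the product law is Tonelli's theorem and is carried back along [law_pair],
    so that first moments suffice. *)
Lemma intgM_indep : intg P (fun w => X w * Y w).
Proof.
apply/integrableP; split; first by apply/measurable_EFinP; exact: measurable_funM.
case/integrableP : imul => _.
rewrite (eq_measure_integral (distribution P Z')); last by move=> A mA _; exact: law_pair.
rewrite ge0_integral_distribution//.
by do 2 apply: measurableT_comp => //.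
Qed.

Lemma ExM_indep : Ex P (fun w => X w * Y w) = Ex P X * Ex P Y.
Proof.
apply: EFin_inj; rewrite EFinM !ExE//; last exact: intgM_indep.
transitivity (\int[distribution P Z']_z (mul z)%:E)%E.
  rewrite integral_distribution//; first exact/measurable_EFinP.
  exact: intgM_indep.
transitivity (\int[PX \x PY]_z (mul z)%:E)%E.
  by apply: eq_measure_integral => A mA _; apply/esym; exact: law_pair.
rewrite -integral12_prod_meas1//.
have FE x : fubini_F PY (fun z => (mul z)%:E) x = (x * Ex P Y)%:E.
  rewrite EFinM ExE// /fubini_F.
  have -> : (\int[P]_w (Y w)%:E = \int[PY]_y y%:E)%E.
    by rewrite (@integral_distribution _ _ _ _ _ P Y' EFin).
  by rewrite -integralZl.
have -> : (\int[P]_w (X w)%:E = \int[PX]_x x%:E)%E.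
  by rewrite (@integral_distribution _ _ _ _ _ P X' EFin).
rewrite -(ExE iY) -integralZr//.
by apply: eq_integral => x _; rewrite FE EFinM.
Qed.

End independent_product.

(** * The strong law of large numbers *)

Lemma bernoulli_ge (R : realFieldType) (h : R) n : 0 <= h -> 1 + h *+ n <= (1 + h) ^+ n.
Proof.
move=> h0; elim: n => [|n IH]; first by rewrite mulr0n addr0 expr0.
rewrite exprS mulrSr; apply: le_trans (_ : (1 + h) * (1 + h *+ n) <= _).
  have : 0 <= h * (h *+ n) by rewrite mulr_ge0// mulrn_wge0.
  by move: (h *+ n) => u; nra.
by rewrite ler_wpM2l// addr_ge0.
Qed.

Lemma expr_unbounded (R : realType) (a M : R) : 1 < a -> exists n, M < a ^+ n.
Proof.
move=> a1; have h0 : 0 < a - 1 by rewrite subr_gt0.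
exists (Num.truncn (M / (a - 1))).+1.
have := bernoulli_ge (Num.truncn (M / (a - 1))).+1 (ltW h0).
have -> : 1 + (a - 1) = a by rewrite addrC subrK.
apply: lt_le_trans.
apply: (@lt_trans _ _ ((a - 1) *+ (Num.truncn (M / (a - 1))).+1)); last by rewrite ltrDr.
rewrite -mulr_natr mulrC -ltr_pdivrMr//.
by apply: real_truncnS_gt; rewrite num_real.
Qed.

Section geometric_sums.
Variables (R : realType) (a : R).
Hypothesis a1 : 1 < a.

Let a0 : 0 < a. Proof. exact: lt_trans a1. Qed.
Let an0 n : 0 < a ^+ n. Proof. exact: exprn_gt0. Qed.

(** With g(n) = min(1, x / a^n), each nonzero term equals a/(a-1) (g(n) - g(n+1)): the sum
    telescopes, with a bound uniform in x. *)
Lemma sum_geometric_tail (x : R) N : 0 <= x ->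
  \sum_(0 <= n < N) (x <= a ^+ n)%R%:R * x / a ^+ n <= a / (a - 1).
Proof.
move=> x0; pose g n := Num.min 1 (x / a ^+ n).
have step n : (x <= a ^+ n)%R%:R * x / a ^+ n <= a / (a - 1) * (g n - g n.+1).
  have c0 : 0 < a / (a - 1) by rewrite divr_gt0// subr_gt0.
  have gle : x / a ^+ n.+1 <= x / a ^+ n.
    by rewrite ler_wpM2l// lef_pV2 ?posrE// ler_eXn2l// ltnW.
  have [xa|ax] := leP x (a ^+ n); last first.
    rewrite !mul0r mulr_ge0 ?(ltW c0)// subr_ge0 /g.
    by rewrite le_min ge_min lexx /= ge_min gle orbT.
  have g1 : x / a ^+ n <= 1 by rewrite ler_pdivrMr// mul1r.
  rewrite /g (min_idPr g1) (min_idPr (le_trans gle g1)) exprS.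
  have an := lt0r_neq0 (an0 n); have an' := lt0r_neq0 a0.
  have an'' : a - 1 != 0 by rewrite subr_eq0 gt_eqF.
  rewrite mul1r le_eqVlt; apply/orP; left; apply/eqP; field.
  by rewrite an an' an''.
apply: (@le_trans _ _ (\sum_(0 <= n < N) a / (a - 1) * (g n - g n.+1))).
  exact: ler_sum.
have c0 : 0 <= a / (a - 1) by rewrite divr_ge0 ?subr_ge0// ltW.
rewrite -mulr_sumr -[X in _ <= X]mulr1 ler_wpM2l//.
have -> : \sum_(0 <= n < N) (g n - g n.+1) = g 0%N - g N.
  elim: N => [|N IH]; first by rewrite big_nil subrr.
  by rewrite big_nat_recr//= IH addrA subrK.
rewrite lerBlDr (le_trans (_ : _ <= 1)) ?ge_min ?lexx// lerDl /g le_min ler01/=.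
by rewrite divr_ge0// ltW.
Qed.

(** The same telescoping with h(n) = min(a^n, a x), since a^(n+1) - a^n = (a-1) a^n. The cap a x,
    rather than x, keeps the increment intact at the last power below x. *)
Lemma sum_geometric_head (x : R) N : 0 <= x ->
  \sum_(0 <= n < N) (a ^+ n < x)%R%:R * a ^+ n <= a / (a - 1) * x.
Proof.
move=> x0; pose h n := Num.min (a ^+ n) (a * x).
have am1 : 0 < a - 1 by rewrite subr_gt0.
have step n : (a ^+ n < x)%R%:R * a ^+ n <= (a - 1)^-1 * (h n.+1 - h n).
  have [ax|xa] := ltP (a ^+ n) x; last first.
    rewrite mul0r mulr_ge0 ?invr_ge0 ?(ltW am1)// subr_ge0 /h.
    rewrite le_min !ge_min lexx orbT andbT.
    by rewrite ler_eXn2l// leqnSn.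
  have h1 : a ^+ n.+1 <= a * x by rewrite exprS ler_pM2l// ltW.
  have h0 : a ^+ n <= a * x by rewrite (le_trans _ h1)// ler_eXn2l// leqnSn.
  rewrite /h (min_idPl h1) (min_idPl h0) mul1r.
  have -> : a ^+ n.+1 - a ^+ n = (a - 1) * a ^+ n by rewrite exprS mulrBl mul1r.
  by rewrite mulKf// gt_eqF.
apply: (@le_trans _ _ (\sum_(0 <= n < N) (a - 1)^-1 * (h n.+1 - h n))).
  exact: ler_sum.
rewrite -mulr_sumr telescope_sumr//.
have c0 : 0 <= (a - 1)^-1 by rewrite invr_ge0 ltW.
rewrite -mulrA mulrCA ler_wpM2l//.
rewrite lerBlDr (le_trans (_ : _ <= a * x)) ?ge_min ?lexx ?orbT// lerDl /h le_min.
by rewrite ltW//= mulr_ge0// ltW.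
Qed.

End geometric_sums.

(** Between consecutive powers of a, monotonicity of [t] costs a factor at most a, so every limit
    point of t(n)/n lies in [mu/a, a mu]; letting a = 1 + 1/(j+1) decrease to 1 closes the gap. *)
Lemma cvg_along_geometric (R : realType) (t : nat -> R) (mu : R) :
  (forall i j, (i <= j)%N -> t i <= t j) -> (forall i, 0 <= t i) -> 0 <= mu ->
  (forall j, let a : R := 1 + j.+1%:R^-1 in
    (fun n => t (Num.truncn (a ^+ n)) / a ^+ n) @ \oo --> mu) ->
  (fun n => n%:R^-1 * t n) @ \oo --> mu.
Proof.
move=> tnd t0 mu0 H; apply/cvgrPdistC_le => eps eps0.
(* This [j] makes h mu at most eps/4; the upper bound a (mu + del) then exceeds mu by at most 3
   eps/4. *)
pose j := Num.truncn (4 * mu / eps).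
pose h : R := j.+1%:R^-1; pose a := 1 + h; pose del := eps / 4.
have h0 : 0 < h by rewrite invr_gt0.
have h1 : h <= 1 by rewrite invf_le1// ler1n.
have hmu : h * mu <= del.
  have : 4 * mu / eps <= j.+1%:R by rewrite ltW// real_truncnS_gt// num_real.
  rewrite ler_pdivrMr// => E; rewrite mulrC ler_pdivrMr// /del.
  by have := E; lra.
have del0 : 0 < del by rewrite divr_gt0.
have a1 : 1 < a by rewrite ltrDl.
have a0 : 0 < a by exact: lt_trans a1.
have an0 n : 0 < a ^+ n by exact: exprn_gt0.
have [n0 _ Hn0] : \forall n \near \oo, `|t (Num.truncn (a ^+ n)) / a ^+ n - mu| <= del.
  by move/cvgrPdistC_le : (H j); apply.
have [N0 N0a] : exists N0 : nat, a ^+ n0 <= N0%:R.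
  by exists (Num.truncn (a ^+ n0)).+1; rewrite ltW// real_truncnS_gt// num_real.
exists N0.+1 => // N /= N0N.
have N1 : (0 < N)%N by exact: leq_ltn_trans N0N.
have exm : exists m, N%:R < a ^+ m by exact: expr_unbounded.
(* The least exponent m with N < a^m is not 0, as N >= 1; its predecessor n gives a^n <= N <
   a^(n+1). *)
case: (ex_minnP exm) => -[|n]; first by rewrite expr0 ltNge ler1n N1.
move=> Nan min_n.
have anN : a ^+ n <= N%:R by rewrite leNgt; apply/negP => /min_n; rewrite ltnn.
have n0n : (n0 <= n)%N.
  rewrite -ltnS -(ltr_eXn2l a1) (le_lt_trans N0a)// (le_lt_trans _ Nan)// ler_nat.
  exact: ltnW.
have NR0 : (0 : R) < N%:R by rewrite ltr0n.
have := Hn0 n n0n; have := Hn0 n.+1 (leqW n0n).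
set v1 := _ / _; set v0 := _ / _ => /= Hv1 Hv0.
have up : N%:R^-1 * t N <= a * v1.
  have -> : a * v1 = t (Num.truncn (a ^+ n.+1)) / a ^+ n.
    by rewrite /v1 [in X in _ / X]exprS invfM mulrCA mulVKf// gt_eqF.
  rewrite mulrC ler_pM// ?invr_ge0 ?ler0n//; last by rewrite lef_pV2 ?posrE.
  by apply: tnd; rewrite truncn_ge_nat ?ltW// ltW.
have lo : v0 / a <= N%:R^-1 * t N.
  rewrite /v0 -mulrA -invfM -exprSr mulrC.
  rewrite ler_pM// ?invr_ge0 ?(ltW (an0 _))//; first by rewrite lef_pV2 ?posrE// ltW.
  by apply: tnd; rewrite -(ler_nat R) (le_trans _ anN)// truncn_le ltW.
move: Hv1 Hv0; rewrite !ler_norml => /andP[_ Hv1] /andP[Hv0 _].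
have Ee : eps = 4 * del by rewrite /del; field.
have Hv0' : v0 >= mu - del by lra.
have Hv1' : v1 <= mu + del by lra.
apply/andP; split.
  rewrite lerBrDr (le_trans _ lo)// ler_pdivlMr//.
  apply: le_trans Hv0'; rewrite /a.
  have E : 0 <= h * del by rewrite mulr_ge0 ?ltW.
  by rewrite Ee; lra.
rewrite lerBlDr (le_trans up)//.
apply: (@le_trans _ _ (a * (mu + del))); first by rewrite ler_pM2l.
have E : h * del <= del by rewrite ger_pMl.
by rewrite /a Ee; lra.
Qed.

Section probability_inequalities.
Context d (T : measurableType d) (R : realType) (P : probability T R).

Lemma borel_cantelli_ae (F : (set T)^nat) (M : R) : (forall n, measurable (F n)) ->
  (forall N, \sum_(0 <= n < N) fine (P (F n)) <= M) ->
  {ae P, forall w, \forall n \near \oo, ~ F n w}.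
Proof.
move=> mF FM.
have P0 : P (lim_sup_set F) = 0%E.
  apply: lim_sup_set_cvg0 => //; apply: (@le_lt_trans _ _ M%:E); last by rewrite ltry.
  apply: lime_le; first exact: is_cvg_nneseries.
  apply: nearW => N; have := FM N; rewrite -lee_fin -sumEFin.
  by under eq_bigr do rewrite fineK ?fin_num_measure//.
exists (lim_sup_set F); split=> //.
  by apply: bigcapT_measurable => n; apply: bigcup_measurable.
move=> w /= nw n _; apply: contrapT => h; apply: nw; exists n => //= k nk Fk.
by apply: h; exists k.
Qed.

Lemma chebyshev_sq (D : T -> R) c : measurable_fun setT D ->
  intg P (fun w => D w ^+ 2) -> 0 < c ->
  fine (P [set w | c <= `|D w|]) <= Ex P (fun w => D w ^+ 2) / c ^+ 2.
Proof.
move=> mD iD c0.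
have mB : measurable [set w | c <= `|D w|].
  rewrite -[X in measurable X]setTI; apply: (measurable_fun_ler (measurable_cst c)) => //.
  exact: measurableT_comp.
rewrite -Ex_indic// mulrC -ExZ//; apply: le_Ex; [exact: intg_indic|exact: intgZ|].
move=> w; rewrite indicE; case: (boolP (w \in _)) => [|_]; last first.
  by rewrite mulr_ge0 ?invr_ge0// sqr_ge0.
rewrite inE /= => cD; rewrite mulrC ler_pdivlMr ?exprn_gt0// mul1r.
by rewrite -(real_normK (num_real (D w))) ler_sqr ?nnegrE// ltW.
Qed.

(** Centring and pairwise independence kill the cross terms, so the second moments add up. The
    uniform bound [M] makes all products integrable. *)
Lemma Ex_sum_indep_sq (W : nat -> T -> R) M v k :
  (forall i, measurable_fun setT (W i)) -> (forall i w, `|W i w| <= M) ->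
  (forall i, Ex P (W i) = 0) -> (forall i j, i != j -> indep2 P (W i) (W j)) ->
  (forall i, Ex P (fun w => W i w ^+ 2) <= v) ->
  Ex P (fun w => (\sum_(0 <= i < k) W i w) ^+ 2) <= k%:R * v.
Proof.
move=> mW WM W0 iW Wv.
have iWi i : intg P (W i) by exact: intg_bounded (mW i) (WM i).
have iWM i j : intg P (fun w => W i w * W j w).
  apply: (@intg_bounded _ _ _ _ _ (M * M)); first exact: measurable_funM.
  by move=> w; rewrite normrM ler_pM.
have iS2 n : intg P (fun w => (\sum_(0 <= i < n) W i w) ^+ 2).
  have -> : (fun w => (\sum_(0 <= i < n) W i w) ^+ 2) =
      (fun w => \sum_(0 <= i < n) \sum_(0 <= j < n) W i w * W j w).
    apply/funext => w; rewrite expr2 mulr_suml; apply: eq_bigr => i _.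
    by rewrite mulr_sumr.
  by do 2 (apply: intg_sum => ? _).
elim: k => [|k IH].
  by rewrite mul0r le_eqVlt -[X in _ == X](Ex_cst P) -(rwP orP); left; apply/eqP; congr Ex;
     apply/funext => w; rewrite big_nil expr0n.
have iSW : intg P (fun w => \sum_(0 <= i < k) W i w * W k w) by apply: intg_sum.
have -> : (fun w => (\sum_(0 <= i < k.+1) W i w) ^+ 2) =
  (fun w => ((\sum_(0 <= i < k) W i w) ^+ 2 + 2 * (\sum_(0 <= i < k) W i w * W k w)) +
    W k w ^+ 2).
  apply/funext => w; rewrite big_nat_recr//= -mulr_suml; ring.
rewrite ExD; [|exact: intgD (iS2 k) (intgZ 2 iSW)|exact: iWM].
rewrite ExD; [|exact: iS2|exact: intgZ].
rewrite ExZ//.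
have -> : Ex P (fun w => \sum_(0 <= i < k) W i w * W k w) = 0.
  under eq_fun do rewrite big_mkord.
  rewrite Ex_sum// big1// => i _.
  rewrite ExM_indep// ?W0 ?mul0r//; apply: iW.
  by rewrite neq_ltn ltn_ord.
by rewrite mulr0 addr0 -natr1 mulrDl mul1r lerD.
Qed.

End probability_inequalities.

Section slln_nonneg.
Context d (T : measurableType d) (R : realType) (P : probability T R).
Variable X : nat -> T -> R.
Hypothesis mX : forall i, measurable_fun setT (X i).
Hypothesis X0 : forall i w, 0 <= X i w.
Hypothesis iX : intg P (X 0%N).
Hypothesis idX : forall i, identically_distributed P (X i) (X 0%N).
Hypothesis indX : forall i j, i != j -> indep2 P (X i) (X j).

Let mu := Ex P (X 0%N).

Section ratio.
Variable a : R.
Hypothesis a1 : 1 < a.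

Let a0 : 0 < a. Proof. exact: lt_trans a1. Qed.
Let an0 n : 0 < a ^+ n. Proof. exact: exprn_gt0. Qed.

(* Etemadi's proof: the truncation level [a ^+ n] also counts the summands, so that Chebyshev's
   inequality and Borel-Cantelli only require pairwise independence and a first moment. *)
Let tr n (x : R) : R := if x <= a ^+ n then x else 0.

Let mtr n : measurable_fun setT (tr n).
Proof.
by apply: measurable_fun_ifT => //; exact: measurable_fun_ler.
Qed.

Let Y n i w := tr n (X i w).

Let mY n i : measurable_fun setT (Y n i).
Proof. exact: measurableT_comp. Qed.

Let Y_ge0 n i w : 0 <= Y n i w.
Proof. by rewrite /Y /tr; case: ifP. Qed.

Let Y_le n i w : Y n i w <= a ^+ n.
Proof. by rewrite /Y /tr; case: ifP => // _; rewrite ltW. Qed.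

Let Y_leX n i w : Y n i w <= X i w.
Proof. by rewrite /Y /tr; case: ifP. Qed.

Let iY n i : intg P (Y n i).
Proof. by apply: (@intg_bounded _ _ _ _ _ (a ^+ n)) => // w; rewrite ger0_norm. Qed.

Let m n := Ex P (Y n 0%N).

Let ExY n i : Ex P (Y n i) = m n.
Proof. exact: (Ex_transfer (mX i) (mX 0%N) (idX i) (mtr n) (iY n i)). Qed.

Let iY2 n i : intg P (fun w => Y n i w ^+ 2).
Proof.
apply: (@intg_bounded _ _ _ _ _ (a ^+ n ^+ 2)); first exact: measurable_funX.
by move=> w; rewrite ger0_norm ?sqr_ge0// ler_sqr ?nnegrE// (ltW (an0 n)).
Qed.

Let ExY2 n i : Ex P (fun w => Y n i w ^+ 2) = Ex P (fun w => Y n 0%N w ^+ 2).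
Proof.
have mt : measurable_fun setT (fun x => tr n x ^+ 2) by exact: measurable_funX.
exact: (Ex_transfer (mX i) (mX 0%N) (idX i) mt (iY2 n i)).
Qed.

Let m_ge0 n : 0 <= m n. Proof. exact: Ex_ge0. Qed.

Let m_le n : m n <= a ^+ n.
Proof. by rewrite -[X in _ <= X](Ex_cst P); apply: le_Ex => //; exact: intg_cst. Qed.

Let k n := Num.truncn (a ^+ n).

Let k_le n : (k n)%:R <= a ^+ n.
Proof. by rewrite truncn_le ltW. Qed.

Let W n i w := Y n i w - m n.

Let mW n i : measurable_fun setT (W n i).
Proof. exact: measurable_funB. Qed.

Let variance_sum n : Ex P (fun w => (\sum_(0 <= i < k n) W n i w) ^+ 2) <=
  (k n)%:R * Ex P (fun w => Y n 0%N w ^+ 2).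
Proof.
apply: (@Ex_sum_indep_sq _ _ _ _ _ (a ^+ n)) => //.
- move=> i w; rewrite ler_norml /W; have := Y_ge0 n i w; have := Y_le n i w.
  by have := m_ge0 n; have := m_le n; lra.
- by move=> i; rewrite /W ExB ?ExY ?Ex_cst ?subrr//; exact: intg_cst.
- move=> i j ij; have mt : measurable_fun setT (fun x => tr n x - m n).
    exact: measurable_funB.
  exact: (indep2_comp mt mt (indX ij)).
- move=> i; rewrite -(ExY2 n i).
  have -> : (fun w => W n i w ^+ 2) =
      (fun w => (Y n i w ^+ 2 - 2 * m n * Y n i w) + m n ^+ 2).
    by apply/funext => w; rewrite /W; ring.
  have iZ : intg P (fun w => 2 * m n * Y n i w) by exact: intgZ.
  rewrite ExD; [|exact: intgB|exact: intg_cst].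
  rewrite ExB// ExZ// ExY Ex_cst.
  by have := sqr_ge0 (m n); lra.
Qed.

Let deviation n eps := [set w | eps * a ^+ n <= `|\sum_(0 <= i < k n) W n i w|].

Let mdeviation n eps : measurable (deviation n eps).
Proof.
rewrite -[X in measurable X]setTI.
apply: (measurable_fun_ler (measurable_cst (eps * a ^+ n))) => //.
by apply: measurableT_comp => //; exact: measurable_sum.
Qed.

(** Chebyshev's inequality and k n <= a^n bound each term by eps^-2 E[Y^2 / a^n]. Under the
    expectation one factor X is kept aside, while the geometric tail bounds the sum of the other
    factors by a/(a-1): a first moment of X is enough. *)
Let sum_deviation eps N : 0 < eps ->
  \sum_(0 <= n < N) fine (P (deviation n eps)) <= eps ^- 2 * (mu * (a / (a - 1))).
Proof.
move=> e0.
pose g n w := X 0%N w * ((X 0%N w <= a ^+ n)%R%:R * X 0%N w / a ^+ n).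
have gE n w : g n w = Y n 0%N w ^+ 2 / a ^+ n.
  by rewrite /g /Y /tr; case: ifP => _; rewrite ?expr2 ?mul1r ?mul0r ?mulr0 ?mulrA// mul0r.
have ig n : intg P (g n).
  by rewrite (_ : g n = fun w => (a ^+ n)^-1 * Y n 0%N w ^+ 2);
    [exact: intgZ|apply/funext => w; rewrite gE mulrC].
have step n : fine (P (deviation n eps)) <= eps ^- 2 * Ex P (g n).
  have iS : intg P (fun w => (\sum_(0 <= i < k n) W n i w) ^+ 2).
    apply: (@intg_bounded _ _ _ _ _ (((k n)%:R * a ^+ n) ^+ 2)).
      by apply: measurable_funX; exact: measurable_sum.
    move=> w; rewrite normrX ler_sqr ?nnegrE ?mulr_ge0 ?(ltW (an0 _))//.
    rewrite (le_trans (ler_norm_sum _ _ _))//.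
    rewrite (le_trans (_ : _ <= \sum_(0 <= i < k n) a ^+ n))//; last first.
      by rewrite sumr_const_nat subn0 mulr_natl.
    apply: ler_sum => i _; rewrite ler_norml /W; have := Y_ge0 n i w; have := Y_le n i w.
    by have := m_ge0 n; have := m_le n; lra.
  apply: le_trans (chebyshev_sq _ iS (mulr_gt0 e0 (an0 n))) _.
    exact: measurable_sum.
  have -> : Ex P (g n) = Ex P (fun w => Y n 0%N w ^+ 2) / a ^+ n.
    by rewrite mulrC -ExZ//; congr Ex; apply/funext => w; rewrite gE mulrC.
  rewrite ler_pdivrMr ?exprn_gt0 ?mulr_gt0//.
  set v := Ex P (fun w => Y n 0%N w ^+ 2).
  have -> : eps ^- 2 * (v / a ^+ n) * (eps * a ^+ n) ^+ 2 = v * a ^+ n.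
    by field; rewrite !gt_eqF.
  rewrite (le_trans (variance_sum n))// mulrC ler_wpM2l//.
  by apply: Ex_ge0 => w; exact: sqr_ge0.
apply: (@le_trans _ _ (\sum_(0 <= n < N) eps ^- 2 * Ex P (g n))); first exact: ler_sum.
rewrite -mulr_sumr ler_wpM2l ?invr_ge0 ?exprn_ge0 ?(ltW e0)//.
rewrite -Ex_sum// /mu mulrC -ExZ//; apply: le_Ex; [exact: intg_sum|exact: intgZ|].
move=> w; rewrite -mulr_sumr mulrC ler_wpM2r//.
exact: sum_geometric_tail.
Qed.

Let large n := [set w | exists2 i, (i < k n)%N & a ^+ n < X i w].

Let mlarge n : measurable (large n).
Proof.
have -> : large n = \bigcup_(i in [set i | (i < k n)%N]) [set w | a ^+ n < X i w].
  by apply/seteqP; split=> [w [i ik Xi]|w [i /= ik Xi]]; exists i.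
apply: bigcup_measurable => i _; rewrite -[X in measurable X]setTI.
exact: (measurable_fun_ltr (measurable_cst (a ^+ n))).
Qed.

(** The union bound gives at most E[a^n 1(a^n < X)] for each n, and the geometric head bounds the
    sum of these variables pointwise by a/(a-1) X. *)
Let sum_large N : \sum_(0 <= n < N) fine (P (large n)) <= a / (a - 1) * mu.
Proof.
pose h n i w : R := (a ^+ n < X i w)%R%:R.
have mind n : measurable_fun setT (fun x : R => (a ^+ n < x)%R%:R : R).
  have -> : (fun x : R => (a ^+ n < x)%R%:R) = (fun x => if a ^+ n < x then 1 else 0 : R).
    by apply/funext => x; case: ifP.
  by apply: measurable_fun_ifT => //; exact: measurable_fun_ltr.
have ih n i : intg P (h n i).
  apply: (@intg_bounded _ _ _ _ _ 1); first exact: (measurableT_comp (mind n) (mX i)).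
  by move=> w; rewrite normr_nat lern1 leq_b1.
have step n : fine (P (large n)) <= Ex P (fun w => h n 0%N w * a ^+ n).
  apply: (@le_trans _ _ ((k n)%:R * Ex P (h n 0%N))); last first.
    under [X in _ <= Ex P X]eq_fun do rewrite mulrC.
    by rewrite ExZ// ler_wpM2r//; apply: Ex_ge0.
  have <- : \sum_(0 <= i < k n) Ex P (h n i) = (k n)%:R * Ex P (h n 0%N).
    rewrite mulr_natl -[k n in RHS]subn0 -sumr_const_nat; apply: eq_bigr => i _.
    exact: (Ex_transfer (mX i) (mX 0%N) (idX i) (mind n) (ih n i)).
  rewrite -Ex_indic// -Ex_sum//; apply: le_Ex; [exact: intg_indic|exact: intg_sum|].
  move=> w; rewrite indicE; case: (boolP (w \in _)) => [|_]; last exact: sumr_ge0.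
  rewrite inE => -[i ik aX]; rewrite big_mkord (bigD1 (Ordinal ik))//= {1}/h aX.
  by rewrite lerDl; exact: sumr_ge0.
apply: (@le_trans _ _ (\sum_(0 <= n < N) Ex P (fun w => h n 0%N w * a ^+ n))).
  exact: ler_sum.
have iha n : intg P (fun w => h n 0%N w * a ^+ n).
  by under eq_fun do rewrite mulrC; exact: intgZ.
rewrite -Ex_sum// -ExZ//; apply: le_Ex; [exact: intg_sum|exact: intgZ|].
by move=> w; exact: sum_geometric_head.
Qed.

Let inv_expr_cvg0 : (fun n => (a ^+ n)^-1) @ \oo --> (0 : R).
Proof.
under eq_fun do rewrite -exprVn.
by apply: cvg_expr; rewrite ger0_norm ?invr_ge0 ?(ltW a0)// invf_lt1.
Qed.

Let cvg_floor : (fun n => (k n)%:R / a ^+ n) @ \oo --> (1 : R).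
Proof.
apply: (@squeeze_cvgr _ _ _ _ (fun n => 1 - (a ^+ n)^-1) (fun=> 1)).
- apply: nearW => n; apply/andP; split; last by rewrite ler_pdivrMr// mul1r.
  rewrite ler_pdivlMr// mulrBl mul1r mulVf ?gt_eqF// lerBlDr natr1.
  by rewrite ltW// real_truncnS_gt// num_real.
- by rewrite -[X in _ --> X]subr0; apply: cvgB => //; exact: cvg_cst.
- exact: cvg_cst.
Qed.

Let cvg_m : m n @[n --> \oo] --> mu.
Proof.
apply: (@Ex_dominated _ _ _ _ _ _ (X 0%N)) => //.
- by move=> n w; rewrite ger0_norm.
- move=> w; apply: cvg_near_cst.
  have [N XN] := expr_unbounded (X 0%N w) a1.
  exists N => // n /= Nn; rewrite /Y /tr ifT//.
  by rewrite ltW// (lt_le_trans XN)// ler_eXn2l.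
Qed.

(** Off a null set only finitely many [deviation] events, for each tolerance 1/(j+1), and finitely
    many [large] events occur. The centred truncated sums are then o(a^n), their means contribute mu
    in the limit, and eventually truncation changes no summand. *)
Lemma slln_geometric : {ae P, forall w,
  (fun n => (\sum_(0 <= i < k n) X i w) / a ^+ n) @ \oo --> mu}.
Proof.
have H1 : {ae P, forall w, forall j : nat,
    \forall n \near \oo, ~ deviation n j.+1%:R^-1 w}.
  apply: ae_foralln => j; apply: borel_cantelli_ae => // N.
  exact: sum_deviation.
have H2 : {ae P, forall w, \forall n \near \oo, ~ large n w}.
  exact: borel_cantelli_ae.
apply: filterS2 H1 H2 => w H1 H2.
have lim2 : (fun n => (k n)%:R / a ^+ n * m n) @ \oo --> mu.
  by rewrite -[X in _ --> X]mul1r; exact: cvgM.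
have -> : mu = 0 + mu by rewrite add0r.
have E n : (\sum_(0 <= i < k n) Y n i w) / a ^+ n =
    (\sum_(0 <= i < k n) W n i w) / a ^+ n + (k n)%:R / a ^+ n * m n.
  by rewrite sumrB sumr_const_nat subn0 -mulr_natl; ring.
have lim1 : (fun n => (\sum_(0 <= i < k n) W n i w) / a ^+ n) @ \oo --> (0 : R).
  apply/cvgr0Pnorm_le => eps e0.
  have [j je] : exists j : nat, j.+1%:R^-1 <= eps.
    exists (Num.truncn eps^-1); rewrite -[X in _ <= X]invrK lef_pV2 ?posrE ?invr_gt0//.
    by rewrite ltW// real_truncnS_gt// num_real.
  near=> n; rewrite normrM normfV (gtr0_norm (an0 n)) ler_pdivrMr//.
  have : ~ deviation n j.+1%:R^-1 w by near: n; exact: H1.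
  rewrite /deviation /= => /negP; rewrite -ltNge => /ltW/le_trans; apply.
  by rewrite ler_wpM2r// ltW.
apply: cvg_trans (cvgD lim1 lim2); apply: near_eq_cvg.
near=> n; rewrite fctE -E; congr (_ / _).
have nl : ~ large n w by near: n; exact: H2.
rewrite !big_mkord; apply: eq_bigr => i _; rewrite /Y /tr ifT//.
by rewrite leNgt; apply/negP => aX; apply: nl; exists i.
Unshelve. all: by end_near. Qed.

End ratio.

(** Nonnegativity makes the partial sums monotone, as the interpolation between powers requires;
    taking the countable family of ratios 1 + 1/(j+1) keeps a single null set. *)
Lemma slln_ge0 : {ae P, forall w,
  (fun n => n%:R^-1 * \sum_(0 <= i < n) X i w) @ \oo --> mu}.
Proof.
have H : {ae P, forall w, forall j : nat, (fun n =>
    (\sum_(0 <= i < Num.truncn ((1 + j.+1%:R^-1 : R) ^+ n)) X i w) /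
    (1 + j.+1%:R^-1) ^+ n) @ \oo --> mu}.
  by apply: ae_foralln => j; apply: slln_geometric; rewrite ltrDl invr_gt0.
apply: filterS H => w H.
apply: (cvg_along_geometric (t := fun n => \sum_(0 <= i < n) X i w)) => //.
- move=> i j ij; rewrite (big_cat_nat _ ij)//= lerDl.
  exact: sumr_ge0.
- by move=> i; exact: sumr_ge0.
- exact: Ex_ge0.
Qed.

End slln_nonneg.

Lemma identically_distributed_comp d (T : measurableType d) (R : realType)
    (P : probability T R) d1 d2 (T1 : measurableType d1) (T2 : measurableType d2)
    (X Y : T -> T1) (f : T1 -> T2) : measurable_fun setT f ->
  identically_distributed P X Y ->
  identically_distributed P (fun w => f (X w)) (fun w => f (Y w)).
Proof.
move=> mf XY A mA; apply: (XY (f @^-1` A)).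
by rewrite -[X in measurable X]setTI; exact: mf.
Qed.

Lemma slln d (T : measurableType d) (R : realType) (P : probability T R)
    (X : nat -> T -> R) :
  (forall i, measurable_fun setT (X i)) -> intg P (X 0%N) ->
  (forall i, identically_distributed P (X i) (X 0%N)) ->
  (forall i j, i != j -> indep2 P (X i) (X j)) ->
  {ae P, forall w,
    (fun n => n%:R^-1 * \sum_(0 <= i < n) X i w) @ \oo --> Ex P (X 0%N)}.
Proof.
move=> mX iX idX indX.
pose pos (x : R) := Num.max x 0.
have mpos : measurable_fun setT pos by exact: measurable_maxr.
have mneg : measurable_fun setT (fun x : R => pos (- x)).
  by apply: measurableT_comp => //; exact: oppr_measurable.
(* Used for the positive and the negative part: [f] acts on one variable at a time, so pairwise
   independence and equality of laws pass to the images. *)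
have part (f : R -> R) : measurable_fun setT f -> (forall x, 0 <= f x <= `|x|) ->
    intg P (fun w => f (X 0%N w)) /\ {ae P, forall w,
    (fun n => n%:R^-1 * \sum_(0 <= i < n) f (X i w)) @ \oo --> Ex P (fun w => f (X 0%N w))}.
  move=> mf fP.
  have iffX : intg P (fun w => f (X 0%N w)).
    apply: (@le_intg _ _ _ _ _ (X 0%N)) => //; first exact: measurableT_comp.
    by move=> w; have /andP[f0 fx] := fP (X 0%N w); rewrite ger0_norm.
  split=> //; apply: (@slln_ge0 _ _ _ _ (fun i w => f (X i w))) => //.
  - by move=> i; exact: measurableT_comp.
  - by move=> i w; have /andP[] := fP (X i w).
  - by move=> i; exact: identically_distributed_comp.
  - by move=> i j ij; exact: (indep2_comp mf mf (indX _ _ ij)).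
have pos_le x : 0 <= pos x <= `|x|.
  by rewrite /pos le_max lexx orbT/= ge_max normr_ge0 ler_norm.
have [ip Hp] := part pos mpos pos_le.
have [|in_ Hn] := part (fun x : R => pos (- x)) mneg.
  by move=> x; rewrite -normrN.
apply: filterS2 Hp Hn.
move=> w {}Hp {}Hn.
have posB (x : R) : x = pos x - pos (- x).
  rewrite /pos; have /orP[x0|x0] := le_total 0 x.
    have x0' : - x <= 0 by rewrite oppr_le0.
    by rewrite (max_idPl x0) (max_idPr x0') subr0.
  have x0' : 0 <= - x by rewrite oppr_ge0.
  by rewrite (max_idPr x0) (max_idPl x0') sub0r opprK.
have -> : Ex P (X 0%N) = Ex P (fun w => pos (X 0%N w)) - Ex P (fun w => pos (- X 0%N w)).
  by rewrite -ExB//; congr Ex; apply/funext => w'.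
have E n : n%:R^-1 * \sum_(0 <= i < n) X i w =
    n%:R^-1 * \sum_(0 <= i < n) pos (X i w) -
    n%:R^-1 * \sum_(0 <= i < n) pos (- X i w).
  by rewrite -mulrBr -sumrB; congr (_ * _); apply: eq_bigr => i _; exact: posB.
under eq_fun do rewrite E.
exact: cvgB.
Qed.

Section copies.
Context d (T : measurableType d) (R : realType) (P : probability T R).
Context d1 (T1 : measurableType d1) (Z : T -> T1) (Zs : nat -> T -> T1).
Hypothesis mZ : measurable_fun setT Z.
Hypothesis mZs : forall i, measurable_fun setT (Zs i).
Hypothesis copies : independent_copies P Z Zs.

Lemma copies_indep2 i j : i != j -> indep2 P (Zs i) (Zs j).
Proof.
move=> ij A B mA mB; case: copies => ind _.
pose E k := if k == i then Zs i @^-1` A else Zs j @^-1` B.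
have := ind [fset i; j]%fset E; rewrite big_fsetU1/=; last by rewrite inE.
rewrite big_seq_fset1 /E eqxx eq_sym (negbTE ij) => <-.
  congr (P _); apply/seteqP; split=> [w [wA wB] k /=|w h].
    by rewrite !inE => /orP[/eqP ->|/eqP ->]; rewrite ?eqxx// eq_sym (negbTE ij).
  split; first by have := h i; rewrite /= eqxx; apply; rewrite !inE eqxx.
  by have := h j; rewrite /= eq_sym (negbTE ij); apply; rewrite !inE eqxx orbT.
move=> k; rewrite !inE => /orP[/eqP ->|/eqP ->].
  by rewrite eqxx; exists A => //; rewrite setTI.
by rewrite eq_sym (negbTE ij); exists B => //; rewrite setTI.
Qed.

Lemma slln_copies (h : T1 -> R) : measurable_fun setT h ->
  intg P (fun w => h (Z w)) ->
  {ae P, forall w, (fun n => n%:R^-1 * \sum_(1 <= i < n.+1) h (Zs i w)) @ \oo -->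
    Ex P (fun w => h (Z w))}.
Proof.
move=> mh ih; case: (copies) => _ idZ.
have idZ' i : identically_distributed P Z (Zs i) by move=> A mA; rewrite idZ.
have E1 := Ex_transfer mZ (mZs 1) (idZ' 1%N) mh ih.
(* The sample starts at index 1, so the law is applied to the shifted sequence. *)
have H : {ae P, forall w, (fun n => n%:R^-1 * \sum_(0 <= i < n) h (Zs i.+1 w)) @ \oo -->
    Ex P (fun w => h (Zs 1%N w))}.
  apply: (@slln _ _ _ _ (fun i w => h (Zs i.+1 w))).
  - by move=> i; exact: measurableT_comp.
  - exact: (intg_transfer mZ (mZs 1) (idZ' 1%N) mh ih).
  - move=> i; apply: identically_distributed_comp => //.
    by move=> A mA; rewrite !idZ.
  - by move=> i j ij; apply: (indep2_comp mh mh); exact: copies_indep2.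
apply: filterS H => w H; rewrite E1.
by under eq_fun do rewrite big_add1.
Qed.

End copies.

(** * The Cramer-Wold device *)

Section measurable_column_vectors.
Context {R : realType}.

Lemma cV_sigma_ind k (S : set (set 'cV[R]_k)) : sigma_algebra setT S ->
  (forall i (B : set R), measurable B -> S [set v | B (v i 0)]) -> measurable `<=` S.
Proof.
move=> sS cS; apply: smallest_sub => //.
apply: (big_ind (fun U => U `<=` S)) => //.
- by move=> U U' US U'S A [/US|/U'S].
- by move=> i _ A [B mB <-]; rewrite setTI; exact: cS.
Qed.

Lemma measurable_coord k (i : 'I_k) :
  measurable_fun setT (fun v : 'cV[R]_k => v i 0).
Proof.
move=> _ B mB; apply: sub_sigma_algebra; rewrite (bigD1 i)//=; left.
by exists B.
Qed.

Lemma measurable_cV d (T : measurableType d) k (f : T -> 'cV[R]_k) :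
  (forall i, measurable_fun setT (fun w => f w i 0)) -> measurable_fun setT f.
Proof.
move=> mf _ A; rewrite setTI; move: A.
apply: (@cV_sigma_ind _ [set A | measurable (f @^-1` A)]).
  split=> [|A mA|F mF] /=; first by rewrite preimage_set0.
  - by rewrite setTD preimage_setC; exact: measurableC.
  - by rewrite preimage_bigcup; exact: bigcupT_measurable.
by move=> i B mB; have := mf i measurableT B mB; rewrite setTI.
Qed.

Definition dot k (t v : 'cV[R]_k) : R := \sum_i t i 0 * v i 0.

Lemma dotE k (t v : 'cV[R]_k) : dot t v = (t^T *m v) 0 0.
Proof. by rewrite !mxE; apply: eq_bigr => i _; rewrite !mxE. Qed.

Lemma dotDl k (s t v : 'cV[R]_k) : dot (s + t) v = dot s v + dot t v.
Proof. by rewrite !dotE linearD/= mulmxDl mxE. Qed.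

Lemma dotNl k (t v : 'cV[R]_k) : dot (- t) v = - dot t v.
Proof. by rewrite !dotE linearN/= mulNmx mxE. Qed.

Lemma dotZl k c (t v : 'cV[R]_k) : dot (c *: t) v = c * dot t v.
Proof. by rewrite !dotE linearZ/= -scalemxAl mxE. Qed.

Lemma dot_delta k i (v : 'cV[R]_k) : dot (delta_mx i 0) v = v i 0.
Proof.
rewrite /dot (bigD1 i)//= mxE !eqxx mul1r big1 ?addr0// => j ji.
by rewrite mxE (negbTE ji) mul0r.
Qed.

Lemma measurable_dot k (t : 'cV[R]_k) : measurable_fun setT (dot t).
Proof.
apply: measurable_sum => i; apply: measurable_funM => //.
exact: measurable_coord.
Qed.

End measurable_column_vectors.

(* The iterates of this polynomial converge to the sign function on [-1, 1]: any
   algebra of functions which is closed under bounded pointwise limits contains the signs of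
   its elements of norm at most 1. *)
Section smoothstep.
Variable R : realType.

Definition smoothstep (s : R) : R := 2^-1 * (3 * s - s * s * s).

Lemma smoothstepN s : smoothstep (- s) = - smoothstep s.
Proof. by rewrite /smoothstep; ring. Qed.

(** Writing f for [smoothstep], 1 - f(u) = (1-u)^2 (2+u) / 2, so the distance to the fixed point 1
    shrinks by a factor at most 1 - s/2 whenever s <= u <= 1. *)
Lemma iter_smoothstep_itv s n : 0 < s <= 1 -> s <= iter n smoothstep s <= 1 /\
  1 - iter n smoothstep s <= (1 - s / 2) ^+ n.
Proof.
move=> /andP[s0 s1]; elim: n => [|n [/andP[su u1] IH]] /=.
  by rewrite lexx s1 expr0; split=> //; lra.
move: su u1 IH; set u := iter _ _ _ => su u1 IH; rewrite /smoothstep.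
have u0 : 0 < u by lra.
have h1 : 0 <= u * ((1 - u) * (1 + u)) by rewrite !mulr_ge0//; lra.
have h2 : 0 <= (1 - u) * ((1 - u) * (2 + u)) by rewrite !mulr_ge0//; lra.
split; first by apply/andP; split; lra.
rewrite exprS; apply: le_trans (_ : (1 - s / 2) * (1 - u) <= _); last by rewrite ler_wpM2l//; lra.
have h3 : 0 <= (1 - u) * (u - s + u * u) by rewrite mulr_ge0//; nra.
by lra.
Qed.

Lemma iter_smoothstep_le1 s n : `|s| <= 1 -> `|iter n smoothstep s| <= 1.
Proof.
move=> s1; elim: n => [//|n /=]; set u := iter _ _ _ => u1.
move: u1; rewrite !ler_norml /smoothstep => /andP[u0 u1].
have h1 : 0 <= (1 - u) * ((1 - u) * (2 + u)) by rewrite !mulr_ge0//; lra.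
have h2 : 0 <= (1 + u) * ((1 + u) * (2 - u)) by rewrite !mulr_ge0//; lra.
by apply/andP; split; lra.
Qed.

Lemma cvg_smoothstep_pos s : 0 < s <= 1 ->
  (fun n => iter n smoothstep s) @ \oo --> (1 : R).
Proof.
move=> s01; apply: (@squeeze_cvgr _ _ _ _ (fun n => 1 - (1 - s / 2) ^+ n) (fun=> 1)).
- apply: nearW => n; have [/andP[_ u1] h] := iter_smoothstep_itv n s01.
  by rewrite u1 andbT; lra.
- rewrite -[X in _ --> X]subr0; apply: cvgB; first exact: cvg_cst.
  by apply: cvg_expr; case/andP: s01 => s0 s1; rewrite ger0_norm; lra.
- exact: cvg_cst.
Qed.

Lemma cvg_smoothstep s : `|s| <= 1 ->
  (fun n => iter n smoothstep s) @ \oo --> Num.sg s.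
Proof.
move=> s1; have [s0|s0|->] := ltgtP s 0.
- rewrite ltr0_sg//.
  have -> : (fun n => iter n smoothstep s) = (fun n => - iter n smoothstep (- s)).
    apply/funext; elim=> [|n IH] /=; first by rewrite opprK.
    by rewrite IH smoothstepN.
  apply: cvgN; apply: cvg_smoothstep_pos; rewrite oppr_gt0 s0/=.
  by rewrite -(ltr0_norm s0).
- by rewrite gtr0_sg//; apply: cvg_smoothstep_pos; rewrite s0 -(gtr0_norm s0).
- rewrite sgr0.
  have -> : (fun n => iter n smoothstep 0) = (fun=> 0).
    by apply/funext; elim=> [//|n /= ->]; rewrite /smoothstep; ring.
  exact: cvg_cst.
Qed.

End smoothstep.

Section cramer_wold.
Context d (T : measurableType d) (R : realType) (P : probability T R).
Variables (k : nat) (V V' : T -> 'cV[R]_k).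
Hypotheses (mV : measurable_fun setT V) (mV' : measurable_fun setT V').
Hypothesis same_projections : forall t,
  identically_distributed P (fun w => dot t (V w)) (fun w => dot t (V' w)).

Let bounded_meas (F : 'cV[R]_k -> R) :=
  measurable_fun setT F /\ exists M, forall v, `|F v| <= M.

(* By the addition formulas, the functions which multiply [good] functions into [good] ones form
   an algebra containing the cosines. It is closed under bounded limits, so it contains the sign
   of [sin ((v i 0 - a) / n)], hence, letting n grow, the indicators of the half-spaces, and
   finally those of all Borel sets. *)
Let good (F : 'cV[R]_k -> R) := bounded_meas F /\
  forall t c, Ex P (fun w => F (V w) * cos (dot t (V w) + c)) =
              Ex P (fun w => F (V' w) * cos (dot t (V' w) + c)).

Let mcos t c : measurable_fun setT (fun v : 'cV[R]_k => cos (dot t v + c)).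
Proof.
apply: (measurableT_comp (f := cos)).
  by apply: continuous_measurable_fun; exact: continuous_cos.
by apply: measurable_funD => //; exact: measurable_dot.
Qed.

Let bm_comp F (U : T -> 'cV[R]_k) t c : measurable_fun setT U -> bounded_meas F ->
  intg P (fun w => F (U w) * cos (dot t (U w) + c)).
Proof.
move=> mU [mF [M FM]]; apply: (@intg_bounded _ _ _ _ _ M).
  apply: measurable_funM; first exact: measurableT_comp.
  exact: (measurableT_comp (mcos t c) mU).
move=> w; rewrite normrM -[M]mulr1 ler_pM//; exact: cos_max.
Qed.

Let good_lin a b F G : good F -> good G -> good (fun v => a * F v + b * G v).
Proof.
move=> [bF HF] [bG HG]; split.
  case: bF bG => [mF [M FM]] [mG [N GN]]; split.
    by apply: measurable_funD; apply: measurable_funM.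
  exists (`|a| * M + `|b| * N) => v; rewrite (le_trans (ler_normD _ _))// !normrM.
  by rewrite lerD// ler_wpM2l.
move=> t c.
have E U : measurable_fun setT U ->
    Ex P (fun w => (a * F (U w) + b * G (U w)) * cos (dot t (U w) + c)) =
    a * Ex P (fun w => F (U w) * cos (dot t (U w) + c)) +
    b * Ex P (fun w => G (U w) * cos (dot t (U w) + c)).
  move=> mU; rewrite -!ExZ; try exact: bm_comp.
  rewrite -ExD; try by apply: intgZ; exact: bm_comp.
  by congr Ex; apply/funext => w; ring.
by rewrite !E// HF HG.
Qed.

Let good_lim (F_ : nat -> 'cV[R]_k -> R) F M : (forall n, good (F_ n)) ->
  (forall n v, `|F_ n v| <= M) -> (forall v, F_ ^~ v @ \oo --> F v) -> good F.
Proof.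
move=> gF FM cF.
have mF : measurable_fun setT F.
  by apply: (measurable_fun_cvg (h := F_)) => [n|v _]; [case: (gF n) => -[]|exact: cF].
split.
  split=> //; exists M => v.
  apply: (@cvgr_to_le nat \oo _ R (fun n => `|F_ n v|)); last exact: nearW.
  exact: (cvg_norm (cF v)).
move=> t c.
have lim U : measurable_fun setT U ->
    (fun n => Ex P (fun w => F_ n (U w) * cos (dot t (U w) + c))) @ \oo -->
    Ex P (fun w => F (U w) * cos (dot t (U w) + c)).
  move=> mU; apply: (@Ex_dominated _ _ _ _ _ _ (fun=> M)).
  - by move=> n; apply: intg_meas; apply: bm_comp => //; case: (gF n).
  - apply: measurable_funM; first exact: measurableT_comp.
    exact: (measurableT_comp (mcos t c) mU).
  - exact: intg_cst.
  - by move=> n w; rewrite normrM -[M]mulr1 ler_pM//; exact: cos_max.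
  - by move=> w; apply: cvgM; [exact: cF|exact: cvg_cst].
have := lim V mV; have -> : (fun n => Ex P (fun w => F_ n (V w) * cos (dot t (V w) + c)))
    = (fun n => Ex P (fun w => F_ n (V' w) * cos (dot t (V' w) + c))).
  by apply/funext => n; case: (gF n) => _ ->.
by move=> /cvg_lim <-//; move: (lim V' mV') => /cvg_lim <-.
Qed.

Let mult (h : 'cV[R]_k -> R) := forall F, good F -> good (fun v => F v * h v).

Let mult_cos t c : mult (fun v => cos (dot t v + c)).
Proof.
move=> F [[mF [M FM]] HF]; split.
  split; first exact: measurable_funM.
  by exists M => v; rewrite normrM -[M]mulr1 ler_pM//; exact: cos_max.
move=> s c'.
have cc U (w : T) : F (U w) * cos (dot t (U w) + c) * cos (dot s (U w) + c') =
    2^-1 * (F (U w) * cos (dot (t + s) (U w) + (c + c'))) +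
    2^-1 * (F (U w) * cos (dot (t - s) (U w) + (c - c'))).
  rewrite !dotDl dotNl.
  have -> : dot t (U w) + dot s (U w) + (c + c') = (dot t (U w) + c) + (dot s (U w) + c').
    by rewrite addrACA.
  have -> : dot t (U w) - dot s (U w) + (c - c') = (dot t (U w) + c) - (dot s (U w) + c').
    by rewrite addrACA opprD.
  move: (dot t _ + c) (dot s _ + c') => a b.
  by rewrite cosD cosB; field.
under eq_fun do rewrite cc; under [in RHS]eq_fun do rewrite cc.
have bF : bounded_meas F by split=> //; exists M.
rewrite !ExD; try by apply: intgZ; exact: bm_comp.
by rewrite !ExZ ?HF//; exact: bm_comp.
Qed.

Let mult_cst a : mult (fun=> a).
Proof.
move=> F gF; have := good_lin a 0 gF gF.
by congr good; apply/funext => v; rewrite mul0r addr0 mulrC.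
Qed.

Let multM g h : mult g -> mult h -> mult (fun v => g v * h v).
Proof.
move=> mg mh F gF; have := mh _ (mg _ gF).
by congr good; apply/funext => v; rewrite mulrA.
Qed.

Let mult_lin a b g h : mult g -> mult h -> mult (fun v => a * g v + b * h v).
Proof.
move=> mg mh F gF; have := good_lin a b (mg _ gF) (mh _ gF).
by congr good; apply/funext => v; ring.
Qed.

Let mult_lim (h_ : nat -> 'cV[R]_k -> R) h M : (forall n, mult (h_ n)) ->
  (forall n v, `|h_ n v| <= M) -> (forall v, h_ ^~ v @ \oo --> h v) -> mult h.
Proof.
move=> mh hM ch F gF; have [[_ [N FN]] _] := gF.
apply: (@good_lim (fun n v => F v * h_ n v) _ (N * M)).
- by move=> n; exact: mh.
- by move=> n v; rewrite normrM ler_pM.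
- by move=> v; apply: cvgM => //; exact: cvg_cst.
Qed.

Let mult_iter_smoothstep t c n : mult (fun v => iter n (@smoothstep R) (cos (dot t v + c))).
Proof.
elim: n => [|n IH] /=; first exact: mult_cos.
have := mult_lin (2^-1 * 3) (- 2^-1) IH (multM (multM IH IH) IH).
by congr mult; apply/funext => v; rewrite /smoothstep; ring.
Qed.

Let mult_sg_cos t c : mult (fun v => Num.sg (cos (dot t v + c))).
Proof.
apply: (@mult_lim (fun n v => iter n (@smoothstep R) (cos (dot t v + c))) _ 1).
- by move=> n; exact: mult_iter_smoothstep.
- by move=> n v; apply: iter_smoothstep_le1; exact: cos_max.
- by move=> v; apply: cvg_smoothstep; exact: cos_max.
Qed.

Let mult_sg i a : mult (fun v => Num.sg (v i 0 - a)).
Proof.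
pose L n : R := n.+1%:R^-1.
apply: (@mult_lim (fun n v => Num.sg (sin (L n * (v i 0 - a)))) _ 1).
(* The sine is a cosine of phase - pi/2, and L n (v i 0 - a) is an affine function of v. *)
- move=> n; have := mult_sg_cos (L n *: delta_mx i 0) (- (L n * a) - pi / 2).
  congr mult; apply/funext => v; congr Num.sg.
  by rewrite dotZl dot_delta addrA -mulrBr cosB cos_pihalf sin_pihalf mulr0 add0r mulr1.
- by move=> n v; rewrite normr_sg lern1 leq_b1.
(* As soon as |u| / (n+1) < pi, the sine has the sign of u, and the sequence is constant from there
   on. *)
- move=> v; apply: cvg_near_cst; set u := v i 0 - a.
  exists (Num.truncn (`|u| / pi)).+1 => // n /= nu.
  have L0 : 0 < L n by rewrite invr_gt0.
  have Lu : `|u| * L n < pi.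
    rewrite ltr_pdivrMr// mulrC -ltr_pdivrMr ?pi_gt0//.
    rewrite (lt_le_trans (real_truncnS_gt (num_real _)))// ler_nat.
    exact: ltnW.
  have [u0|u0|->] := ltgtP u 0; last by rewrite mulr0 sin0.
  - rewrite (ltr0_sg u0) ltr0_sg// -oppr_gt0 -sinN sin_gt0_pi// -mulrN.
    by rewrite mulr_gt0 ?oppr_gt0//= mulrC -(ltr0_norm u0).
  - rewrite (gtr0_sg u0) gtr0_sg// sin_gt0_pi// mulr_gt0//=.
    by rewrite mulrC -(gtr0_norm u0).
Qed.

Let mult_ray i a : mult (\1_[set v : 'cV[R]_k | a < v i 0]).
Proof.
(* For a sign s, (s + s^2) / 2 is the indicator of s = 1. *)
have := mult_lin 2^-1 2^-1 (mult_sg i a) (multM (mult_sg i a) (mult_sg i a)).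
congr mult; apply/funext => v; rewrite indicE.
have -> : (v \in [set v : 'cV[R]_k | a < v i 0]) = (0 < v i 0 - a).
  by rewrite subr_gt0; apply/idP/idP; rewrite inE.
have [v0|v0|<-] := ltgtP 0 (v i 0 - a).
- by rewrite gtr0_sg// /=; field.
- by rewrite ltr0_sg// /=; field.
- by rewrite sgr0 /=; ring.
Qed.

Let mult_set := [set A : set 'cV[R]_k | mult \1_A].

Let mult_setC A : mult_set A -> mult_set (~` A).
Proof.
move=> mA; have := mult_lin 1 (- 1) (mult_cst 1) mA.
congr mult; apply/funext => v; rewrite !indicE in_setC.
by case: (v \in A) => /=; ring.
Qed.

Let mult_setI A B : mult_set A -> mult_set B -> mult_set (A `&` B).
Proof.
move=> mA mB; have := multM mA mB.
congr mult; apply/funext => v; rewrite !indicE in_setI.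
by case: (v \in A); case: (v \in B) => /=; ring.
Qed.

Let mult_set0 : mult_set set0.
Proof.
by have := mult_cst 0; congr mult; apply/funext => v; rewrite indicE in_set0.
Qed.

Let mult_setU A B : mult_set A -> mult_set B -> mult_set (A `|` B).
Proof.
by move=> mA mB; rewrite -[A `|` B]setCK setCU; apply: mult_setC; apply: mult_setI;
   apply: mult_setC.
Qed.

Let mult_bigcup (F : (set 'cV[R]_k)^nat) : (forall n, mult_set (F n)) ->
  mult_set (\bigcup_n F n).
Proof.
move=> mF; apply: (@mult_lim (fun n => \1_(\big[setU/set0]_(i < n) F i)) _ 1).
- by move=> n; apply: (big_ind mult_set).
- by move=> n v; rewrite indicE normr_nat lern1 leq_b1.
- move=> v; apply: cvg_near_cst; have [[n _ Fn]|nF] := pselect ((\bigcup_n F n) v).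
    exists n.+1 => // m /= nm; rewrite !indicE !mem_set//; first by exists n.
    by rewrite -bigcup_mkord; exists n.
  apply: nearW => n; rewrite !indicE !memNset// -bigcup_mkord => -[i _ Fi].
  by apply: nF; exists i.
Qed.

(** Equality of the projections makes the constant 1 [good]. Multiplying it by the indicator of [A]
    and testing at t = 0, c = 0, where the cosine is 1, compares the two probabilities of [A]. *)
Lemma cramer_wold : identically_distributed P V V'.
Proof.
move=> A mA.
have mA' (U : T -> 'cV[R]_k) : measurable_fun setT U -> measurable (U @^-1` A).
  by move=> mU; have := mU measurableT A mA; rewrite setTI.
have multA : mult_set A.
  move: A mA {mA'}; apply: cV_sigma_ind.
    by split=> // B; rewrite setTD; exact: mult_setC.
  move=> i B mB.
  have : <<s @RGenOInfty.G R >> B.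
    by have := mB; rewrite [X in X B -> _](RGenOInfty.measurableE R).
  move: B {mB}.
  apply: (smallest_sub (X := [set B : set R | mult_set [set v | B (v i 0)]])) => //.
    split=> [|B mB|F mF]; first exact: mult_set0.
      by rewrite setTD; exact: mult_setC.
    exact: mult_bigcup.
  move=> _ [a ->]; have := mult_ray i a.
  congr mult; apply/funext => v; rewrite !indicE; congr (nat_of_bool _)%:R.
  by apply/idP/idP; rewrite !inE /= in_itv/= andbT.
have good1 : good (fun=> 1).
  split; first by split => //; exists 1 => v; rewrite normr1.
  move=> t c.
  have mc : measurable_fun setT (fun x : R => 1 * cos (x + c)).
    apply: measurable_funM => //; apply: (measurableT_comp (f := cos)).
      by apply: continuous_measurable_fun; exact: continuous_cos.
    exact: measurable_funD.
  have mdot U : measurable_fun setT U -> measurable_fun setT (fun w : T => dot t (U w)).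
    by move=> mU; apply: (measurableT_comp _ mU); exact: measurable_dot.
  apply: (Ex_transfer (mdot _ mV) (mdot _ mV') (same_projections t) mc).
  by apply: (bm_comp (F := fun=> 1)) => //; split => //; exists 1 => v; rewrite normr1.
have [_ /(_ 0 0)] := multA _ good1.
have E U : measurable_fun setT U ->
    Ex P (fun w => 1 * \1_A (U w) * cos (dot 0 (U w) + 0)) = fine (P (U @^-1` A)).
  move=> mU; rewrite -Ex_indic; last exact: mA'.
  congr Ex; apply/funext => w.
  by rewrite dotE trmx0 mul0mx mxE addr0 cos0 mul1r mulr1.
rewrite !E// => /(congr1 (@EFin R)).
by rewrite !fineK//; apply: fin_num_measure; exact: mA'.
Qed.

End cramer_wold.

(** * Gaussian laws *)

Section normal_affine.
Variables (R : realType) (m s : R).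
Hypothesis s0 : 0 < s.

Local Notation leb := (@lebesgue_measure R).

Let phi (x : measurableTypeR R) : measurableTypeR R := m + s * x.

Let mphi : measurable_fun setT phi.
Proof. by apply: measurable_funD => //; exact: measurable_funM. Qed.

Let s_nng : {nonneg R} := NngNum (ltW s0).

Lemma lebesgue_measure_affine (A : set R) : measurable A ->
  leb A = (s%:E * leb ((fun x => m + s * x)%R @^-1` A))%E.
Proof.
pose pf : {measure set (measurableTypeR R) -> \bar R} := pushforward leb phi.
pose nu : {measure set (measurableTypeR R) -> \bar R} := mscale s_nng (pf mphi).
suff H X : ocitv X -> leb X = nu X by move=> mA; exact: (lebesgue_measure_unique H mA).
move=> [[a b] _ <-].
have E : phi @^-1` `]a, b]%classic = `](a - m) / s, (b - m) / s]%classic.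
  by apply/seteqP; split=> x /=; rewrite !in_itv/=;
    rewrite ltr_pdivrMr// ler_pdivlMr// ltrBlDl lerBrDl mulrC.
rewrite /nu /= /mscale/= /pushforward /= E !lebesgue_measure_itv/= !lte_fin.
rewrite ltr_pM2r ?invr_gt0// ltrD2r; case: ifPn => _; last by rewrite mule0.
by rewrite -!EFinD -EFinM -mulrBl mulrC divfK ?gt_eqF//; congr (_%:E); ring.
Qed.

(** A normal law becomes an affine image of the standard one, so that its moments are computed by
    transfer. The factor s from Lebesgue measure cancels the s in the normalisation of the
    density. *)
Lemma normal_prob_affine (A : set R) : measurable A ->
  normal_prob m s A = normal_prob 0 1 ((fun x => m + s * x) @^-1` A).
Proof.
move=> mA; rewrite /normal_prob.
have mpdf (a b : R) : measurable_fun setT (fun x => (normal_pdf a b x)%:E).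
  by apply/measurable_EFinP; exact: measurable_normal_pdf.
pose pf : {measure set (measurableTypeR R) -> \bar R} := pushforward leb phi.
transitivity (\int[mscale s_nng (pf mphi)]_(x in A) (normal_pdf m s x)%:E)%E.
  by apply: eq_measure_integral => B mB _; exact: lebesgue_measure_affine.
rewrite ge0_integral_mscale//; last 2 first.
- by apply: measurable_funTS; exact: mpdf.
- by move=> x _; rewrite lee_fin normal_pdf_ge0.
rewrite (ge0_integral_pushforward mphi)//; last 2 first.
- by apply: measurable_funTS; exact: mpdf.
- by move=> x _; rewrite lee_fin normal_pdf_ge0.
have mA' : measurable (phi @^-1` A) by rewrite -[X in measurable X]setTI; exact: mphi.
rewrite -ge0_integralZl//; last 2 first.
- apply: measurable_funTS; apply: (measurableT_comp (mpdf m s)); exact: mphi.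
- by move=> x _; rewrite lee_fin normal_pdf_ge0.
apply: eq_integral => x _; rewrite -EFinM; congr (_%:E).
rewrite !normal_pdfE ?oner_neq0 ?gt_eqF// /phi /=.
rewrite /normal_peak /normal_fun.
have -> : - (m + s * x - m) ^+ 2 / (s ^+ 2 *+ 2) = - (x - 0) ^+ 2 / (1 ^+ 2 *+ 2).
  by field; rewrite gt_eqF.
rewrite mulrA; congr (_ * _); rewrite expr1n mul1r -mulrnAr.
rewrite sqrtrM ?sqr_ge0// sqrtr_sqr gtr0_norm// invfM mulrA divff ?gt_eqF// mul1r.
by [].
Qed.

End normal_affine.

Section square_integrable.
Context d (T : measurableType d) (R : realType) (P : probability T R).
Implicit Types X Y : T -> R.

Definition sqintg X := measurable_fun setT X /\ intg P (fun w => X w ^+ 2).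

Lemma sqintg_meas X : sqintg X -> measurable_fun setT X. Proof. by case. Qed.

Lemma sqintg_cst c : sqintg (fun=> c).
Proof. by split=> //; exact: intg_cst. Qed.

Lemma sqintgM X Y : sqintg X -> sqintg Y -> intg P (fun w => X w * Y w).
Proof.
move=> [mX iX] [mY iY]; apply: (@le_intg _ _ _ _ _ (fun w => X w ^+ 2 + Y w ^+ 2)).
- exact: measurable_funM.
- move=> w; rewrite normrM [X in _ <= X]ger0_norm; last by rewrite addr_ge0// sqr_ge0.
  rewrite -(real_normK (num_real (X w))) -(real_normK (num_real (Y w))).
  move: `|X w| `|Y w| (normr_ge0 (X w)) (normr_ge0 (Y w)) => a b a0 b0.
  have := mulr_ge0 a0 b0; have := sqr_ge0 (a - b); rewrite !expr2; lra.
- exact: intgD.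
Qed.

Lemma sqintg_intg X : sqintg X -> intg P X.
Proof.
move=> sX; have := sqintgM sX (sqintg_cst 1).
by congr intg; apply/funext => w; rewrite mulr1.
Qed.

Lemma sqintgZ c X : sqintg X -> sqintg (fun w => c * X w).
Proof.
move=> [mX iX]; split; first exact: measurable_funM.
by under eq_fun do rewrite exprMn; exact: intgZ.
Qed.

Lemma sqintgD X Y : sqintg X -> sqintg Y -> sqintg (fun w => X w + Y w).
Proof.
move=> sX sY; split; first by apply: measurable_funD; [case: sX|case: sY].
have -> : (fun w => (X w + Y w) ^+ 2) =
    (fun w => (X w ^+ 2 + 2 * (X w * Y w)) + Y w ^+ 2).
  by apply/funext => w; ring.
by apply: intgD; [apply: intgD; [case: sX|exact/intgZ/sqintgM]|case: sY].
Qed.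

Lemma sqintgN X : sqintg X -> sqintg (fun w => - X w).
Proof. by move=> sX; have := sqintgZ (- 1) sX; under eq_fun do rewrite mulN1r. Qed.

Lemma sqintg_sum (I : Type) (s : seq I) (X : I -> T -> R) :
  (forall i, sqintg (X i)) -> sqintg (fun w => \sum_(i <- s) X i w).
Proof.
move=> sX; elim: s => [|i s IH].
  by under eq_fun do rewrite big_nil; exact: sqintg_cst.
by under eq_fun do rewrite big_cons; exact: sqintgD.
Qed.

Lemma sqintg_dot k (t : 'cV[R]_k) (X : T -> 'cV[R]_k) :
  (forall i, sqintg (fun w => X w i 0)) -> sqintg (fun w => dot t (X w)).
Proof. by move=> sX; apply: sqintg_sum => i; exact: sqintgZ. Qed.

Lemma Lfun2_sqintg X : X \in Lfun P 2%:E -> sqintg X.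
Proof.
move=> X2; split; last exact: Lfun2_integrable_sqr.
by move: X2; rewrite inE => /andP[]; rewrite inE.
Qed.

End square_integrable.

Section gaussian.
Context d (T : measurableType d) (R : realType) (P : probability T R).

Let N : probability _ R := @normal_prob R 0 1.

(** Point masses are the case s = 0 of the affine image of the standard normal law; degenerate
    projections can thus be treated together with the others. *)
Lemma gaussian_lawE (m s : R) A : 0 <= s -> measurable A ->
  gaussian_law m s A = N ((fun x => m + s * x) @^-1` A).
Proof.
move=> s0 mA; rewrite /gaussian_law; case: ifPn => [/eqP ->|sn0].
  rewrite diracE; case: (boolP (m \in A)) => mA'.
    have -> : (fun x => m + 0 * x) @^-1` A = setT.
      by apply/seteqP; split=> x //= _; rewrite mul0r addr0; exact: set_mem.
    by rewrite probability_setT.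
  have -> : (fun x => m + 0 * x) @^-1` A = set0.
    apply/seteqP; split=> x //=; rewrite mul0r addr0 => Am.
    by move: mA'; rewrite mem_set.
  by rewrite measure0.
by apply: normal_prob_affine => //; rewrite lt_def sn0.
Qed.

Lemma gaussian_rvD (X : T -> R) c : gaussian_rv P X -> gaussian_rv P (fun w => X w + c).
Proof.
move=> [m [s [s0 Xms]]]; exists (m + c), s; split=> // A mA.
have mAc : measurable ((fun x => x + c) @^-1` A).
  by rewrite -[X in measurable X]setTI; apply: measurable_funD.
rewrite gaussian_lawE//; have := Xms _ mAc; rewrite gaussian_lawE// => ->.
by congr (N _); apply/seteqP; split=> x /=; rewrite addrAC.
Qed.

Let maff (m s : R) : measurable_fun setT (fun x : measurableTypeR R => m + s * x).
Proof. by apply: measurable_funD => //; exact: measurable_funM. Qed.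

Let e1 := Ex N (fun x => x).
Let e2 := Ex N (fun x => x ^+ 2).

Section moments.
Variables (X : T -> R) (m s : R).
Hypothesis s0 : 0 <= s.
Hypothesis Xms : forall A, measurable A -> P (X @^-1` A) = gaussian_law m s A.
Hypothesis sX : sqintg P X.

Let law A : measurable A -> P (X @^-1` A) = N ((fun x => m + s * x) @^-1` A).
Proof. by move=> mA; rewrite Xms// gaussian_lawE. Qed.

(* The moments [e1] and [e2] of the standard normal law need not be computed: the mean and the
   second moment determine [m] and [s] as soon as [e2 - e1 ^+ 2] is positive. *)
Lemma gaussian_std_sqintg : 0 < s -> sqintg N (fun x => x).
Proof.
move=> sp; have : sqintg N (fun x => m + s * x).
  split; first exact: maff.
  apply: (intg_transfer (f := fun y : R => y ^+ 2) (sqintg_meas sX) (maff m s) law).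
    exact: exprn_measurable.
  by case: sX.
move=> /sqintgD/(_ (sqintg_cst _ (- m)))/(sqintgZ s^-1).
by under eq_fun do rewrite addrAC subrr add0r mulKf ?gt_eqF//.
Qed.

Lemma gaussian_mean : Ex P X = m + s * e1.
Proof.
rewrite (Ex_transfer (f := fun y : R => y) (sqintg_meas sX) (maff m s) law)//; last first.
  exact: sqintg_intg.
(* For s = 0 the integrability of the identity under [N] is not at hand, but [e1] is then multiplied
   by 0. *)
have [sp|sn] := ltP 0 s; last first.
  have -> : s = 0 by apply/eqP; rewrite eq_le sn s0.
  by under [X in Ex _ X]eq_fun do rewrite mul0r; rewrite Ex_cst mul0r.
have iN := sqintg_intg (gaussian_std_sqintg sp).
by rewrite ExD ?ExZ ?Ex_cst//; [exact: intg_cst|exact: intgZ].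
Qed.

Lemma gaussian_second : Ex P (fun w => X w ^+ 2) = m ^+ 2 + 2 * m * s * e1 + s ^+ 2 * e2.
Proof.
rewrite (Ex_transfer (f := fun y : R => y ^+ 2) (sqintg_meas sX) (maff m s) law); last 2 first.
- exact: exprn_measurable.
- by case: sX.
have [sp|sn] := ltP 0 s; last first.
  have -> : s = 0 by apply/eqP; rewrite eq_le sn s0.
  under [X in Ex _ X]eq_fun do rewrite mul0r addr0; rewrite Ex_cst; ring.
have sN := gaussian_std_sqintg sp; have iN := sqintg_intg sN; have [_ i2] := sN.
have -> : (fun x : R => (m + s * x) ^+ 2) =
    (fun x => (m ^+ 2 + 2 * m * s * x) + s ^+ 2 * x ^+ 2).
  by apply/funext => x; ring.
have iA : intg N (fun x => 2 * m * s * x) by exact: intgZ.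
rewrite ExD; [|by apply: intgD => //; exact: intg_cst|exact: intgZ].
by rewrite ExD ?ExZ ?Ex_cst//; exact: intg_cst.
Qed.

End moments.

(** If the variance vanished, the standard normal law would be carried by the single point [e1],
    which is Lebesgue-null and hence null for a law dominated by Lebesgue measure. *)
Lemma normal_variance_gt0 : sqintg N (fun x => x) -> 0 < e2 - e1 ^+ 2.
Proof.
move=> sN; have iN := sqintg_intg sN; have [_ i2] := sN.
have sC : sqintg N (fun x => x - e1) := sqintgD sN (sqintg_cst _ (- e1)).
have -> : e2 - e1 ^+ 2 = Ex N (fun x => (x - e1) ^+ 2).
  have -> : (fun x => (x - e1) ^+ 2) = (fun x => (x ^+ 2 - 2 * e1 * x) + e1 ^+ 2).
    by apply/funext => x; ring.
  have iA : intg N (fun x => 2 * e1 * x) by exact: intgZ.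
  rewrite ExD; [|exact: intgB|exact: intg_cst].
  by rewrite ExB// ExZ// Ex_cst -/e1 -/e2; ring.
rewrite lt_def Ex_ge0 ?andbT//; last by move=> x; exact: sqr_ge0.
apply/eqP => E0.
have N0 : (\int[N]_x `|((x - e1) ^+ 2)%:E| = 0)%E.
  have [_ iC] := sC; have E0' := ExE iC; rewrite E0 in E0'; rewrite [RHS]E0'.
  by apply: eq_integral => x _; rewrite gee0_abs// lee_fin sqr_ge0.
have mC : measurable_fun setT (fun x : R => ((x - e1) ^+ 2)%:E).
  by apply/measurable_EFinP; apply: measurable_funX; case: sC.
have [Z [mZ NZ HZ]] := (ae_eq_integral_abs N measurableT mC).1 N0.
have : N [set e1] = 0%E.
  have /null_content_dominatesP := normal_prob_dominates 0 (1 : R); apply => //.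
  exact: lebesgue_measure_set1.
have : N (~` [set e1]) = 0%E.
  apply/eqP; rewrite -measure_le0 -NZ le_measure ?inE//; first exact: measurableC.
  move=> x /= xe; apply: HZ => /= /(_ I) [/eqP]; rewrite sqrf_eq0 subr_eq0 => /eqP.
  exact: xe.
by rewrite probability_setC// => + E; rewrite E sube0 => /eqP; rewrite onee_eq0.
Qed.

(** Equality of the first two moments equates the variances: (s^2 - s'^2) (e2 - e1^2) = 0. Unless s
    and s' are both 0, the second factor is positive, so s = s', and the means then give m = m'. *)
Lemma gaussian_identically_distributed (X X' : T -> R) :
  gaussian_rv P X -> gaussian_rv P X' -> sqintg P X -> sqintg P X' ->
  Ex P X = Ex P X' -> Ex P (fun w => X w ^+ 2) = Ex P (fun w => X' w ^+ 2) ->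
  identically_distributed P X X'.
Proof.
move=> [m [s [s0 H]]] [m' [s' [s0' H']]] sX sX'.
rewrite (gaussian_mean s0 H sX) (gaussian_mean s0' H' sX').
rewrite (gaussian_second s0 H sX) (gaussian_second s0' H' sX') => E1 E2.
suff ss : s = s'.
  have mm : m = m' by move: E1; rewrite ss => /addIr.
  by move=> A mA; rewrite H// H'// ss mm.
have V : (s ^+ 2 - s' ^+ 2) * (e2 - e1 ^+ 2) = 0.
  have E1' : (m + s * e1) ^+ 2 = (m' + s' * e1) ^+ 2 by rewrite E1.
  by move: E1' E2; rewrite !expr2; lra.
have [sp|sn] := ltP 0 (s + s'); last by lra.
have sN : sqintg N (fun x => x).
  have [sp'|sn'] := ltP 0 s; first exact: gaussian_std_sqintg s0 H sX sp'.
  by apply: (gaussian_std_sqintg s0' H' sX'); lra.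
have := normal_variance_gt0 sN; move: V => /eqP; rewrite mulf_eq0 => /orP[|/eqP ->].
  by rewrite subr_eq0 eqrXn2// => /eqP.
by rewrite ltxx.
Qed.

End gaussian.

Section covariances.
Context d (T : measurableType d) (R : realType) (P : probability T R).
Implicit Types X Y Z : T -> R.

Definition cv X Y := Ex P (fun w => X w * Y w) - Ex P X * Ex P Y.

Lemma cvC X Y : cv X Y = cv Y X.
Proof.
by rewrite /cv mulrC; congr (_ - _); congr Ex; apply/funext => w; rewrite mulrC.
Qed.

Lemma cvDl X Y Z : sqintg P X -> sqintg P Y -> sqintg P Z ->
  cv (fun w => X w + Y w) Z = cv X Z + cv Y Z.
Proof.
move=> sX sY sZ; rewrite /cv ExD ?mulrDl; try exact: sqintg_intg.
under [X in Ex _ X - _]eq_fun do rewrite mulrDl.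
by rewrite ExD; [ring|exact: sqintgM|exact: sqintgM].
Qed.

Lemma cvZl c X Z : sqintg P X -> sqintg P Z -> cv (fun w => c * X w) Z = c * cv X Z.
Proof.
move=> sX sZ; rewrite /cv ExZ; last exact: sqintg_intg.
under [X in Ex _ X - _]eq_fun do rewrite -mulrA.
by rewrite ExZ; [ring|exact: sqintgM].
Qed.

Lemma cv_cstl c Z : sqintg P Z -> cv (fun=> c) Z = 0.
Proof. by move=> sZ; rewrite /cv ExZ ?Ex_cst ?subrr//; exact: sqintg_intg. Qed.

Lemma cvDr X Y Z : sqintg P X -> sqintg P Y -> sqintg P Z ->
  cv Z (fun w => X w + Y w) = cv Z X + cv Z Y.
Proof. by move=> sX sY sZ; rewrite cvC cvDl// (cvC X) (cvC Y). Qed.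

Lemma cv_cstr c Z : sqintg P Z -> cv Z (fun=> c) = 0.
Proof. by move=> sZ; rewrite cvC cv_cstl. Qed.

Lemma cv_suml (I : Type) (s : seq I) (X : I -> T -> R) Z :
  (forall i, sqintg P (X i)) -> sqintg P Z ->
  cv (fun w => \sum_(i <- s) X i w) Z = \sum_(i <- s) cv (X i) Z.
Proof.
move=> sX sZ; elim: s => [|i s IH].
  by rewrite big_nil; under eq_fun do rewrite big_nil; exact: cv_cstl.
rewrite big_cons -IH -cvDl//; last exact: sqintg_sum.
by under eq_fun do rewrite big_cons.
Qed.

Lemma cv_dotl k (t : 'cV[R]_k) (X : T -> 'cV[R]_k) Z :
  (forall i, sqintg P (fun w => X w i 0)) -> sqintg P Z ->
  cv (fun w => dot t (X w)) Z = \sum_i t i 0 * cv (fun w => X w i 0) Z.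
Proof.
move=> sX sZ; rewrite cv_suml//; last by move=> i; exact: sqintgZ.
by apply: eq_bigr => i _; rewrite cvZl.
Qed.

Lemma cv_dotr k (t : 'cV[R]_k) (X : T -> 'cV[R]_k) Z :
  (forall i, sqintg P (fun w => X w i 0)) -> sqintg P Z ->
  cv Z (fun w => dot t (X w)) = \sum_i cv Z (fun w => X w i 0) * t i 0.
Proof.
move=> sX sZ; rewrite cvC cv_dotl//; apply: eq_bigr => i _.
by rewrite cvC mulrC.
Qed.

Lemma cv_indep X Y : sqintg P X -> sqintg P Y -> indep2 P X Y -> cv X Y = 0.
Proof.
by move=> sX sY XY; rewrite /cv ExM_indep ?subrr//; exact: sqintg_intg.
Qed.

Lemma cov_mxE k (X : T -> 'cV[R]_k) i j : (forall i, sqintg P (fun w => X w i 0)) ->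
  cov_mx P X i j = cv (fun w => X w i 0) (fun w => X w j 0).
Proof.
move=> sX; rewrite mxE unlock !ExpectationE.
set a := Ex _ (fun w => X w i 0); set b := Ex _ (fun w => X w j 0).
have -> : ((fun w => X w i 0) \- cst a) * ((fun w => X w j 0) \- cst b) =
    (fun w => (X w i 0 * X w j 0 + - b * X w i 0) + (- a * X w j 0 + a * b)).
  by apply/funext => w; rewrite !fctE /=; ring.
have i1 := sqintg_intg (sX i); have i2 := sqintg_intg (sX j).
have i12 := sqintgM (sX i) (sX j).
have ib : intg P (fun w => - b * X w i 0) by exact: intgZ.
have ia : intg P (fun w => - a * X w j 0) by exact: intgZ.
have ic := intg_cst P (a * b).
rewrite ExD; [|exact: intgD|exact: intgD].
rewrite ExD// ExD// Ex_cst !ExZ// /cv -/a -/b; ring.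
Qed.

End covariances.

Section gaussian_uncorrelated.
Context d (T : measurableType d) (R : realType) (P : probability T R) (k : nat).
Variables (U : T -> R) (X : T -> 'cV[R]_k).
Hypothesis sU : sqintg P U.
Hypothesis sX : forall i, sqintg P (fun w => X w i 0).
Hypothesis U0 : Ex P U = 0.
Hypothesis UX : forall i, Ex P (fun w => U w * X w i 0) = 0.
Hypothesis gUX : forall s t, gaussian_rv P (fun w => s * U w + dot t (X w)).

(* By the Cramer-Wold device, (U, X) and (- U, X) have the same law, so that no joint
   density is needed. *)
Lemma gaussian_uncorrelated (A : set 'cV[R]_k) : measurable A ->
  Ex P (fun w => U w * \1_A (X w)) = 0.
Proof.
move=> mA; pose V (a : R) w : 'cV[R]_(1 + k) := col_mx (const_mx (a * U w)) (X w).
have mX : measurable_fun setT X by apply: measurable_cV => i; case: (sX i).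
have mV a : measurable_fun setT (V a).
  apply: measurable_cV => i; rewrite /V.
  case: (split_ordP i) => j ->.
    by under eq_fun do rewrite col_mxEu mxE; case: (sqintgZ a sU).
  by under eq_fun do rewrite col_mxEd; case: (sX j).
have dotV a t w : dot t (V a w) = a * t (lshift k 0) 0 * U w + dot (dsubmx t) (X w).
  rewrite /dot big_split_ord/= big_ord1 /V col_mxEu mxE; congr (_ + _); first ring.
  by apply: eq_bigr => i _; rewrite col_mxEd mxE.
have law : identically_distributed P (V 1) (V (- 1)).
  apply: cramer_wold => // t.
  rewrite (funext (dotV 1 t)) (funext (dotV (- 1) t)).
  set s := t _ 0; set u := dsubmx t.
  have sD := sqintg_dot u sX; have sZ a := sqintgZ (a * s) sU.
  have iD := sqintg_intg sD; have iZ a := sqintg_intg (sZ a).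
  have UD : Ex P (fun w => U w * dot u (X w)) = 0.
    under eq_fun do rewrite /dot mulr_sumr.
    rewrite Ex_sum; last by move=> i; apply: sqintgM => //; exact: sqintgZ.
    apply: big1 => i _; under eq_fun do rewrite mulrCA.
    by rewrite ExZ ?UX ?mulr0//; exact: sqintgM.
  apply: gaussian_identically_distributed => //.
  - exact: sqintgD.
  - exact: sqintgD.
  - by rewrite !ExD// !ExZ ?U0 ?mulr0//; exact: sqintg_intg.
  (* Orthogonality removes the cross term, so the sign of [a] is invisible in the second moment. *)
  have E a : Ex P (fun w => (a * s * U w + dot u (X w)) ^+ 2) =
      (a * s) ^+ 2 * Ex P (fun w => U w ^+ 2) + Ex P (fun w => dot u (X w) ^+ 2).
    have -> : (fun w => (a * s * U w + dot u (X w)) ^+ 2) =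
      (fun w => ((a * s) ^+ 2 * U w ^+ 2 + 2 * (a * s) * (U w * dot u (X w))) +
        dot u (X w) ^+ 2).
      by apply/funext => w; ring.
    have [_ iU2] := sU; have [_ iD2] := sD; have iUD := sqintgM sU sD.
    have i1 : intg P (fun w => (a * s) ^+ 2 * U w ^+ 2) by exact: intgZ.
    have i2 : intg P (fun w => 2 * (a * s) * (U w * dot u (X w))) by exact: intgZ.
    rewrite ExD//; last exact: intgD.
    by rewrite ExD// !ExZ// UD mulr0 addr0.
  by rewrite !E; ring.
(* Since f(V a) = a U 1_A(X), equality of the laws for a = 1 and a = -1 makes the expectation equal
   to its opposite. *)
pose f (v : 'cV[R]_(1 + k)) := v (lshift k 0) 0 * \1_A (dsubmx v).
have mf : measurable_fun setT f.
  apply: measurable_funM; first exact: measurable_coord.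
  have md : measurable_fun setT (@dsubmx R 1 k 1).
    apply: measurable_cV => i; under eq_fun do rewrite mxE; exact: measurable_coord.
  by apply: (measurableT_comp _ md).
have mXA : measurable (X @^-1` A) by have := mX measurableT A mA; rewrite setTI.
have fV a w : f (V a w) = a * (U w * \1_A (X w)).
  by rewrite /f /V col_mxEu mxE col_mxKd mulrA.
have iUA : intg P (fun w => U w * \1_A (X w)).
  exact: (intgM_indic mXA (sqintg_intg sU)).
have if1 : intg P (fun w => f (V 1 w)) by under eq_fun do rewrite fV; exact: intgZ.
have := Ex_transfer (mV 1) (mV (- 1)) law mf if1.
by rewrite (funext (fV 1)) (funext (fV (- 1))) !ExZ//; lra.
Qed.

End gaussian_uncorrelated.

(** * Conditional expectation and probability *)

Section conditional_expectation.
Context d (T : measurableType d) (R : realType) (P : probability T R).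

Lemma integral_indicM (X : T -> R) (A : set T) :
  (\int[P]_(w in A) (X w)%:E = \int[P]_w (X w * \1_A w)%:E)%E.
Proof.
rewrite integral_mkcond; apply: eq_integral => w _ /=.
by rewrite patchE indicE; case: ifPn => _; rewrite ?mulr1 ?mulr0.
Qed.

(** Dynkin induction on the event. The complement step needs E X = 0, which is the hypothesis for
    the rectangle of the two whole spaces. *)
Lemma Ex_indic_pair0 d1 d2 (T1 : measurableType d1) (T2 : measurableType d2)
    (X : T -> R) (V1 : T -> T1) (V2 : T -> T2) : intg P X ->
  measurable_fun setT V1 -> measurable_fun setT V2 ->
  (forall A B, measurable A -> measurable B ->
    Ex P (fun w => X w * (\1_A (V1 w) * \1_B (V2 w))) = 0) ->
  forall C, measurable C -> Ex P (fun w => X w * \1_C (V1 w, V2 w)) = 0.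
Proof.
move=> iX mV1 mV2 H.
have mV : measurable_fun setT (fun w => (V1 w, V2 w)) by exact: measurable_fun_pair.
have mpre C : measurable C -> measurable ((fun w => (V1 w, V2 w)) @^-1` C).
  by move=> mC; have := mV measurableT C mC; rewrite setTI.
have HX A B : measurable A -> measurable B ->
    Ex P (fun w => X w * \1_(A `*` B) (V1 w, V2 w)) = 0.
  move=> mA mB; rewrite -(H A B mA mB); congr Ex; apply/funext => w.
  by rewrite !indicE in_setX/=; case: (_ \in A); case: (_ \in B); rewrite /= ?mulr1 ?mulr0.
have X0 : Ex P X = 0.
  rewrite -(HX setT setT measurableT measurableT); congr Ex; apply/funext => w.
  by rewrite setXTT indicT mulr1.
change (measurable `<=` [set C | Ex P (fun w => X w * \1_C (V1 w, V2 w)) = 0]).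
apply: measurable_prod_ind => [A B mA mB|C mC /= EC|F tF mF EF /=].
- exact: HX.
- have iC : intg P (fun w => X w * \1_C (V1 w, V2 w)).
    exact: (intgM_indic (mpre _ mC) iX).
  have -> : (fun w => X w * \1_(~` C) (V1 w, V2 w)) =
      (fun w => X w - X w * \1_C (V1 w, V2 w)).
    apply/funext => w; rewrite !indicE in_setC.
    by case: (_ \in C); rewrite /= ?mulr0 ?mulr1 ?subrr ?subr0.
  by rewrite ExB// X0 EC subrr.
- have := @Ex_indic_bigcup _ _ _ P X (fun i => (fun w => (V1 w, V2 w)) @^-1` F i) iX.
  rewrite -preimage_bigcup; apply => //.
  + by move=> i j _ _ [w [Fi Fj]]; apply: (tF _ _ I I); exists (V1 w, V2 w).
  + by move=> i; exact: mpre.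
Qed.

Section given.
Context d1 (T1 : measurableType d1) (V : T -> T1).
Hypothesis mV : measurable_fun setT V.

Lemma measurable_given A : g_sigma_algebra_preimage V A -> measurable A.
Proof. by move=> [C mC <-]; exact: mV. Qed.

Lemma measurable_fun_given (Y : T -> R) :
  measurable_fun [set: g_sigma_algebra_preimageType V] Y -> measurable_fun setT Y.
Proof. by move=> mY mT B mB; apply: measurable_given; exact: mY. Qed.

Lemma cond_expectation_Ex (X Y : T -> R) C : cond_expectation P V X Y ->
  measurable C ->
  Ex P (fun w => Y w * \1_C (V w)) = Ex P (fun w => X w * \1_C (V w)).
Proof.
move=> [_ _ XY] mC; rewrite /Ex /Rintegral -!integral_indicM XY//.
by exists C => //; rewrite setTI.
Qed.

Lemma ae_eq_Ex (X Y : T -> R) : measurable_fun setT X -> measurable_fun setT Y ->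
  {ae P, forall w, X w = Y w} -> Ex P X = Ex P Y.
Proof.
move=> mX mY XY; rewrite /Ex /Rintegral; congr fine; apply: ae_eq_integral => //.
- exact/measurable_EFinP.
- exact/measurable_EFinP.
- by apply: filterS XY => w -> _.
Qed.

(** Uniqueness of conditional expectations: D = Y - g(V) is measurable given [V] and integrates to 0
    over every event given [V]. Testing it on {D > 0} and on the whole space gives E|D| = 0. *)
Lemma cond_expectation_ae (X Y : T -> R) (g : T1 -> R) : measurable_fun setT g ->
  cond_expectation P V X Y -> intg P X -> intg P (fun w => g (V w)) ->
  (forall C, measurable C -> Ex P (fun w => (X w - g (V w)) * \1_C (V w)) = 0) ->
  {ae P, forall w, Y w = g (V w)}.
Proof.
move=> mg XY iX ig Hg; have [mY iY _] := XY; rewrite -/(intg P Y) in iY.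
pose D w := Y w - g (V w).
have iD : intg P D by exact: intgB.
have mpre C : measurable C -> measurable (V @^-1` C).
  by move=> mC; have := mV measurableT mC; rewrite setTI.
have D0 C : measurable C -> Ex P (fun w => D w * \1_C (V w)) = 0.
  move=> mC; have mVC := mpre _ mC.
  have iYC : intg P (fun w => Y w * \1_C (V w)) by exact: (intgM_indic mVC iY).
  have iXC : intg P (fun w => X w * \1_C (V w)) by exact: (intgM_indic mVC iX).
  have igC : intg P (fun w => g (V w) * \1_C (V w)) by exact: (intgM_indic mVC ig).
  rewrite -(Hg C mC) /D; under eq_fun do rewrite mulrBl.
  by under [in RHS]eq_fun do rewrite mulrBl; rewrite !ExB// (cond_expectation_Ex XY mC).
have mDV : measurable_fun [set: g_sigma_algebra_preimageType V] D.
  apply: measurable_funB => //; move=> _ B mB; exists (g @^-1` B); last by rewrite setTI.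
  by have := mg measurableT B mB; rewrite setTI.
have [C mC CE] : g_sigma_algebra_preimage V [set w | 0 < D w].
  have := measurable_fun_ltr (measurable_cst (0 : R)) mDV.
  by move=> /(_ measurableT [set true]); rewrite setTI; apply.
have CE' w : \1_C (V w) = (0 < D w)%R%:R :> R.
  rewrite indicE; congr (nat_of_bool _)%:R; apply/idP/idP.
    by rewrite inE => Cw; have : (setT `&` V @^-1` C) w by []; rewrite CE.
  by move=> Dw; rewrite inE; have : [set w | 0 < D w] w by []; rewrite -CE => -[].
have absD : Ex P (fun w => `|D w|) = 0.
  have -> : (fun w => `|D w|) = (fun w => 2 * (D w * \1_C (V w)) - D w * \1_setT (V w)).
    apply/funext => w; rewrite CE' indicT; have [D0'|D0'] := ltP 0 (D w).
      by rewrite gtr0_norm//=; ring.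
    by rewrite ler0_norm//=; ring.
  have i1 : intg P (fun w => 2 * (D w * \1_C (V w))).
    by apply: intgZ; exact: (intgM_indic (mpre _ mC) iD).
  have i2 : intg P (fun w => D w * \1_setT (V w)).
    exact: (intgM_indic (mpre _ measurableT) iD).
  by rewrite ExB// ExZ ?D0// ?mulr0 ?subrr//; exact: (intgM_indic (mpre _ mC) iD).
have mD := intg_meas iD.
have iaD : intg P (fun w => `|D w|).
  by apply: (le_intg _ _ iD) => [|w]; [exact: measurableT_comp|rewrite normr_id].
have I0 : (\int[P]_w `|(D w)%:E| = 0)%E.
  by have := ExE iaD; rewrite absD => <-.
have mD' : measurable_fun setT (EFin \o D) by exact/measurable_EFinP.
have := (ae_eq_integral_abs P measurableT mD').1 I0.
by apply: filterS => w /(_ I) [] /eqP; rewrite subr_eq0 => /eqP.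
Qed.

End given.
End conditional_expectation.

Section conditional_probability.
Context d (T : measurableType d) (R : realType) (P : probability T R).

(* Unlike in the library, [f] and [g] need not be measurable: the event of [cond_probability]
   is not assumed to be. *)
Lemma le_integral_nonmeasurable (A : set T) (f g : T -> \bar R) :
  (forall x, 0 <= f x)%E -> (forall x, f x <= g x)%E ->
  (\int[P]_(x in A) f x <= \int[P]_(x in A) g x)%E.
Proof.
move=> f0 fg; have g0 x : (0 <= g x)%E by exact: le_trans (f0 x) (fg x).
rewrite !ge0_integralE//; apply: ereal_sup_le => _ [h hf <-]; exists h => // x.
by apply: le_trans (hf x) _; rewrite /patch; case: ifP.
Qed.

Context d1 (T1 : measurableType d1) (V : T -> T1).
Hypothesis mV : measurable_fun setT V.

(** A possibly nonmeasurable [E] is controlled by a measurable [D] containing it. The bounds hold on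
    average over events given [V], which is all that a version offers. *)
Lemma cond_probability_le (E D A : set T) (p : T -> R) :
  cond_probability P V E p -> E `<=` D -> measurable D ->
  g_sigma_algebra_preimage V A ->
  (0 <= \int[P]_(w in A) (p w)%:E <= P (D `&` A))%E.
Proof.
move=> [_ _ pE] ED mD sA; rewrite pE//; apply/andP; split.
  by apply: integral_ge0 => w _; rewrite lee_fin.
rewrite -integral_indic//; last exact: (measurable_given mV).
apply: le_integral_nonmeasurable => w; rewrite lee_fin//.
rewrite !indicE; case: (boolP (w \in E)) => // wE.
by rewrite mem_set//; apply: ED; exact: set_mem.
Qed.

(* A maximal inequality: on the first passage of [p] above [c] after time [N], which is an event
   given [V], the average of [p] is at most the probability of the union of the later [E' n]. *)
Lemma cond_probability_cvg0 (E E' : nat -> set T) (p : nat -> T -> R) m :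
  (forall n, (m < n)%N -> cond_probability P V (E n) (p n)) ->
  (forall n, E n `<=` E' n) -> (forall n, measurable (E' n)) ->
  {ae P, forall w, \forall n \near \oo, ~ E' n w} ->
  {ae P, forall w, p ^~ w @ \oo --> 0}.
Proof.
move=> pE EE' mE' aeE'.
pose D N := \bigcup_(k in [set k | (N <= k)%N]) E' k.
have mD N : measurable (D N) by apply: bigcup_measurable.
(* The tails [D N] decrease to the limsup of the [E' n], a null event. *)
have D0 : P (D N) @[N --> \oo] --> 0%E.
  have <- : P (lim_sup_set E') = 0%E.
    have mL : measurable (lim_sup_set E') by exact: bigcapT_measurable.
    apply/(measure_negligible mL); apply: negligibleS aeE' => w Lw /= [N _ HN].
    by have [k /= Nk Ek] := Lw N I; exact: (HN k Nk Ek).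
  apply: lim_sup_set_cvg => //.
  by rewrite (le_lt_trans (probability_le1 _ _)) ?ltry//; exact: mD.
have mp n : (m < n)%N -> measurable_fun [set: g_sigma_algebra_preimageType V] (p n).
  by move=> mn; case: (pE n mn).
have ip n : (m < n)%N -> intg P (p n) by move=> mn; case: (pE n mn).
have gt_sigma n c : (m < n)%N -> g_sigma_algebra_preimage V [set w | c < p n w].
  move=> mn; have := measurable_fun_ltr (measurable_cst c) (mp n mn).
  by move=> /(_ measurableT [set true]); rewrite setTI; apply.
have lt_sigma n c : (m < n)%N -> g_sigma_algebra_preimage V [set w | p n w < c].
  move=> mn; have := measurable_fun_ltr (mp n mn) (measurable_cst c).
  by move=> /(_ measurableT [set true]); rewrite setTI; apply.
have upper n c A : (m < n)%N -> 0 < c -> g_sigma_algebra_preimage V A ->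
    A `<=` [set w | c < p n w] -> (c%:E * P A <= P (E' n `&` A))%E.
  move=> mn c0 sA Ac; have mA := measurable_given mV sA.
  have /andP[_] := cond_probability_le (pE n mn) (EE' n) (mE' n) sA.
  apply: le_trans; rewrite -[leLHS]integral_cst//.
  apply: le_integral => //.
  - by apply: integrableS (intg_cst P c).
  - by apply: integrableS (ip n mn).
  - by move=> w; rewrite inE => /Ac /= /ltW; rewrite lee_fin.
(* A version may be negative on a null set. It is tested on {p n < -1/(j+1)}, where positive
   probability would make the integral negative, against the lower bound. *)
have pge0 : {ae P, forall w, forall n, (m < n)%N -> 0 <= p n w}.
  apply: ae_foralln => n; have [mn|mn] := ltnP m n; last first.
    by apply: aeW.
  have H : {ae P, forall w, forall j : nat, - j.+1%:R^-1 <= p n w}.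
    apply: ae_foralln => j; have sA := lt_sigma n (- j.+1%:R^-1) mn.
    set A := [set w | _] in sA; have mA := measurable_given mV sA.
    have /andP[h _] := cond_probability_le (pE n mn) (EE' n) (mE' n) sA.
    exists A; split=> //; last by move=> w /= /negP; rewrite -ltNge.
    apply/eqP; rewrite -measure_le0.
    have : (0 <= (- j.+1%:R^-1)%:E * P A)%E.
      apply: le_trans h _; rewrite -[leRHS]integral_cst//; apply: le_integral => //.
      - by apply: integrableS (ip n mn).
      - by apply: integrableS (intg_cst P _).
      - by move=> w; rewrite inE lee_fin => /ltW.
    by rewrite EFinN mulNe oppe_ge0 pmule_rle0// lte_fin invr_gt0.
  apply: filterS H => w H _; rewrite leNgt; apply/negP => p0.
  have := H (Num.truncn (- p n w)^-1); rewrite leNgt => /negP; apply.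
  rewrite ltrNr invf_plt ?posrE ?oppr_gt0//.
  by rewrite real_truncnS_gt// num_real.
have small c : 0 < c -> {ae P, forall w, \forall n \near \oo, p n w <= c}.
  move=> c0.
  pose F N k := [set w | c < p (N + k)%N w].
  (* The shift by m + 1 stays in the range n > m where [p n] is a version. *)
  pose L := lim_sup_set (fun n => F m.+1 n).
  have mF N k : (m < N)%N -> measurable (F N k).
    move=> mN; apply: (measurable_given mV); apply: gt_sigma.
    by rewrite (leq_trans mN)// leq_addr.
  have bound N : (m < N)%N -> (c%:E * P (\bigcup_k F N k) <= P (D N))%E.
    move=> mN; have mNk k : (m < N + k)%N by rewrite (leq_trans mN)// leq_addr.
    (* [seqDU] splits the union according to the first index at which [p] exceeds c; each piece is
       an event given [V], so the average bound applies to it. *)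
    have sF k : g_sigma_algebra_preimage V (seqDU (F N) k).
      rewrite /seqDU; have := gt_sigma (N + k)%N c (mNk k).
      have sU : g_sigma_algebra_preimage V (\big[setU/set0]_(j < k) F N j).
        apply: (@bigsetU_measurable _ (g_sigma_algebra_preimageType V)) => j _.
        exact: gt_sigma.
      move=> s1; exact: (@measurableD _ (g_sigma_algebra_preimageType V)).
    have mS k : measurable (seqDU (F N) k) by apply: (measurable_given mV).
    have -> : P (\bigcup_k F N k) = (\sum_(k <oo) P (seqDU (F N) k))%E.
      rewrite seqDU_bigcup_eq measure_bigcup//.
      by apply: eq_eseriesl => k; rewrite in_setT.
    rewrite -nneseriesZl//.
    apply: (@le_trans _ _ (\sum_(k <oo) P (D N `&` seqDU (F N) k))%E).
      apply: lee_nneseries => [k _ _|k _].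
        by rewrite mule_ge0// lee_fin ltW.
      apply: le_trans (upper (N + k)%N c _ (mNk k) c0 (sF k) _) _.
        exact: subset_seqDU.
      apply: le_measure; rewrite ?inE//.
      - by apply: measurableI.
      - by apply: measurableI.
      - by apply: setSI => w Ew; exists (N + k)%N => //=; exact: leq_addr.
    rewrite -[leLHS](_ : P (\bigcup_k (D N `&` seqDU (F N) k)) = _); last first.
      rewrite measure_bigcup//.
      - by apply: eq_eseriesl => k; rewrite in_setT.
      - by move=> k _; exact: measurableI.
      - by apply: trivIset_setIl; exact: trivIset_seqDU.
    apply: le_measure; rewrite ?inE//.
    - by apply: bigcupT_measurable => k; exact: measurableI.
    - by move=> w [k _ []].
  have mL : measurable L.
    by apply: bigcapT_measurable => n; apply: bigcup_measurable => k _; exact: mF.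
  (* [L] lies in every union of late passages, so letting N grow forces P L = 0. *)
  have cL N : (c%:E * P L <= P (D (m.+1 + N)%N))%E.
    apply: le_trans (bound (m.+1 + N)%N _); last by rewrite addSn ltnS leq_addr.
    rewrite lee_pmul2l//; apply: le_measure; rewrite ?inE//.
    - by apply: bigcupT_measurable => k; apply: mF; rewrite addSn ltnS leq_addr.
    - move=> w /(_ N I)[k /= Nk Fk]; exists (k - N)%N => //.
      by rewrite /F /= -addnA subnKC.
  have PL0 : P L = 0%E.
    have : (c%:E * P L <= 0)%E.
      have D0' : P (D (m.+1 + N)%N) @[N --> \oo] --> 0%E.
        have := D0; rewrite -(cvg_shiftn m.+1); apply: cvg_trans.
        by apply: near_eq_cvg; apply: nearW => N; rewrite addnC.
      by have /cvge_to_ge := D0'; apply; exact: nearW.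
    by rewrite pmule_rle0 ?lte_fin// measure_le0 => /eqP.
  exists L; split=> // w /= nw n _; apply: contrapT => h; apply: nw.
  exists (m.+1 + n)%N => // k /= nk; rewrite leNgt; apply/negP => ck; apply: h.
  exists (k - m.+1)%N => /=; first by rewrite leq_subRL// (leq_trans _ nk)// leq_addr.
  by rewrite /F /= subnKC// (leq_trans _ nk)// leq_addr.
have smallj : {ae P, forall w, forall j : nat, \forall n \near \oo, p n w <= j.+1%:R^-1}.
  by apply: ae_foralln => j; apply: small; rewrite invr_gt0.
apply: filterS2 pge0 smallj => w p0 pj.
apply/cvgr0Pnorm_le => eps e0.
have je : (Num.truncn eps^-1).+1%:R^-1 <= eps.
  rewrite -[X in _ <= X]invrK lef_pV2 ?posrE ?invr_gt0//.
  by rewrite ltW// real_truncnS_gt// num_real.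
near=> n; rewrite ger0_norm; last by apply: p0; near: n; exact: nbhs_infty_gt.
by apply: le_trans je; near: n; exact: pj.
Unshelve. all: by end_near. Qed.

End conditional_probability.

(** * The predictor as a function of the sample moments *)

(* Unlike invmx and mp_inv, a continuous function of its entries. *)
Definition adj_inv (R : realType) n (M : 'M[R]_n) := (\det M)^-1 *: \adj M.

Lemma invmx_adj_inv (R : realType) n (M : 'M[R]_n) : M \in unitmx -> invmx M = adj_inv M.
Proof. by move=> uM; rewrite /invmx uM. Qed.

Lemma mp_inv_adj_inv (R : realType) n (M : 'M[R]_n) : M \in unitmx -> mp_inv M = adj_inv M.
Proof.
move=> uM; rewrite -invmx_adj_inv//; apply: penrose_unique (penrose_mp_inv M) _.
by split; rewrite ?(mulmxV uM) ?(mulVmx uM) ?mul1mx ?trmx1.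
Qed.

Section plug_in.
Variables (R : realType) (d q m : nat).

(** [adj_inv] makes this rational in the entries of all its arguments. Evaluated at the sample
    moments it is eventually the estimator, and at the population moments its limit. *)
Definition plug_in (Srr : 'M[R]_(q + m)) (Sry : 'M[R]_(q + m, d)) (Sxx : 'M[R]_m)
    (my : 'cV[R]_d) (mz : 'cV[R]_q) (mx : 'cV[R]_m) (S : 'M[R]_(d, m))
    (z0 : 'cV[R]_q) (x0 : 'cV[R]_m) : 'cV[R]_d :=
  let G := adj_inv Srr *m Sry in
  my - (usubmx G)^T *m mz - (dsubmx G)^T *m mx + (usubmx G)^T *m z0 + (dsubmx G)^T *m x0
    - S *m adj_inv Sxx *m (x0 - mx).

Lemma eta_tildeE n (y : nat -> 'cV[R]_d) (z : nat -> 'cV[R]_q) (x : nat -> 'cV[R]_m)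
    S z0 x0 : let r i := col_mx (z i) (x i) in
  \det (sample_cov n r r) != 0 -> \det (Sigma_x_hat n x) != 0 ->
  eta_tilde n y z x S z0 x0 =
  plug_in (sample_cov n r r) (sample_cov n r y) (Sigma_x_hat n x)
    (sample_mean n y) (sample_mean n z) (sample_mean n x) S z0 x0.
Proof.
move=> r; rewrite -!unitfE => ur ux.
rewrite /eta_tilde /ols_predictor /ols_b /ols_C /ols_B /ols_coef -/r.
by rewrite mp_inv_adj_inv// invmx_adj_inv.
Qed.

Lemma sample_meanE n k (u : nat -> 'cV[R]_k) a :
  sample_mean n u a 0 = n%:R^-1 * \sum_(1 <= i < n.+1) u i a 0.
Proof. by rewrite mxE summxE. Qed.

(** Reduces a covariance centred at sample means to plain averages, to which the strong law applies.
    For n = 0 both sides are 0, as 0^-1 = 0. *)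
Lemma sample_covE n k l (u : nat -> 'cV[R]_k) (v : nat -> 'cV[R]_l) a b :
  sample_cov n u v a b = n%:R^-1 * \sum_(1 <= i < n.+1) u i a 0 * v i b 0 -
    sample_mean n u a 0 * sample_mean n v b 0.
Proof.
rewrite mxE summxE.
have [n0|n0] := eqVneq (n%:R : R) 0.
  by rewrite !sample_meanE n0 invr0 !mul0r subr0.
have E (s : 'cV[R]_k) (t : 'cV[R]_l) i : ((u i - s) *m (v i - t)^T) a b =
    (u i a 0 * v i b 0 - s a 0 * v i b 0) - (u i a 0 - s a 0) * t b 0.
  by rewrite mxE big_ord1 !mxE; ring.
under eq_bigr do rewrite E.
rewrite !sumrB -mulr_sumr -mulr_suml sumrB sumr_const_nat subn1/= -mulr_natl.
have -> : \sum_(1 <= i < n.+1) v i b 0 = n%:R * sample_mean n v b 0.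
  by rewrite sample_meanE mulVKf.
have -> : \sum_(1 <= i < n.+1) u i a 0 = n%:R * sample_mean n u a 0.
  by rewrite sample_meanE mulVKf.
by move: (sample_mean _ _ _ _) (sample_mean _ _ _ _) => s t; field.
Qed.

End plug_in.

Section entrywise_closure.
Variables (R : realType) (I : Type) (A : (I -> R) -> Prop).
Hypothesis A_cst : forall c, A (fun=> c).
Hypothesis AD : forall f g, A f -> A g -> A (fun i => f i + g i).
Hypothesis AM : forall f g, A f -> A g -> A (fun i => f i * g i).

(** [A] stands for a class of functions containing the constants and stable under sums and products,
    hence under polynomial expressions. It is instantiated by convergence of sequences and by
    measurability, so that each matrix formula is traversed once for both. *)
Definition entrywise m n (M : I -> 'M[R]_(m, n)) := forall a b, A (fun i => M i a b).

Lemma closure_sum (J : Type) (s : seq J) (p : pred J) (f : J -> I -> R) :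
  (forall j, A (f j)) -> A (fun i => \sum_(j <- s | p j) f j i).
Proof.
move=> Af; elim: s => [|j s IH]; first by under eq_fun do rewrite big_nil.
by under eq_fun do rewrite big_cons; case: (p j) => //; exact: AD.
Qed.

Lemma closure_prod (J : Type) (s : seq J) (f : J -> I -> R) :
  (forall j, A (f j)) -> A (fun i => \prod_(j <- s) f j i).
Proof.
move=> Af; elim: s => [|j s IH]; first by under eq_fun do rewrite big_nil.
by under eq_fun do rewrite big_cons; exact: AM.
Qed.

Lemma entrywiseM m n p (M : I -> 'M[R]_(m, n)) (N : I -> 'M[R]_(n, p)) :
  entrywise M -> entrywise N -> entrywise (fun i => M i *m N i).
Proof.
by move=> AM' AN a b; under eq_fun do rewrite mxE; apply: closure_sum => j; exact: AM.
Qed.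

Lemma entrywiseD m n (M N : I -> 'M[R]_(m, n)) :
  entrywise M -> entrywise N -> entrywise (fun i => M i + N i).
Proof. by move=> AM' AN a b; under eq_fun do rewrite mxE; exact: AD. Qed.

Lemma entrywiseZ m n c (M : I -> 'M[R]_(m, n)) :
  A c -> entrywise M -> entrywise (fun i => c i *: M i).
Proof. by move=> Ac AM' a b; under eq_fun do rewrite mxE; exact: AM. Qed.

Lemma entrywiseN m n (M : I -> 'M[R]_(m, n)) :
  entrywise M -> entrywise (fun i => - M i).
Proof.
move=> AM' a b; under eq_fun do rewrite mxE -mulN1r.
exact: (AM (A_cst (- 1)) (AM' a b)).
Qed.

Lemma entrywiseB m n (M N : I -> 'M[R]_(m, n)) :
  entrywise M -> entrywise N -> entrywise (fun i => M i - N i).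
Proof. by move=> AM' AN; apply: entrywiseD => //; exact: entrywiseN. Qed.

Lemma entrywise_sum (J : Type) (s : seq J) m n (M : J -> I -> 'M[R]_(m, n)) :
  (forall j, entrywise (M j)) -> entrywise (fun i => \sum_(j <- s) M j i).
Proof.
by move=> AM' a b; under eq_fun do rewrite summxE; apply: closure_sum => j; exact: AM'.
Qed.

Lemma entrywise_tr m n (M : I -> 'M[R]_(m, n)) :
  entrywise M -> entrywise (fun i => (M i)^T).
Proof. by move=> AM' a b; under eq_fun do rewrite mxE. Qed.

Lemma entrywise_usub m1 m2 n (M : I -> 'M[R]_(m1 + m2, n)) :
  entrywise M -> entrywise (fun i => usubmx (M i)).
Proof. by move=> AM' a b; under eq_fun do rewrite mxE. Qed.

Lemma entrywise_dsub m1 m2 n (M : I -> 'M[R]_(m1 + m2, n)) :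
  entrywise M -> entrywise (fun i => dsubmx (M i)).
Proof. by move=> AM' a b; under eq_fun do rewrite mxE. Qed.

Lemma entrywise_cst m n (M : 'M[R]_(m, n)) : entrywise (fun=> M).
Proof. by move=> a b. Qed.

Lemma closure_det n (M : I -> 'M[R]_n) : entrywise M -> A (fun i => \det (M i)).
Proof.
move=> AM'; apply: closure_sum => s; apply: AM => //.
by apply: closure_prod => j.
Qed.

Lemma entrywise_adj n (M : I -> 'M[R]_n) :
  entrywise M -> entrywise (fun i => \adj (M i)).
Proof.
move=> AM' a b; under eq_fun do rewrite mxE; apply: AM => //.
by apply: closure_det => c e; under eq_fun do rewrite !mxE.
Qed.

(** The inverse of the determinant is the one nonpolynomial ingredient and is left as a hypothesis:
    convergence draws it from a nonzero limit, measurability from that of inversion. *)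
Lemma entrywise_adj_inv n (M : I -> 'M[R]_n) : entrywise M ->
  A (fun i => (\det (M i))^-1) -> entrywise (fun i => adj_inv (M i)).
Proof. by move=> AM' Ad; apply: entrywiseZ => //; exact: entrywise_adj. Qed.

Lemma entrywise_plug_in d q m (Srr : I -> 'M[R]_(q + m)) (Sry : I -> 'M[R]_(q + m, d))
    (Sxx : I -> 'M[R]_m) my mz mx (S : 'M[R]_(d, m)) z0 x0 :
  entrywise Srr -> entrywise Sry -> entrywise Sxx ->
  A (fun i => (\det (Srr i))^-1) -> A (fun i => (\det (Sxx i))^-1) ->
  entrywise my -> entrywise mz -> entrywise mx -> entrywise z0 -> entrywise x0 ->
  entrywise (fun i =>
    plug_in (Srr i) (Sry i) (Sxx i) (my i) (mz i) (mx i) S (z0 i) (x0 i)).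
Proof.
move=> ASrr ASry ASxx Adr Adx Amy Amz Amx Az0 Ax0.
have AG : entrywise (fun i => adj_inv (Srr i) *m Sry i).
  by apply: entrywiseM => //; exact: entrywise_adj_inv.
have AGu := entrywise_tr (entrywise_usub AG).
have AGd := entrywise_tr (entrywise_dsub AG).
have ASI := entrywise_adj_inv ASxx Adx.
apply: entrywiseB.
  do 2 (apply: entrywiseD; last exact: entrywiseM).
  by do 2 (apply: entrywiseB; last exact: entrywiseM).
apply: entrywiseM; last exact: entrywiseB.
by apply: entrywiseM => //; exact: entrywise_cst.
Qed.

End entrywise_closure.

Section closure_instances.
Variable R : realType.

(* A sequence and its limit, packed into one function on [option nat] so that convergence is a
   closure property in the sense of [entrywise]. *)
Definition cvg_none (u : option nat -> R) := (fun n => u (Some n)) @ \oo --> u None.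

Lemma cvg_none_cst c : cvg_none (fun=> c). Proof. exact: cvg_cst. Qed.

Lemma cvg_noneD f g : cvg_none f -> cvg_none g -> cvg_none (fun i => f i + g i).
Proof. exact: cvgD. Qed.

Lemma cvg_noneM f g : cvg_none f -> cvg_none g -> cvg_none (fun i => f i * g i).
Proof. exact: cvgM. Qed.

Lemma cvg_noneV f : f None != 0 -> cvg_none f -> cvg_none (fun i => (f i)^-1).
Proof. by move=> f0 cf; exact: cvgV. Qed.

(** Inversion is the pointwise limit of the continuous functions x / (x^2 + 1/(n+1)), which also
    produce the value 0^-1 = 0 at the origin. *)
Lemma measurable_inv : measurable_fun setT (fun x : R => x^-1).
Proof.
pose f n (x : R) := x * (x ^+ 2 + n.+1%:R^-1)^-1.
have den0 n (x : R) : x ^+ 2 + n.+1%:R^-1 != 0.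
  by rewrite gt_eqF// ltr_wpDl ?sqr_ge0// invr_gt0.
apply: (measurable_fun_cvg (h := f)) => [n|x _].
  apply: continuous_measurable_fun => x; apply: cvgM; first exact: cvg_id.
  apply: cvgV => //; apply: cvgD; last exact: cvg_cst.
  exact: exprn_continuous.
have [->|x0] := eqVneq x 0.
  by rewrite invr0; under eq_fun do rewrite /f mul0r; exact: cvg_cst.
have -> : x^-1 = x * (x ^+ 2 + 0)^-1 by rewrite addr0 expr2 invfM mulVKf.
apply: cvgM; first exact: cvg_cst.
apply: cvgV; first by rewrite addr0 sqrf_eq0.
by apply: cvgD; [exact: cvg_cst|exact: cvg_harmonic].
Qed.

End closure_instances.

Lemma cvg_cV (R : realType) k (u : nat -> 'cV[R]_k) (v : 'cV[R]_k) :
  (forall a, (fun n => u n a 0) @ \oo --> v a 0) -> u @ \oo --> v.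
Proof.
move=> cu B [Q vQ QB]; apply: filterS (QB : _ `<=` B) _ => /=.
have : \forall n \near \oo, forall a, Q a 0 (u n a 0).
  by apply: filter_forall => a; exact: (cu a _ (vQ a 0)).
by apply: filterS => n H a b; rewrite (ord1 b).
Qed.

(** * The errors-in-variables model *)

Section model.
Context (dT : measure_display) (T : measurableType dT) (R : realType)
  (P : probability T R) (d q m : nat)
  (b : 'cV[R]_d) (C : 'M[R]_(q, d)) (B : 'M[R]_(m, d))
  (y : {RV P >-> 'cV[R]_d}) (z : {RV P >-> 'cV[R]_q})
  (xi : {RV P >-> 'cV[R]_m}) (e eps : {RV P >-> 'cV[R]_d})
  (x delta : {RV P >-> 'cV[R]_m}).
Hypothesis model : eiv_model b C B y z xi e eps x delta.

Let W w := (eps w, delta w).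

Local Notation ed := ('cV[R]_d * 'cV[R]_m)%type.
Local Notation xied := ('cV[R]_m * ed)%type.
Local Notation zxi := ('cV[R]_q * 'cV[R]_m)%type.

Let mz : measurable_fun setT z. Proof. by []. Qed.
Let mx : measurable_fun setT x. Proof. by []. Qed.
Let my : measurable_fun setT y. Proof. by []. Qed.
Let mW : measurable_fun setT W. Proof. exact: measurable_fun_pair. Qed.

(** The factorisation for fewer blocks is drawn from this one by taking the whole space for the
    others. *)
Lemma indep4 A1 A2 A3 A4 : measurable A1 -> measurable A2 -> measurable A3 -> measurable A4 ->
  P (z @^-1` A1 `&` (xi @^-1` A2 `&` (e @^-1` A3 `&` W @^-1` A4))) =
  (P (z @^-1` A1) * (P (xi @^-1` A2) * (P (e @^-1` A3) * P (W @^-1` A4))))%E.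
Proof.
move=> m1 m2 m3 m4.
pose i0 : 'I_4 := Ordinal (isT : (0 < 4)%N); pose i1 : 'I_4 := Ordinal (isT : (1 < 4)%N).
pose i2 : 'I_4 := Ordinal (isT : (2 < 4)%N); pose i3 : 'I_4 := Ordinal (isT : (3 < 4)%N).
pose E := tnth [tuple z @^-1` A1; xi @^-1` A2; e @^-1` A3; W @^-1` A4].
have := eiv_indep model (J := (i0 |` (i1 |` (i2 |` [fset i3])))%fset) (E := E).
rewrite !big_fsetU1 ?inE//= big_seq_fset1 /E !(tnth_nth set0)/= => <-.
  congr (P _); apply/seteqP; split=> [w [w1 [w2 [w3 w4]]] i /=|w h].
    by rewrite !inE => /or4P[] /eqP ->; rewrite (tnth_nth set0).
  split; [|split; [|split]].
  - by have := h i0; rewrite (tnth_nth set0); apply; rewrite /= !inE.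
  - by have := h i1; rewrite (tnth_nth set0); apply; rewrite /= !inE.
  - by have := h i2; rewrite (tnth_nth set0); apply; rewrite /= !inE.
  - by have := h i3; rewrite (tnth_nth set0); apply; rewrite /= !inE.
move=> i; rewrite !inE => /or4P[] /eqP ->; rewrite !(tnth_nth set0)/=.
- by exists A1; rewrite ?setTI.
- by exists A2; rewrite ?setTI.
- by exists A3; rewrite ?setTI.
- by exists A4; rewrite ?setTI.
Qed.

Let PT : P setT = 1%E. Proof. exact: probability_setT. Qed.

Lemma indep_z_xiW : indep2 P z (fun w => (xi w, W w)).
Proof.
apply: indep2_pair => // A1 A2 A3 m1 m2 m3.
have := indep4 m1 m2 measurableT m3; have := indep4 measurableT m2 measurableT m3.
by rewrite !preimage_setT !setTI PT !mul1e => -> ->.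
Qed.

Lemma indep_e_zxi : indep2 P e (fun w => (z w, xi w)).
Proof.
apply: indep2_pair => // A1 A2 A3 m1 m2 m3.
have := indep4 m2 m3 m1 measurableT; have := indep4 m2 m3 measurableT measurableT.
rewrite !preimage_setT !setTI !setIT PT !mule1 => E0 E1.
by rewrite E0 muleC -muleA -E1 setIC -setIA.
Qed.

Lemma indep_W_zxi : indep2 P W (fun w => (z w, xi w)).
Proof.
apply: indep2_pair => // A1 A2 A3 m1 m2 m3.
have := indep4 m2 m3 measurableT m1; have := indep4 m2 m3 measurableT measurableT.
rewrite !preimage_setT !setTI !setIT PT !mul1e !mule1 => E0 E1.
by rewrite E0 muleC -muleA -E1 setIC -setIA.
Qed.

Lemma indep_e_W : indep2 P e W.
Proof.
move=> A1 A2 m1 m2; have := indep4 measurableT measurableT m1 m2.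
by rewrite !preimage_setT !setTI PT !mul1e.
Qed.

Let sz i : sqintg P (fun w => z w i 0). Proof. exact/Lfun2_sqintg/(eiv_moment_z model). Qed.
Let sxi i : sqintg P (fun w => xi w i 0). Proof. exact/Lfun2_sqintg/(eiv_moment_xi model). Qed.
Let se i : sqintg P (fun w => e w i 0). Proof. exact/Lfun2_sqintg/(eiv_moment_e model). Qed.
Let seps i : sqintg P (fun w => eps w i 0). Proof. exact/Lfun2_sqintg/(eiv_moment_eps model). Qed.
Let sdelta i : sqintg P (fun w => delta w i 0).
Proof. exact/Lfun2_sqintg/(eiv_moment_delta model). Qed.

Let xE w i : x w i 0 = xi w i 0 + delta w i 0.
Proof. by rewrite (eiv_surrogate model) mxE. Qed.

Let yE w a : y w a 0 =
  b a 0 + dot (col a C) (z w) + dot (col a B) (xi w) + e w a 0 + eps w a 0.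
Proof.
rewrite (eiv_response model) !mxE /dot.
by congr (_ + _ + _ + _ + _); apply: eq_bigr => i _; rewrite !mxE.
Qed.

Let sx i : sqintg P (fun w => x w i 0).
Proof. by rewrite (funext (xE ^~ i)); exact: sqintgD. Qed.

Let szC a : sqintg P (fun w => dot (col a C) (z w)). Proof. exact: sqintg_dot. Qed.
Let sxiB a : sqintg P (fun w => dot (col a B) (xi w)). Proof. exact: sqintg_dot. Qed.

Let sy1 a : sqintg P (fun w => b a 0 + dot (col a C) (z w)).
Proof. by apply: sqintgD => //; exact: sqintg_cst. Qed.
Let sy2 a : sqintg P (fun w => b a 0 + dot (col a C) (z w) + dot (col a B) (xi w)).
Proof. exact: sqintgD. Qed.
Let sy3 a :
  sqintg P (fun w => b a 0 + dot (col a C) (z w) + dot (col a B) (xi w) + e w a 0).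
Proof. exact: sqintgD. Qed.

Let sy a : sqintg P (fun w => y w a 0).
Proof. by rewrite (funext (yE ^~ a)); exact: sqintgD. Qed.

Let Ex_e i : Ex P (fun w => e w i 0) = 0.
Proof. by rewrite -ExpectationE (eiv_mean_e model i). Qed.
Let Ex_eps i : Ex P (fun w => eps w i 0) = 0.
Proof. by rewrite -ExpectationE (eiv_mean_eps model i). Qed.
Let Ex_delta i : Ex P (fun w => delta w i 0) = 0.
Proof. by rewrite -ExpectationE (eiv_mean_delta model i). Qed.

Definition mean_vec k (X : T -> 'cV[R]_k) : 'cV[R]_k := \col_i Ex P (fun w => X w i 0).

Lemma mean_vecE k (X : T -> 'cV[R]_k) i : mean_vec X i 0 = Ex P (fun w => X w i 0).
Proof. by rewrite mxE. Qed.

Let Ex_dot k (t : 'cV[R]_k) (X : T -> 'cV[R]_k) :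
  (forall i, sqintg P (fun w => X w i 0)) ->
  Ex P (fun w => dot t (X w)) = dot t (mean_vec X).
Proof.
move=> sX; rewrite Ex_sum; last by move=> i; apply: intgZ; exact: sqintg_intg.
by apply: eq_bigr => i _; rewrite ExZ ?mxE//; exact: sqintg_intg.
Qed.

Lemma mean_x : mean_vec x = mean_vec xi.
Proof.
apply/colP => i; rewrite !mxE (funext (xE ^~ i)).
by rewrite ExD ?Ex_delta ?addr0//; exact: sqintg_intg.
Qed.

Lemma mean_y : mean_vec y = b + C^T *m mean_vec z + B^T *m mean_vec xi.
Proof.
apply/colP => a; rewrite mean_vecE (funext (yE ^~ a)).
rewrite ExD; [|exact: sqintg_intg|exact: sqintg_intg].
rewrite ExD; [|exact: sqintg_intg|exact: sqintg_intg].
rewrite ExD; [|exact: sqintg_intg|exact: sqintg_intg].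
rewrite ExD; [|exact: intg_cst|exact: sqintg_intg].
rewrite Ex_e Ex_eps !addr0 Ex_cst !Ex_dot// 2!mxE.
congr (_ + _); [congr (_ + _)|]; rewrite !mxE; apply: eq_bigr => i _;
  by rewrite !mxE.
Qed.

Let mcoord k (i : 'I_k) : measurable_fun setT (fun v : 'cV[R]_k => v i 0) :=
  measurable_coord i.

Let cv_z_xi i j : cv P (fun w => z w i 0) (fun w => xi w j 0) = 0.
Proof.
apply: cv_indep => //.
apply: (indep2_comp (mcoord i) _ indep_z_xiW (g := fun t : xied => t.1 j 0)).
by apply: (measurableT_comp (mcoord j)).
Qed.

Let cv_z_delta i j : cv P (fun w => z w i 0) (fun w => delta w j 0) = 0.
Proof.
apply: cv_indep => //.
apply: (indep2_comp (mcoord i) _ indep_z_xiW (g := fun t : xied => t.2.2 j 0)).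
apply: (measurableT_comp (mcoord j)).
by apply: measurableT_comp.
Qed.

Let cv_z_eps i j : cv P (fun w => z w i 0) (fun w => eps w j 0) = 0.
Proof.
apply: cv_indep => //.
apply: (indep2_comp (mcoord i) _ indep_z_xiW (g := fun t : xied => t.2.1 j 0)).
apply: (measurableT_comp (mcoord j)).
by apply: measurableT_comp.
Qed.

Let cv_z_e i j : cv P (fun w => z w i 0) (fun w => e w j 0) = 0.
Proof.
rewrite cvC; apply: cv_indep => //.
apply: (indep2_comp (mcoord j) _ indep_e_zxi (g := fun t : zxi => t.1 i 0)).
by apply: (measurableT_comp (mcoord i)).
Qed.

Let cv_xi_e i j : cv P (fun w => xi w i 0) (fun w => e w j 0) = 0.
Proof.
rewrite cvC; apply: cv_indep => //.
apply: (indep2_comp (mcoord j) _ indep_e_zxi (g := fun t : zxi => t.2 i 0)).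
by apply: (measurableT_comp (mcoord i)).
Qed.

Let cv_xi_eps i j : cv P (fun w => xi w i 0) (fun w => eps w j 0) = 0.
Proof.
rewrite cvC; apply: cv_indep => //.
apply: (indep2_comp (f := fun t : ed => t.1 j 0) (g := fun t : zxi => t.2 i 0) _ _ indep_W_zxi).
  by apply: (measurableT_comp (mcoord j)).
by apply: (measurableT_comp (mcoord i)).
Qed.

Let cv_xi_delta i j : cv P (fun w => xi w i 0) (fun w => delta w j 0) = 0.
Proof.
rewrite cvC; apply: cv_indep => //.
apply: (indep2_comp (f := fun t : ed => t.2 j 0) (g := fun t : zxi => t.2 i 0) _ _ indep_W_zxi).
  by apply: (measurableT_comp (mcoord j)).
by apply: (measurableT_comp (mcoord i)).
Qed.

Let cv_delta_e i j : cv P (fun w => delta w i 0) (fun w => e w j 0) = 0.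
Proof.
rewrite cvC; apply: cv_indep => //.
apply: (indep2_comp (mcoord j) _ indep_e_W (g := fun t : ed => t.2 i 0)).
by apply: (measurableT_comp (mcoord i)).
Qed.

Local Notation Sz := (cov_mx P z).
Local Notation Sx := (cov_mx P x).
Local Notation Sxi := (cov_mx P xi).
Local Notation Sed := (cross_moment P eps delta).

Let cross_momentE a j : Sed a j = Ex P (fun w => eps w a 0 * delta w j 0).
Proof.
rewrite mxE -ExpectationE; congr (fine (expectation P _)); apply/funext => w.
by rewrite mxE big_ord1 !mxE.
Qed.

Lemma cv_z_x i j : cv P (fun w => z w i 0) (fun w => x w j 0) = 0.
Proof. by rewrite (funext (xE ^~ j)) cvDr// cv_z_xi cv_z_delta addr0. Qed.

Lemma cv_z_y i a : cv P (fun w => z w i 0) (fun w => y w a 0) = (Sz *m C) i a.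
Proof.
rewrite (funext (yE ^~ a)) cvDr// cvDr// cvDr// cvDr//; last exact: sqintg_cst.
rewrite cv_cstr// cv_z_eps cv_z_e !cv_dotr// add0r !addr0.
rewrite [X in _ + X]big1 ?addr0; last by move=> k _; rewrite cv_z_xi mul0r.
by rewrite mxE; apply: eq_bigr => k _; rewrite cov_mxE// mxE.
Qed.

(** The measurement error delta is correlated with y through eps alone, which adds the transpose of
    [Sed]: the bias that the correction term removes from the OLS predictor. *)
Lemma cv_x_y i a : cv P (fun w => x w i 0) (fun w => y w a 0) =
  (Sxi *m B + Sed^T) i a.
Proof.
rewrite (funext (xE ^~ i)) cvDl// mxE; congr (_ + _).
  rewrite (funext (yE ^~ a)) cvDr// cvDr// cvDr// cvDr//; last exact: sqintg_cst.
  rewrite cv_cstr// cv_xi_eps cv_xi_e !cv_dotr// add0r !addr0.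
  rewrite [X in X + _]big1 ?add0r; last by move=> k _; rewrite cvC cv_z_xi mul0r.
  by rewrite mxE; apply: eq_bigr => k _; rewrite cov_mxE// mxE.
rewrite (funext (yE ^~ a)) cvDr// cvDr// cvDr// cvDr//; last exact: sqintg_cst.
rewrite cv_cstr// cv_delta_e !cv_dotr// add0r addr0.
rewrite [X in X + _ + _]big1 ?add0r; last by move=> k _; rewrite cvC cv_z_delta mul0r.
rewrite [X in X + _]big1 ?add0r; last by move=> k _; rewrite cvC cv_xi_delta mul0r.
rewrite mxE cross_momentE /cv Ex_delta mul0r subr0.
by congr Ex; apply/funext => w; rewrite mulrC.
Qed.

Lemma cv_xi_x i j : cv P (fun w => xi w i 0) (fun w => x w j 0) = Sxi i j.
Proof. by rewrite (funext (xE ^~ j)) cvDr// cv_xi_delta addr0 cov_mxE. Qed.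

Let cov_sym k (X : T -> 'cV[R]_k) : (forall i, sqintg P (fun w => X w i 0)) ->
  (cov_mx P X)^T = cov_mx P X.
Proof. by move=> sX; apply/matrixP => i j; rewrite mxE !cov_mxE// cvC. Qed.

Let r w := col_mx (z w) (x w).

Let rE_l w i : r w (lshift m i) 0 = z w i 0. Proof. by rewrite col_mxEu. Qed.
Let rE_r w i : r w (rshift q i) 0 = x w i 0. Proof. by rewrite col_mxEd. Qed.

Lemma cv_r i j : cv P (fun w => r w i 0) (fun w => r w j 0) = block_mx Sz 0 0 Sx i j.
Proof.
case: (split_ordP i) => i' ->; case: (split_ordP j) => j' ->;
  rewrite ?(funext (rE_l ^~ _)) ?(funext (rE_r ^~ _)).
- by rewrite block_mxEul cov_mxE.
- by rewrite block_mxEur cv_z_x mxE.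
- by rewrite block_mxEdl cvC cv_z_x mxE.
- by rewrite block_mxEdr cov_mxE.
Qed.

Lemma cv_r_y i a : cv P (fun w => r w i 0) (fun w => y w a 0) =
  col_mx (Sz *m C) (Sxi *m B + Sed^T) i a.
Proof.
case: (split_ordP i) => i' ->; rewrite ?(funext (rE_l ^~ _)) ?(funext (rE_r ^~ _)).
- by rewrite col_mxEu cv_z_y.
- by rewrite col_mxEd cv_x_y.
Qed.

Definition best_predictor (z0 : 'cV[R]_q) (x0 : 'cV[R]_m) : 'cV[R]_d :=
  b + C^T *m z0 +
  B^T *m (mean_vec xi + Sxi *m invmx Sx *m (x0 - mean_vec xi)).

Lemma plug_in_limit z0 x0 :
  plug_in (block_mx Sz 0 0 Sx) (col_mx (Sz *m C) (Sxi *m B + Sed^T)) Sx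
    (mean_vec y) (mean_vec z) (mean_vec x) Sed z0 x0 = best_predictor z0 x0.
Proof.
have uz := eiv_cov_z model; have ux := eiv_cov_x model.
have ub : block_mx Sz 0 0 Sx \in unitmx.
  by rewrite unitmxE det_ublock unitrM -!unitmxE uz ux.
rewrite /plug_in -!invmx_adj_inv//.
have -> : invmx (block_mx Sz 0 0 Sx) *m col_mx (Sz *m C) (Sxi *m B + Sed^T) =
    col_mx C (invmx Sx *m (Sxi *m B + Sed^T)).
  (* The claimed coefficients are checked by multiplying back by the block-diagonal matrix. *)
  rewrite -[RHS](mulKmx ub); congr (_ *m _).
  by rewrite mul_block_col !mul0mx addr0 add0r mulKVmx.
rewrite col_mxKu col_mxKd mean_x mean_y /best_predictor.
rewrite trmx_mul trmx_inv linearD/= trmx_mul trmxK !cov_sym//.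
rewrite [B^T *m (_ + _)]mulmxDr !mulmxDl !mulmxBr !mulmxA.
move: (C^T *m _) (C^T *m z0) (B^T *m mean_vec xi) (_ *m Sxi *m _ *m mean_vec xi)
  (_ *m Sxi *m _ *m x0) (Sed *m _ *m mean_vec xi) (Sed *m _ *m x0) => u1 u2 u3 u4 u5 u6 u7.
by apply/colP => a; rewrite !mxE; ring.
Qed.

Lemma gaussian_linear (t1 t2 : 'cV[R]_m) :
  gaussian_rv P (fun w => dot t1 (xi w) + dot t2 (delta w)).
Proof.
have := eiv_gaussian model (col_mx 0 (col_mx t2 t1)).
congr gaussian_rv; apply/funext => w.
by rewrite !tr_col_mx !mul_row_col trmx0 mul0mx add0r mxE -!dotE addrC.
Qed.

Let Sx_r j (v : 'cV[R]_m) : (v^T *m Sx) 0 j = cv P (fun w => dot v (x w)) (fun w => x w j 0).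
Proof.
by rewrite cv_dotl// mxE; apply: eq_bigr => k _; rewrite mxE cov_mxE.
Qed.

Let Sxi_r j (v : 'cV[R]_m) : (v^T *m Sxi) 0 j = cv P (fun w => dot v (xi w)) (fun w => x w j 0).
Proof.
by rewrite cv_dotl// mxE; apply: eq_bigr => k _; rewrite mxE cv_xi_x.
Qed.

Let msingle (A : set 'cV[R]_m) : measurable A -> measurable_fun setT (\1_A : _ -> R).
Proof. by move=> mA; exact: measurable_indic. Qed.

(** Coefficients of the best linear prediction from x of the component of B^T xi of index [a]: the
    solution of k^T Sx = (col a B)^T Sxi. *)
Let ka a : 'cV[R]_m := ((col a B)^T *m Sxi *m invmx Sx)^T.

Let predictionE a v : dot (col a B) (mean_vec xi + Sxi *m invmx Sx *m (v - mean_vec xi)) =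
  dot (ka a) v + (dot (col a B) (mean_vec xi) - dot (ka a) (mean_vec xi)).
Proof.
rewrite !dotE /ka trmxK [(col a B)^T *m (_ + _)]mulmxDr !mulmxBr !mulmxA.
move: (_ *m mean_vec xi) (_ *m v) (_ *m Sxi *m _ *m mean_vec xi) => u1 u2 u3.
by rewrite !mxE; ring.
Qed.

Lemma best_predictorE a z0 x0 : best_predictor z0 x0 a 0 = b a 0 + dot (col a C) z0 +
  dot (col a B) (mean_vec xi + Sxi *m invmx Sx *m (x0 - mean_vec xi)).
Proof.
rewrite /best_predictor mxE [(b + _) a 0]mxE.
by congr (_ + _ + _); rewrite !mxE; apply: eq_bigr => i _; rewrite !mxE.
Qed.

Lemma best_predictor_intg a : intg P (fun w => best_predictor (z w) (x w) a 0).
Proof.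
rewrite (funext (fun w => best_predictorE a (z w) (x w))).
apply: sqintg_intg; apply: sqintgD => //.
rewrite (funext (fun w => predictionE a (x w))).
by apply: sqintgD; [exact: sqintg_dot|exact: sqintg_cst].
Qed.

Let regressionE a (u : 'cV[R]_q) (v : 'cV[R]_m) : (b + C^T *m u + B^T *m v) a 0 =
  b a 0 + dot (col a C) u + dot (col a B) v.
Proof.
rewrite mxE [(b + _) a 0]mxE.
by congr (_ + _ + _); rewrite !mxE; apply: eq_bigr => i _; rewrite !mxE.
Qed.

Lemma regression_intg a : intg P (fun w => (b + C^T *m z w + B^T *m xi w) a 0).
Proof.
by rewrite (funext (fun w => regressionE a (z w) (xi w))); exact: sqintg_intg.
Qed.

(* The error of the best linear prediction of [xi] from [x], which is Gaussian and
   uncorrelated with [x], hence independent of [x]; [z] is independent of both. *)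
Lemma prediction_error_orthogonal a D : measurable D ->
  Ex P (fun w => (dot (col a B) (xi w) -
      dot (col a B) (mean_vec xi + Sxi *m invmx Sx *m (x w - mean_vec xi))) *
    \1_D (z w, x w)) = 0.
Proof.
move=> mD; pose be := col a B; pose mu := mean_vec xi; pose k := ka a.
pose c := dot k mu - dot be mu.
have UE w : dot be (xi w) - dot be (mu + Sxi *m invmx Sx *m (x w - mu)) =
    dot be (xi w) - dot k (x w) + c.
  by rewrite predictionE -/be -/mu -/k /c; ring.
pose U w := dot be (xi w) - dot k (x w) + c.
under eq_fun do rewrite UE; rewrite -/U.
have sbe : sqintg P (fun w => dot be (xi w)) by exact: sqintg_dot.
have sk : sqintg P (fun w => dot k (x w)) by exact: sqintg_dot.
have sd : sqintg P (fun w => dot be (xi w) - dot k (x w)).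
  by apply: sqintgD => //; exact: sqintgN.
have sU : sqintg P U by apply: sqintgD => //; exact: sqintg_cst.
have EU : Ex P U = 0.
  rewrite ExD; [|exact: sqintg_intg|exact: intg_cst].
  rewrite ExB; [|exact: sqintg_intg|exact: sqintg_intg].
  by rewrite Ex_cst !Ex_dot// mean_x /c; ring.
(* [k] solves the normal equations, so the covariances of both terms of [U] with x cancel. *)
have UX i : Ex P (fun w => U w * x w i 0) = 0.
  have -> : Ex P (fun w => U w * x w i 0) = cv P U (fun w => x w i 0).
    by rewrite /cv EU mul0r subr0.
  rewrite cvDl//; last exact: sqintg_cst.
  rewrite (cvDl sbe (sqintgN sk) (sx i)) cv_cstl// addr0.
  under [X in _ + cv _ X _]eq_fun do rewrite -mulN1r.
  rewrite cvZl// -Sxi_r -Sx_r /k /ka trmxK mulmxKV ?(eiv_cov_x model)//.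
  by rewrite mulN1r subrr.
(* With x = xi + delta this is a linear form in (xi, delta) plus the constant s c. *)
have gU s t : gaussian_rv P (fun w => s * U w + dot t (x w)).
  have := gaussian_rvD (s * c) (gaussian_linear (s *: be - s *: k + t) (t - s *: k)).
  congr gaussian_rv; apply/funext => w.
  rewrite /U !dotDl !dotNl !dotZl.
  have dx v : dot v (x w) = dot v (xi w) + dot v (delta w).
    by rewrite !dotE (eiv_surrogate model) mulmxDr mxE.
  by rewrite !dx; ring.
apply: (Ex_indic_pair0 (X := U)) mD => //; first exact: sqintg_intg.
move=> A1 A2 mA1 mA2.
have iUA : intg P (fun w => U w * \1_A2 (x w)).
  apply: (@intgM_indic _ _ _ P U (x @^-1` A2)); last exact: sqintg_intg.
  by have := mx measurableT mA2; rewrite setTI.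
have iA1 : intg P (fun w => \1_A1 (z w)).
  apply: (@intg_indic _ _ _ P (z @^-1` A1)).
  by have := mz measurableT mA1; rewrite setTI.
(* [U] and x are functions of xi and delta, and z is independent of (xi, (eps, delta)) taken
   jointly. *)
have ind : indep2 P (fun w => \1_A1 (z w) : R) (fun w => U w * \1_A2 (x w)).
  pose g (t : xied) : R :=
    (dot be t.1 - dot k (t.1 + t.2.2) + c) * \1_A2 (t.1 + t.2.2).
  have mg2 : measurable_fun setT (fun t : xied => t.1 + t.2.2).
    apply: measurable_cV => i; under eq_fun do rewrite mxE.
    apply: measurable_funD; first by apply: (measurableT_comp (mcoord i)).
    by apply: (measurableT_comp (mcoord i)); apply: measurableT_comp.
  have mg : measurable_fun setT g.
    apply: measurable_funM.
      apply: measurable_funD => //; apply: measurable_funB.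
        by apply: (measurableT_comp (measurable_dot be)).
      exact: (measurableT_comp (measurable_dot k) mg2).
    exact: (measurableT_comp (msingle mA2) mg2).
  have -> : (fun w => U w * \1_A2 (x w)) = (fun w => g (xi w, W w)).
    by apply/funext => w; rewrite /g /U /= -(eiv_surrogate model).
  exact: (indep2_comp (measurable_indic mA1) mg indep_z_xiW).
under eq_fun do rewrite mulrCA.
by rewrite ExM_indep// (gaussian_uncorrelated sU sx EU UX gU mA2) mulr0.
Qed.

(** The error is e + eps, whose terms are centred and each independent of (z, xi). This identifies
    eta_0 with the regression function b + C^T z + B^T xi. *)
Lemma regression_error_orthogonal a D : measurable D ->
  Ex P (fun w => (y w a 0 - (b + C^T *m z w + B^T *m xi w) a 0) * \1_D (z w, xi w)) = 0.
Proof.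
move=> mD.
have E w : y w a 0 - (b + C^T *m z w + B^T *m xi w) a 0 = e w a 0 + eps w a 0.
  by rewrite (eiv_response model) !mxE; ring.
under eq_fun do rewrite E mulrDl.
have mzx : measurable_fun setT (fun w => (z w, xi w)) by exact: measurable_fun_pair.
have iD : intg P (fun w => \1_D (z w, xi w)).
  apply: (@intg_indic _ _ _ P ((fun w => (z w, xi w)) @^-1` D)).
  by have := mzx measurableT D mD; rewrite setTI.
have ie := sqintg_intg (se a); have ieps := sqintg_intg (seps a).
have inde : indep2 P (fun w => e w a 0) (fun w => \1_D (z w, xi w) : R).
  exact: (indep2_comp (mcoord a) (measurable_indic mD) indep_e_zxi).
have indeps : indep2 P (fun w => eps w a 0) (fun w => \1_D (z w, xi w) : R).
  apply: (indep2_comp (f := fun t : ed => t.1 a 0) _ (measurable_indic mD) indep_W_zxi).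
  by apply: (measurableT_comp (mcoord a)).
rewrite ExD ?ExM_indep ?Ex_e ?Ex_eps ?mul0r ?addr0//; exact: intgM_indep.
Qed.

Lemma best_predictor_orthogonal a D : measurable D ->
  Ex P (fun w => ((b + C^T *m z w + B^T *m xi w) a 0 - best_predictor (z w) (x w) a 0) *
    \1_D (z w, x w)) = 0.
Proof.
move=> mD; rewrite -[RHS](prediction_error_orthogonal a mD); congr Ex; apply/funext => w.
by rewrite regressionE best_predictorE; congr (_ * _); ring.
Qed.

Lemma model_sqintg : [/\ forall i, sqintg P (fun w => z w i 0),
  forall i, sqintg P (fun w => x w i 0) & forall i, sqintg P (fun w => y w i 0)].
Proof. by []. Qed.

End model.

(** * Limits of the sample moments and of the plug-in formula *)

Lemma ae_forall d (T : measurableType d) (R : realType)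
    (P : probability T R) (J : finType) (Q : J -> T -> Prop) :
  (forall j, {ae P, forall w, Q j w}) -> {ae P, forall w, forall j, Q j w}.
Proof. by move=> H; exact: (@filter_forall _ _ (fun j w => Q j w) _ _ H). Qed.

Section sample_moments.
Context d (T : measurableType d) (R : realType) (P : probability T R).
Context d1 (T1 : measurableType d1) (Z : T -> T1) (Zs : nat -> T -> T1).
Hypothesis mZ : measurable_fun setT Z.
Hypothesis mZs : forall i, measurable_fun setT (Zs i).
Hypothesis copies : independent_copies P Z Zs.

Variables (k : nat) (f : T1 -> 'cV[R]_k).
Hypothesis mf : measurable_fun setT f.
Hypothesis sf : forall a, sqintg P (fun w => f (Z w) a 0).

Let mfa a : measurable_fun setT (fun t => f t a 0).
Proof. exact: (measurableT_comp (measurable_coord a) mf). Qed.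

Lemma sample_mean_cvg : {ae P, forall w, forall a,
  (fun n => sample_mean n (fun i => f (Zs i w)) a 0) @ \oo -->
    Ex P (fun w => f (Z w) a 0)}.
Proof.
apply: ae_forall => a.
have := slln_copies mZ mZs copies (mfa a) (sqintg_intg (sf a)).
by apply: filterS => w; under [in X in _ -> X]eq_fun do rewrite sample_meanE.
Qed.

End sample_moments.

Section sample_covariances.
Context d (T : measurableType d) (R : realType) (P : probability T R).
Context d1 (T1 : measurableType d1) (Z : T -> T1) (Zs : nat -> T -> T1).
Hypothesis mZ : measurable_fun setT Z.
Hypothesis mZs : forall i, measurable_fun setT (Zs i).
Hypothesis copies : independent_copies P Z Zs.
Variables (k l : nat) (f : T1 -> 'cV[R]_k) (g : T1 -> 'cV[R]_l).
Hypotheses (mf : measurable_fun setT f) (mg : measurable_fun setT g).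
Hypothesis sf : forall a, sqintg P (fun w => f (Z w) a 0).
Hypothesis sg : forall a, sqintg P (fun w => g (Z w) a 0).

Lemma sample_cov_cvg : {ae P, forall w, forall a b,
  (fun n => sample_cov n (fun i => f (Zs i w)) (fun i => g (Zs i w)) a b) @ \oo -->
    cv P (fun w => f (Z w) a 0) (fun w => g (Z w) b 0)}.
Proof.
have Hprod : {ae P, forall w, forall a b,
    (fun n => n%:R^-1 * \sum_(1 <= i < n.+1) f (Zs i w) a 0 * g (Zs i w) b 0) @ \oo -->
      Ex P (fun w => f (Z w) a 0 * g (Z w) b 0)}.
  do 2 apply: ae_forall => ?.
  apply: (slln_copies (h := fun t => f t _ 0 * g t _ 0) mZ mZs copies) => //.
    apply: measurable_funM; first exact: (measurableT_comp (measurable_coord _) mf).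
    exact: (measurableT_comp (measurable_coord _) mg).
  exact: sqintgM.
apply: filterS3 Hprod (sample_mean_cvg mZ mZs copies mf sf)
  (sample_mean_cvg mZ mZs copies mg sg) => w Hp Hf Hg a b.
under eq_fun do rewrite sample_covE.
by apply: cvgB; [exact: Hp|apply: cvgM; [exact: Hf|exact: Hg]].
Qed.

End sample_covariances.

Section deterministic_limits.
Variables (R : realType) (d q m : nat).

Lemma Sigma_x_hat_cvg (x : nat -> 'cV[R]_m) (S : 'M[R]_m) :
  (forall a b, (fun n => sample_cov n x x a b) @ \oo --> S a b) ->
  forall a b, (fun n => Sigma_x_hat n x a b) @ \oo --> S a b.
Proof.
move=> H a b.
have ratio : (fun n => n%:R / (n%:R - 1)) @ \oo --> (1 : R).
  (* Shifted by 2, the ratio is 1 + 1/(n+1), away from the zero denominator at n = 1. *)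
  rewrite -(cvg_shiftn 2).
  have -> : (fun n => (n + 2)%:R / ((n + 2)%:R - 1)) = (fun n => 1 + harmonic n : R).
    apply/funext => n; rewrite /harmonic addn2 -[n.+2%:R]natr1 addrK.
    by rewrite mulrDl divff ?mul1r// pnatr_eq0.
  have h := cvgD (cvg_cst (1 : R)) (@cvg_harmonic R).
  by rewrite addr0 in h; exact: h.
have E n : (0 < n)%N ->
    n%:R / (n%:R - 1) * sample_cov n x x a b = Sigma_x_hat n x a b.
  move=> n0; rewrite !mxE mulrA; congr (_ * _).
  by rewrite mulrAC mulfV ?mul1r// pnatr_eq0 -lt0n.
rewrite -[S a b]mul1r; apply: cvg_trans (cvgM ratio (H a b)); apply: near_eq_cvg.
by near=> n; apply: E; near: n; exact: nbhs_infty_gt.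
Unshelve. all: by end_near. Qed.

Lemma det_cvg k (M_ : nat -> 'M[R]_k) (M : 'M[R]_k) :
  (forall a b, (fun n => M_ n a b) @ \oo --> M a b) ->
  (fun n => \det (M_ n)) @ \oo --> \det M.
Proof.
move=> H; pose N o := if o is Some n then M_ n else M.
exact: (closure_det (@cvg_none_cst R) (@cvg_noneD R) (@cvg_noneM R) (M := N) H).
Qed.

Lemma plug_in_cvg (Srr_ : nat -> 'M[R]_(q + m)) (Srr : 'M[R]_(q + m))
    (Sry_ : nat -> 'M[R]_(q + m, d)) (Sry : 'M[R]_(q + m, d))
    (Sxx_ : nat -> 'M[R]_m) (Sxx : 'M[R]_m) (my_ : nat -> 'cV[R]_d) (my : 'cV[R]_d)
    (mz_ : nat -> 'cV[R]_q) (mz : 'cV[R]_q) (mx_ : nat -> 'cV[R]_m) (mx : 'cV[R]_m)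
    S z0 x0 :
  (forall a b, (fun n => Srr_ n a b) @ \oo --> Srr a b) ->
  (forall a b, (fun n => Sry_ n a b) @ \oo --> Sry a b) ->
  (forall a b, (fun n => Sxx_ n a b) @ \oo --> Sxx a b) ->
  (forall a, (fun n => my_ n a 0) @ \oo --> my a 0) ->
  (forall a, (fun n => mz_ n a 0) @ \oo --> mz a 0) ->
  (forall a, (fun n => mx_ n a 0) @ \oo --> mx a 0) ->
  \det Srr != 0 -> \det Sxx != 0 ->
  forall a, (fun n => plug_in (Srr_ n) (Sry_ n) (Sxx_ n) (my_ n) (mz_ n) (mx_ n) S z0 x0 a 0)
    @ \oo --> plug_in Srr Sry Sxx my mz mx S z0 x0 a 0.
Proof.
move=> Hrr Hry Hxx Hy Hz Hx dr dx a.
pose ext k l (u_ : nat -> 'M[R]_(k, l)) u o := if o is Some n then u_ n else u.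
have E k (u_ : nat -> 'cV[R]_k) (u : 'cV[R]_k) : (forall i, (fun n => u_ n i 0) @ \oo --> u i 0) ->
    entrywise (@cvg_none R) (ext _ _ u_ u).
  by move=> H i j; rewrite (ord1 j); exact: H.
have ER : entrywise (@cvg_none R) (ext _ _ Srr_ Srr) := Hrr.
have EX : entrywise (@cvg_none R) (ext _ _ Sxx_ Sxx) := Hxx.
have DR := closure_det (@cvg_none_cst R) (@cvg_noneD R) (@cvg_noneM R) ER.
have DX := closure_det (@cvg_none_cst R) (@cvg_noneD R) (@cvg_noneM R) EX.
have EY : entrywise (@cvg_none R) (ext _ _ Sry_ Sry) := Hry.
have Ez : entrywise (@cvg_none R) (fun=> z0) by move=> i j; exact: cvg_none_cst.
have Ex : entrywise (@cvg_none R) (fun=> x0) by move=> i j; exact: cvg_none_cst.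
have := entrywise_plug_in (@cvg_none_cst R) (@cvg_noneD R) (@cvg_noneM R) S ER EY EX
  (cvg_noneV dr DR) (cvg_noneV dx DX) (E _ _ _ Hy) (E _ _ _ Hz) (E _ _ _ Hx) Ez Ex.
by move=> /(_ a 0).
Qed.

(** Removing the square root turns the deviation event into a condition on a polynomial in the
    entries, for which measurability and limits are immediate. *)
Lemma enorm_gt (tau : R) (v : 'cV[R]_d) : 0 < tau ->
  (tau < enorm v) = (tau ^+ 2 < \sum_i v i 0 ^+ 2).
Proof.
move=> t0; have S0 : 0 <= \sum_i v i 0 ^+ 2 by apply: sumr_ge0 => i _; exact: sqr_ge0.
by rewrite /enorm -[in RHS](sqr_sqrtr S0) ltr_sqr ?nnegrE ?sqrtr_ge0// ltW.
Qed.

End deterministic_limits.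

(** * Strong consistency and conditional probabilities for the copies *)

Section copies_of_model.
Context (dT : measure_display) (T : measurableType dT) (R : realType)
  (P : probability T R) (d q m : nat)
  (b : 'cV[R]_d) (C : 'M[R]_(q, d)) (B : 'M[R]_(m, d))
  (y : {RV P >-> 'cV[R]_d}) (z : {RV P >-> 'cV[R]_q})
  (xi : {RV P >-> 'cV[R]_m}) (e eps : {RV P >-> 'cV[R]_d})
  (x delta : {RV P >-> 'cV[R]_m})
  (ys : nat -> {RV P >-> 'cV[R]_d}) (zs : nat -> {RV P >-> 'cV[R]_q})
  (xis : nat -> {RV P >-> 'cV[R]_m}) (es epss : nat -> {RV P >-> 'cV[R]_d})
  (xs deltas : nat -> {RV P >-> 'cV[R]_m})
  (eta0 etahat0 : T -> 'cV[R]_d).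
Hypothesis model : eiv_model b C B y z xi e eps x delta.

Let Z w := (y w, z w, xi w, e w, eps w, x w, delta w).
Let Zs i w := (ys i w, zs i w, xis i w, es i w, epss i w, xs i w, deltas i w).
Hypothesis copies : independent_copies P Z Zs.
Hypothesis etaP : cond_expectation_cV P (fun w => (zs 0%N w, xis 0%N w)) (ys 0%N) eta0.
Hypothesis etahatP :
  cond_expectation_cV P (fun w => (zs 0%N w, xs 0%N w)) eta0 etahat0.

Local Notation obs :=
  ('cV[R]_d * 'cV[R]_q * 'cV[R]_m * 'cV[R]_d * 'cV[R]_d * 'cV[R]_m * 'cV[R]_m)%type.

Let mZ : measurable_fun setT Z.
Proof. by do 6 apply: measurable_fun_pair => //. Qed.

Let mZs i : measurable_fun setT (Zs i).
Proof. by do 6 apply: measurable_fun_pair => //. Qed.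

Let idZ A : measurable A -> P (Z @^-1` A) = P (Zs 0%N @^-1` A).
Proof. by move=> mA; case: copies => _ /(_ 0%N A mA). Qed.

(** The model equations are given for the generic tuple, and the copies share its joint law.
    Expectations for unit 0 are therefore written through projections of the tuple and
    transferred. *)
Let py (t : obs) := t.1.1.1.1.1.1.
Let pz (t : obs) := t.1.1.1.1.1.2.
Let pxi (t : obs) := t.1.1.1.1.2.
Let px (t : obs) := t.1.2.
Let pr (t : obs) := col_mx (pz t) (px t).

Let mpy : measurable_fun setT py.
Proof. by rewrite /py; do 5 apply: (measurableT_comp measurable_fst) => //. Qed.
Let mpz : measurable_fun setT pz.
Proof.
by apply: (measurableT_comp measurable_snd); do 4 apply: (measurableT_comp measurable_fst) => //.
Qed.
Let mpxi : measurable_fun setT pxi.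
Proof.
by apply: (measurableT_comp measurable_snd); do 3 apply: (measurableT_comp measurable_fst) => //.
Qed.
Let mpx : measurable_fun setT px.
Proof. exact: (measurableT_comp measurable_snd). Qed.

Let mcol k (f : obs -> 'cV[R]_k) i :
  measurable_fun setT f -> measurable_fun setT (fun t => f t i 0).
Proof. by move=> mf; exact: (measurableT_comp (measurable_coord i) mf). Qed.

Let mpr : measurable_fun setT pr.
Proof.
apply: measurable_cV => i; rewrite /pr; case: (split_ordP i) => j ->.
  by under eq_fun do rewrite col_mxEu; exact: mcol.
by under eq_fun do rewrite col_mxEd; exact: mcol.
Qed.

Let measurable_entries d' (T' : measurableType d') k l (M : T' -> 'M[R]_(k, l)) :=
  entrywise (fun f : T' -> R => measurable_fun setT f) M.

Let mreg a : measurable_fun setT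
  (fun t : ('cV[R]_q * 'cV[R]_m)%type => (b + C^T *m t.1 + B^T *m t.2) a 0).
Proof.
have cst c : measurable_fun setT (fun _ : ('cV[R]_q * 'cV[R]_m)%type => c : R) by [].
have D := @measurable_funD _ ('cV[R]_q * 'cV[R]_m)%type R setT.
have M := @measurable_funM _ ('cV[R]_q * 'cV[R]_m)%type R setT.
have E1 : measurable_entries (fun t : ('cV[R]_q * 'cV[R]_m)%type => t.1).
  by move=> i j; rewrite (ord1 j); exact: (measurableT_comp (measurable_coord i)).
have E2 : measurable_entries (fun t : ('cV[R]_q * 'cV[R]_m)%type => t.2).
  by move=> i j; rewrite (ord1 j); exact: (measurableT_comp (measurable_coord i)).
apply: (entrywiseD D (entrywiseD D (entrywise_cst cst b) _) _).
- exact: (entrywiseM cst D M (entrywise_cst cst C^T) E1).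
- exact: (entrywiseM cst D M (entrywise_cst cst B^T) E2).
Qed.

Let best := best_predictor b C B xi x.

Let mbest a : measurable_fun setT (fun t : ('cV[R]_q * 'cV[R]_m)%type => best t.1 t.2 a 0).
Proof.
have cst c : measurable_fun setT (fun _ : ('cV[R]_q * 'cV[R]_m)%type => c : R) by [].
have D := @measurable_funD _ ('cV[R]_q * 'cV[R]_m)%type R setT.
have M := @measurable_funM _ ('cV[R]_q * 'cV[R]_m)%type R setT.
have E1 : measurable_entries (fun t : ('cV[R]_q * 'cV[R]_m)%type => t.1).
  by move=> i j; rewrite (ord1 j); exact: (measurableT_comp (measurable_coord i)).
have E2 : measurable_entries (fun t : ('cV[R]_q * 'cV[R]_m)%type => t.2).
  by move=> i j; rewrite (ord1 j); exact: (measurableT_comp (measurable_coord i)).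
have c k l (K : 'M[R]_(k, l)) := entrywise_cst cst K.
apply: (entrywiseD D (entrywiseD D (c _ _ b) _) _).
- exact: (entrywiseM cst D M (c _ _ C^T) E1).
- apply: (entrywiseM cst D M (c _ _ B^T)).
  apply: (entrywiseD D (c _ _ _)).
  apply: (entrywiseM cst D M (c _ _ _)).
  exact: (entrywiseB cst D M E2 (c _ _ _)).
Qed.

(** Transferred to unit 0, the orthogonality of the regression error is the defining property of the
    conditional expectation, and uniqueness applies. *)
Lemma eta0_ae : {ae P, forall w, forall a,
  eta0 w a 0 = (b + C^T *m zs 0%N w + B^T *m xis 0%N w) a 0}.
Proof.
apply: ae_forall => a.
have [_ _ sy] := model_sqintg model.
have mV : measurable_fun setT (fun w => (zs 0%N w, xis 0%N w)) by exact: measurable_fun_pair.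
pose g (t : ('cV[R]_q * 'cV[R]_m)%type) := (b + C^T *m t.1 + B^T *m t.2) a 0.
have mgV : measurable_fun setT (fun t : obs => g (pz t, pxi t)).
  by apply: (measurableT_comp (mreg a)); exact: measurable_fun_pair.
have iy : intg P (fun w => ys 0%N w a 0).
  exact: (intg_transfer mZ (mZs 0%N) idZ (mcol a mpy) (sqintg_intg (sy a))).
have ig : intg P (fun w => g (zs 0%N w, xis 0%N w)).
  exact: (intg_transfer mZ (mZs 0%N) idZ mgV (regression_intg model a)).
apply: (cond_expectation_ae mV (mreg a) (etaP a) iy ig) => D mD.
have mD' : measurable_fun setT (fun t : obs => \1_D (pz t, pxi t) : R).
  by apply: (measurableT_comp (measurable_indic mD)); exact: measurable_fun_pair.
pose h (t : obs) := (py t a 0 - g (pz t, pxi t)) * \1_D (pz t, pxi t).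
have mh : measurable_fun setT h.
  by apply: measurable_funM => //; apply: measurable_funB => //; exact: mcol.
have ih : intg P (fun w => h (Z w)).
  have mzxi : measurable_fun setT (fun w => (z w, xi w)) by exact: measurable_fun_pair.
  apply: (@intgM_indic _ _ _ P (fun w => y w a 0 - g (z w, xi w))
    ((fun w => (z w, xi w)) @^-1` D)).
    by have := mzxi measurableT D mD; rewrite setTI.
  by apply: intgB; [exact: sqintg_intg|exact: regression_intg model a].
rewrite -(regression_error_orthogonal model a mD).
exact/esym/(Ex_transfer mZ (mZs 0%N) idZ mh ih).
Qed.

(** [eta0] is known only up to a null set, so it is replaced by the regression function under the
    expectation; the transferred orthogonality of the prediction error then identifies [etahat0]. *)
Lemma etahat0_ae : {ae P, forall w, forall a,
  etahat0 w a 0 = best (zs 0%N w) (xs 0%N w) a 0}.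
Proof.
apply: ae_forall => a.
have mV : measurable_fun setT (fun w => (zs 0%N w, xs 0%N w)) by exact: measurable_fun_pair.
have mV' : measurable_fun setT (fun w => (zs 0%N w, xis 0%N w)) by exact: measurable_fun_pair.
have [meta ieta _] := etaP a; rewrite -/(intg P (fun w => eta0 w a 0)) in ieta.
pose g (t : ('cV[R]_q * 'cV[R]_m)%type) := best t.1 t.2 a 0.
pose r (t : ('cV[R]_q * 'cV[R]_m)%type) := (b + C^T *m t.1 + B^T *m t.2) a 0.
have mgV : measurable_fun setT (fun t : obs => g (pz t, px t)).
  by apply: (measurableT_comp (mbest a)); exact: measurable_fun_pair.
have mrV : measurable_fun setT (fun t : obs => r (pz t, pxi t)).
  by apply: (measurableT_comp (mreg a)); exact: measurable_fun_pair.
have ig : intg P (fun w => g (zs 0%N w, xs 0%N w)).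
  exact: (intg_transfer mZ (mZs 0%N) idZ mgV (best_predictor_intg model a)).
apply: (cond_expectation_ae mV (mbest a) (etahatP a) ieta ig) => D mD.
have mD' : measurable_fun setT (fun t : obs => \1_D (pz t, px t) : R).
  by apply: (measurableT_comp (measurable_indic mD)); exact: measurable_fun_pair.
pose h (t : obs) := (r (pz t, pxi t) - g (pz t, px t)) * \1_D (pz t, px t).
have mh : measurable_fun setT h.
  by apply: measurable_funM => //; exact: measurable_funB.
have ih : intg P (fun w => h (Z w)).
  have mzx : measurable_fun setT (fun w => (z w, x w)) by exact: measurable_fun_pair.
  apply: (@intgM_indic _ _ _ P (fun w => r (z w, xi w) - g (z w, x w))
    ((fun w => (z w, x w)) @^-1` D)).
    by have := mzx measurableT D mD; rewrite setTI.
  by apply: intgB; [exact: regression_intg model a|exact: best_predictor_intg model a].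
rewrite -[RHS](best_predictor_orthogonal model a mD).
rewrite [RHS](Ex_transfer mZ (mZs 0%N) idZ mh ih).
apply: ae_eq_Ex.
- apply: measurable_funM; last exact: (measurableT_comp mD' (mZs 0%N)).
  apply: measurable_funB; first exact: intg_meas ieta.
  exact: intg_meas ig.
- exact: (measurableT_comp mh (mZs 0%N)).
- by apply: filterS eta0_ae => w /(_ a) ->.
Qed.

Let rs w i := col_mx (zs i w) (xs i w).
Let Srr := block_mx (cov_mx P z) 0 0 (cov_mx P x).
Let Sry := col_mx (cov_mx P z *m C) (cov_mx P xi *m B + (cross_moment P eps delta)^T).

Let Srr_ n w := sample_cov n (rs w) (rs w).
Let Sry_ n w := sample_cov n (rs w) (fun i => ys i w).
Let Sxx_ n w := Sigma_x_hat n (fun i => xs i w).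
Let my_ n w := sample_mean n (fun i => ys i w).
Let mz_ n w := sample_mean n (fun i => zs i w).
Let mx_ n w := sample_mean n (fun i => xs i w).

Lemma sample_moments_ae : {ae P, forall w,
  [/\ forall a c, (fun n => Srr_ n w a c) @ \oo --> Srr a c,
      forall a c, (fun n => Sry_ n w a c) @ \oo --> Sry a c &
      forall a c, (fun n => Sxx_ n w a c) @ \oo --> cov_mx P x a c] /\
  [/\ forall a, (fun n => my_ n w a 0) @ \oo --> mean_vec P y a 0,
      forall a, (fun n => mz_ n w a 0) @ \oo --> mean_vec P z a 0 &
      forall a, (fun n => mx_ n w a 0) @ \oo --> mean_vec P x a 0]}.
Proof.
have [sz sx sy] := model_sqintg model.
have sr a : sqintg P (fun w => pr (Z w) a 0).
  rewrite /pr; case: (split_ordP a) => j ->.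
    by under eq_fun do rewrite col_mxEu; exact: sz.
  by under eq_fun do rewrite col_mxEd; exact: sx.
have Hrr := sample_cov_cvg mZ mZs copies mpr mpr sr sr.
have Hry := sample_cov_cvg mZ mZs copies mpr mpy sr sy.
have Hxx := sample_cov_cvg mZ mZs copies mpx mpx sx sx.
have Hy := sample_mean_cvg mZ mZs copies mpy sy.
have Hz := sample_mean_cvg mZ mZs copies mpz sz.
have Hx := sample_mean_cvg mZ mZs copies mpx sx.
apply: filterS3 (filterI Hrr Hry) (filterI Hxx Hy) (filterI Hz Hx).
move=> w [h1 h2] [h3 h4] [h5 h6]; split; split.
- by move=> a c; rewrite -(cv_r model); exact: h1.
- by move=> a c; rewrite -(cv_r_y model); exact: h2.
- by apply: Sigma_x_hat_cvg => a c; rewrite cov_mxE//; exact: h3.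
- by move=> a; rewrite mean_vecE; exact: h4.
- by move=> a; rewrite mean_vecE; exact: h5.
- by move=> a; rewrite mean_vecE; exact: h6.
Qed.

Let etatilde0 n w : 'cV[R]_d :=
  eta_tilde n (fun i => ys i w) (fun i => zs i w) (fun i => xs i w)
    (cross_moment P eps delta) (zs 0%N w) (xs 0%N w).

(** A measurable stand-in for [etatilde0], equal to it when neither determinant vanishes; this
    bypasses the measurability of [mp_inv], which is obtained by choice. *)
Let plug_in0 n w : 'cV[R]_d :=
  plug_in (Srr_ n w) (Sry_ n w) (Sxx_ n w) (my_ n w) (mz_ n w) (mx_ n w)
    (cross_moment P eps delta) (zs 0%N w) (xs 0%N w).

Lemma etatilde0E n w : \det (Srr_ n w) != 0 -> \det (Sxx_ n w) != 0 ->
  etatilde0 n w = plug_in0 n w.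
Proof. exact: eta_tildeE. Qed.

(** The sample determinants converge to those of the population matrices, nonzero because Sigma_z
    and Sigma_x are nonsingular; they are thus nonzero for large n, with a threshold depending on
    the outcome. *)
Lemma plug_in0_ae : {ae P, forall w,
  [/\ \forall n \near \oo, \det (Srr_ n w) != 0,
      \forall n \near \oo, \det (Sxx_ n w) != 0 &
      forall a, (fun n => plug_in0 n w a 0) @ \oo --> etahat0 w a 0]}.
Proof.
have ux : \det (cov_mx P x) != 0 by rewrite -unitfE -unitmxE (eiv_cov_x model).
have ur : \det Srr != 0.
  by rewrite det_ublock mulf_neq0// -unitfE -unitmxE (eiv_cov_z model).
apply: filterS2 sample_moments_ae etahat0_ae => w [[h1 h2 h3] [h4 h5 h6]] hhat; split.
- exact: cvgr_neq0 (det_cvg h1) ur.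
- exact: cvgr_neq0 (det_cvg h3) ux.
- move=> a; rewrite hhat /best -(plug_in_limit model).
  exact: plug_in_cvg.
Qed.

Lemma etatilde0_cvg : {ae P, forall w, etatilde0 ^~ w @ \oo --> etahat0 w}.
Proof.
apply: filterS plug_in0_ae => w [hr hx hp]; apply: cvg_cV => a.
apply: cvg_trans (hp a); apply: near_eq_cvg.
by near=> n; rewrite etatilde0E//; near: n.
Unshelve. all: by end_near. Qed.

Let cstT (c : R) : measurable_fun setT (fun _ : T => c). Proof. by []. Qed.
Let DT := @measurable_funD _ T R setT.
Let MT := @measurable_funM _ T R setT.

Let measurable_entries_fun k (u : T -> 'cV[R]_k) : measurable_fun setT u ->
  measurable_entries u.
Proof.
by move=> mu i j; rewrite (ord1 j); exact: (measurableT_comp (measurable_coord i) mu).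
Qed.

Let measurable_sample_mean k (u : nat -> T -> 'cV[R]_k) n :
  (forall i, measurable_fun setT (u i)) ->
  measurable_entries (fun w => sample_mean n (fun i => u i w)).
Proof.
move=> mu; apply: (entrywiseZ MT (cstT _)); apply: (entrywise_sum cstT DT) => i.
exact: measurable_entries_fun.
Qed.

Let measurable_crossprod k l (u : nat -> T -> 'cV[R]_k) (v : nat -> T -> 'cV[R]_l) n :
  (forall i, measurable_fun setT (u i)) -> (forall i, measurable_fun setT (v i)) ->
  measurable_entries (fun w => \sum_(1 <= i < n.+1)
    (u i w - sample_mean n (fun i => u i w)) *m (v i w - sample_mean n (fun i => v i w))^T).
Proof.
move=> mu mv; apply: (entrywise_sum cstT DT) => i; apply: (entrywiseM cstT DT MT).
  by apply: (entrywiseB cstT DT MT); [exact: measurable_entries_fun|exact: measurable_sample_mean].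
by apply: entrywise_tr; apply: (entrywiseB cstT DT MT);
  [exact: measurable_entries_fun|exact: measurable_sample_mean].
Qed.

Let measurable_rs i : measurable_fun setT (fun w => rs w i).
Proof.
apply: measurable_cV => j; rewrite /rs; case: (split_ordP j) => j' ->.
  by under eq_fun do rewrite col_mxEu; exact: (measurableT_comp (measurable_coord j')).
by under eq_fun do rewrite col_mxEd; exact: (measurableT_comp (measurable_coord j')).
Qed.

Let measurable_Srr n : measurable_entries (Srr_ n).
Proof.
by apply: (entrywiseZ MT (cstT _)); exact: (measurable_crossprod (u := fun i w => rs w i)).
Qed.

Let measurable_Sry n : measurable_entries (Sry_ n).
Proof.
by apply: (entrywiseZ MT (cstT _)); exact: (measurable_crossprod (u := fun i w => rs w i)).
Qed.

Let measurable_Sxx n : measurable_entries (Sxx_ n).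
Proof. by apply: (entrywiseZ MT (cstT _)); exact: measurable_crossprod. Qed.

Let measurable_det k (M : T -> 'M[R]_k) : measurable_entries M ->
  measurable_fun setT (fun w => \det (M w)).
Proof. exact: closure_det. Qed.

Let measurable_plug_in0 n : measurable_entries (plug_in0 n).
Proof.
apply: (entrywise_plug_in cstT DT MT).
- exact: measurable_Srr.
- exact: measurable_Sry.
- exact: measurable_Sxx.
- exact: (measurableT_comp (@measurable_inv R) (measurable_det (measurable_Srr n))).
- exact: (measurableT_comp (@measurable_inv R) (measurable_det (measurable_Sxx n))).
- exact: measurable_sample_mean.
- exact: measurable_sample_mean.
- exact: measurable_sample_mean.
- exact: measurable_entries_fun.
- exact: measurable_entries_fun.
Qed.

Let measurable_etahat0 a : measurable_fun setT (fun w => etahat0 w a 0).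
Proof.
have [mhat _ _] := etahatP a; apply: measurable_fun_given mhat.
exact: measurable_fun_pair.
Qed.

Lemma cond_probability_etatilde0_cvg tau (p : nat -> T -> R) : 0 < tau ->
  (forall n, (m < n)%N ->
    cond_probability P (fun w => (zs 0%N w, xs 0%N w))
      [set w | tau < enorm (etatilde0 n w - etahat0 w)] (p n)) ->
  {ae P, forall w, p ^~ w @ \oo --> 0}.
Proof.
move=> tau0 pP.
pose dist n w := \sum_a (plug_in0 n w - etahat0 w) a 0 ^+ 2.
(* A measurable event containing the deviation event: off the degenerate samples, [etatilde0] is the
   measurable [plug_in0]. Almost surely it occurs for finitely many n. *)
pose E' n := [set w | \det (Srr_ n w) = 0] `|` [set w | \det (Sxx_ n w) = 0] `|`
  [set w | tau ^+ 2 < dist n w].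
have mV : measurable_fun setT (fun w => (zs 0%N w, xs 0%N w)) by exact: measurable_fun_pair.
apply: (cond_probability_cvg0 mV pP (E' := E')).
- move=> n w /= h; have [r0|r0] := eqVneq (\det (Srr_ n w)) 0; first by left; left.
  have [x0|x0] := eqVneq (\det (Sxx_ n w)) 0; first by left; right.
  by right; move: h; rewrite etatilde0E// enorm_gt.
- move=> n.
  have det0 k (M : T -> 'M[R]_k) : measurable_entries M -> measurable [set w | \det (M w) = 0].
    move=> mM; have := measurable_det mM measurableT (measurable_set1 (0 : R)).
    by rewrite setTI.
  apply: measurableU; first by apply: measurableU; exact: det0.
  have mdist : measurable_fun setT (dist n).
    apply: measurable_sum => a; apply: measurable_funX.
    under eq_fun do rewrite mxE [X in _ + X]mxE.
    by apply: measurable_funB; [exact: measurable_plug_in0|exact: measurable_etahat0].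
  have := measurable_fun_ltr (measurable_cst (tau ^+ 2)) mdist.
  by move=> /(_ measurableT [set true]); rewrite setTI; apply.
- apply: filterS plug_in0_ae => w [hr hx hp].
  have hd : (fun n => dist n w) @ \oo --> (0 : R).
    pose u a o := if o is Some n then (plug_in0 n w - etahat0 w) a 0 else 0.
    have cu a : @cvg_none R (u a).
      rewrite /cvg_none /u -(subrr (etahat0 w a 0)).
      under eq_fun do rewrite mxE [X in _ + X]mxE.
      by apply: cvgB; [exact: hp|exact: cvg_cst].
    have := closure_sum (@cvg_none_cst R) (@cvg_noneD R) (index_enum 'I_d) xpredT
      (fun a => cvg_noneM (cu a) (cu a)).
    by rewrite /cvg_none /u big1// => a _; rewrite mul0r.
  near=> n; rewrite /E' => -[[/eqP|/eqP]|] /=.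
  + by apply/negP; near: n.
  + by apply/negP; near: n.
  + apply/negP; rewrite -leNgt; near: n.
    by move/cvgrPdistC_le : hd => /(_ _ (exprn_gt0 2 tau0)); apply: filterS => n;
      rewrite subr0; apply: le_trans; exact: ler_norm.
Unshelve. all: by end_near. Qed.

End copies_of_model.

Theorem theorem3 (dT : measure_display) (T : measurableType dT) (R : realType)
  (P : probability T R) (d q m : nat)
  (b : 'cV[R]_d) (C : 'M[R]_(q, d)) (B : 'M[R]_(m, d))
  (y : {RV P >-> 'cV[R]_d}) (z : {RV P >-> 'cV[R]_q})
  (xi : {RV P >-> 'cV[R]_m}) (e eps : {RV P >-> 'cV[R]_d})
  (x delta : {RV P >-> 'cV[R]_m})
  (ys : nat -> {RV P >-> 'cV[R]_d}) (zs : nat -> {RV P >-> 'cV[R]_q})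
  (xis : nat -> {RV P >-> 'cV[R]_m}) (es epss : nat -> {RV P >-> 'cV[R]_d})
  (xs deltas : nat -> {RV P >-> 'cV[R]_m})
  (eta0 etahat0 : T -> 'cV[R]_d) :
  eiv_model b C B y z xi e eps x delta ->
  independent_copies P
    (fun w => (y w, z w, xi w, e w, eps w, x w, delta w))
    (fun i w => (ys i w, zs i w, xis i w, es i w, epss i w, xs i w, deltas i w)) ->
  cond_expectation_cV P (fun w => (zs 0%N w, xis 0%N w)) (ys 0%N) eta0 ->
  cond_expectation_cV P (fun w => (zs 0%N w, xs 0%N w)) eta0 etahat0 ->
  let etatilde0 (n : nat) (w : T) : 'cV[R]_d :=
    eta_tilde n (fun i => ys i w) (fun i => zs i w) (fun i => xs i w)
      (cross_moment P eps delta) (zs 0%N w) (xs 0%N w) in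
  {ae P, forall w, etatilde0 ^~ w @ \oo --> etahat0 w} /\
  (forall tau : R, 0 < tau ->
    forall p : nat -> T -> R,
    (forall n, (m < n)%N ->
      cond_probability P (fun w => (zs 0%N w, xs 0%N w))
        [set w | tau < enorm (etatilde0 n w - etahat0 w)] (p n)) ->
    {ae P, forall w, p ^~ w @ \oo --> 0}).
Proof.
move=> model copies etaP etahatP etatilde0; split.
  exact: (etatilde0_cvg model copies etaP etahatP).
by move=> tau tau0 p; exact: (cond_probability_etatilde0_cvg model copies etaP etahatP tau0).
Qed.
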